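(* For each $N\ge1$ let $U_N$ be a random matrix Haar distributed on the unitary group $\mathrm U(N)$ or on the orthogonal group $\mathrm O(N)$. Let $\mathcal A_0^N=(A_i^N)_{i\in\mathcal I_0}$ be a finite deterministic collection of tensors, $A_i^N\in\mathcal E^N_{\ell_0(i)}$ with $\mathcal I_0$ finite and $\mathcal I_0,\ell_0$ not depending on $N$, stable under entrywise complex conjugation. Assume (A1): for every $\mathcal I_0$-map $\mathfrak m\in\mathcal M_0(\mathcal I_0)$ there is a constant $C(\mathfrak m)$ such that $|\mathfrak m(\mathcal A_0^N)|\le C(\mathfrak m)$ for all $N\ge1$. Then the families $\mathcal A^N_0$ and $\{U_N,U_N^*\}$ (elements of $\mathcal E^N_2$) are asymptotically free in probability as $N\to\infty$.
   Context: Maps. $[n]=\{1,\dots,n\}$. A (combinatorial) map is a pair $\mathfrak m=(\pi,\alpha)$ of permutations of a set $\vec E(\mathfrak m)=[m]$ of half-edges, $\alpha$ an involution ($\alpha^2=\mathrm{id}$, fixed points allowed). The cycles of $\pi$ are the vertices, forming $V(\mathfrak m)$ and ordered by least element; $\partial v=(e_1,\dots,e_p)$ is the cycle of $v$ started at its least element (the half-edges attached to $v$), and $\deg(v)=p$. Fixed points of $\alpha$ are the boundary edges, which are ordered (by default lexicographically); the 2-cycles of $\alpha$ are the edges. $E(\mathfrak m)$ is the set of all cycles of $\alpha$. $\mathcal M_q$ is the set of maps with $q$ boundary edges; $\gamma(\mathfrak m)$ is the number of connected components. For a set $I$ with an order function $\ell:I\to\{1,2,\dots\}$, an $I$-map is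 a map with a label $w_v\in I$ on each vertex such that $\ell(w_v)=\deg(v)$; $\mathcal M_q(I)$ is the set of $I$-maps with $q$ boundary edges. Trace action. $\mathcal E^N_p=(\mathbb C^N)^{\otimes p}$ with elements $x=(x_i)_{i\in[N]^p}$, $\mathcal E^N_0=\mathbb C$. For $\mathfrak m\in\mathcal M_q$ with boundary edges $\partial$ and $x_v\in\mathcal E^N_{\deg(v)}$, $\mathfrak m((x_v)_v)\in\mathcal E^N_q$ is $\mathfrak m((x_v)_v)_{i_\partial}=N^{-\gamma}\sum_{i\in[N]^{E(\mathfrak m)\setminus\partial}}\prod_{v}(x_v)_{i_{\partial v}}$, where $i_{\partial v}$ is the tuple of indices of the elements of $E(\mathfrak m)$ containing the half-edges of $\partial v$, $\gamma=0$ if $q\ge1$ and $\gamma=\gamma(\mathfrak m)$ if $q=0$. For a family $\mathcal A^N=(A^N_i)_{i\in I}$ with $A_i^N\in\mathcal E^N_{\ell(i)}$ and an $I$-map $\mathfrak m$, $\mathfrak m(\mathcal A^N)$ is this value with $x_v=A^N_{w_v}$. Poset of maps. Two maps $(\pi,\alpha),(\pi,\alpha')\in\mathcal M_0$ differ by a switch if $\alpha'\alpha$ is a product of two disjoint transpositions (two edges are replaced by two other edges on the same four half-edges). If moreover $\gamma(\mathfrak m)=\gamma(\mathfrak m')+1$ one writes $\mathfrak m<\mathfrak m'$; $<$ is extended by transitivity. A map is minimal if no map is strictly smaller. Coloured maps. Let each vertex $v$ of $\mathfrak m\in\mathcal M_0$ have a colour $c(v)\in\mathcal C$. A component is monochromatic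 if all its vertices have the same colour. A switch of the two edges joining $u_1,u_2$ and $u_3,u_4$ in $\mathfrak m$ is chromatic if $c(u_1)\ne c(u_2)$, $c(u_3)\neq c(u_4)$ and $\{c(u_1),c(u_2)\}\cap\{c(u_3),c(u_4)\}\ne\emptyset$. An admissible descendant of $\mathfrak m$ is a map $\widehat{\mathfrak m}\le\mathfrak m$ such that: (P1) each connected component of $\widehat{\mathfrak m}$ is monochromatic or minimal non-monochromatic; (P2) if $\widehat{\mathfrak m}\neq\mathfrak m$, there is a path $\mathfrak m=\mathfrak m_0>\mathfrak m_1>\dots>\mathfrak m_t=\widehat{\mathfrak m}$ such that for all $1\le i\le t$, $\mathfrak m_{i-1}$ and $\mathfrak m_i$ differ by a chromatic switch and $\mathfrak m_{i-1}$ does not satisfy (P1). Asymptotic freeness in probability. Let $\mathcal C$ be finite and, for $c\in\mathcal C$, let $\mathcal A^N_c=(a^N_{i})_{i\in\mathcal I_c}$ be (possibly random) families with $\mathcal I_c$ finite and $a_i^N\in\mathcal E^N_{\ell(i)}$. $\mathbb C[\mathcal M_q(\mathcal I_c)]$ is the set of finite formal complex linear combinations of $\mathcal I_c$-maps with $q$ boundary edges (with coefficients not depending on $N$), evaluated on $\mathcal A^N_c$ by linearity. The families are asymptotically free in probability if the following holds for all finite $\mathcal J=\bigsqcup_{c}\mathcal J_c$, all $k:\mathcal J\to\{1,2,\dots\}$, all $\mathfrak p=(\mathfrak p_j)_{j\in\mathcal J}$ with $\mathfrak p_j\in\mathbb C[\mathcal M_{k(j)}(\mathcal I_c)]$ for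 $j\in\mathcal J_c$, and all $\mathcal J$-maps $\mathfrak m\in\mathcal M_0(\mathcal J)$ (with order function $k$), where a vertex labelled by $j\in\mathcal J_c$ has colour $c$ and carries the tensor $\mathfrak p_j(\mathcal A_c^N)$: if every admissible descendant $\widehat{\mathfrak m}$ of $\mathfrak m$ has a minimal non-monochromatic connected component or a monochromatic connected component whose value (trace action) tends to $0$ in probability (asymptotically centered), then the value $\mathfrak m(\mathfrak p(\mathcal A^N))$ tends to $0$ in probability as $N\to\infty$.
   Formalization: In the definition of asymptotic freeness, the maps occurring in the linear combinations 𝔭_j are required to be connected; with disconnected maps (e.g. U together with a closed component of value Tr(UU* )=N) the statement fails. *)

(* Defs.v *)
From HB Require Import structures.
From Stdlib Require Import Relation_Operators.
From mathcomp Require Import all_boot all_order all_algebra all_fingroup.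
From mathcomp Require Import complex spectral.
From mathcomp Require Import all_classical all_reals all_analysis.

Set Implicit Arguments.
Unset Strict Implicit.
Unset Printing Implicit Defensive.

Import Order.TTheory GRing.Theory Num.Theory.
Import numFieldNormedType.Exports.
Local Open Scope ring_scope.

(* The half-edges [m] are encoded as 'I_m; only their order matters. *)

Record cmap (m : nat) := CMap {
  vperm : {perm 'I_m};
  einv : {perm 'I_m};
  einvK : [forall h, einv (einv h) == h]
}.

Section Cmap.
Context {m : nat}.
Implicit Types (M : cmap m) (h : 'I_m).

(* h is the least element of its cycle, so that these h enumerate V(M). *)
Definition vroot M h := [forall x in porbit (vperm M) h, h <= x]%N.

Definition boundary M : {set 'I_m} := [set h | einv M h == h].

Definition in_M0 M := boundary M == finset.set0.

Definition adj M : rel 'I_m :=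
  [rel x y | (y == vperm M x) || (y == einv M x)].

(* vperm and einv being permutations of a finite set, forward reachability is
   already symmetric. *)
Definition comp M h : {set 'I_m} := [set x | connect (adj M) h x].

Definition ncomp M : nat := #|[set comp M h | h : 'I_m]|.

Definition connected_map M := ncomp M == 1%N.

End Cmap.

Section Restriction.
Variables (m : nat) (K : {set 'I_m}) (s : {perm 'I_m}).
Hypothesis sK : forall x, x \in K -> s x \in K.

Definition restr_fun (i : 'I_#|K|) : 'I_#|K| :=
  enum_rank_in (sK (enum_valP i)) (s (enum_val i)).

Lemma restr_funE i : enum_val (restr_fun i) = s (enum_val i).
Proof. by rewrite enum_rankK_in ?sK ?enum_valP. Qed.

Lemma restr_fun_inj : injective restr_fun.
Proof.
move=> i j /(congr1 enum_val); rewrite !restr_funE.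
by move=> /perm_inj /enum_val_inj.
Qed.

Definition restr : {perm 'I_#|K|} := perm restr_fun_inj.

End Restriction.

Section Component.
Variables (m : nat) (M : cmap m) (h : 'I_m).

Lemma comp_vperm x : x \in comp M h -> vperm M x \in comp M h.
Proof.
rewrite !inE => hx; apply: (connect_trans hx); apply: connect1.
by rewrite /adj /= eqxx.
Qed.

Lemma comp_einv x : x \in comp M h -> einv M x \in comp M h.
Proof.
rewrite !inE => hx; apply: (connect_trans hx); apply: connect1.
by rewrite /adj /= eqxx orbT.
Qed.

Lemma component_einvK :
  [forall i, restr comp_einv (restr comp_einv i) == i].
Proof.
apply/forallP => i; apply/eqP/enum_val_inj.
by rewrite !permE !restr_funE (eqP (forallP (einvK M) _)).
Qed.

(* The connected component of h as a map of its own: its half-edges are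
   relabelled increasingly through enum_val. *)
Definition component : cmap #|comp M h| :=
  {| vperm := restr comp_vperm; einv := restr comp_einv;
     einvK := component_einvK |}.

End Component.

Section Poset.
Context {m : nat}.
Implicit Types M : cmap m.

Definition switch M M' : Prop :=
  [/\ in_M0 M, in_M0 M', vperm M = vperm M' &
      exists a b c d : 'I_m, uniq [:: a; b; c; d] /\
        (einv M * einv M' = tperm a b * tperm c d)%g].

Definition map_lt1 M M' : Prop := switch M M' /\ ncomp M = (ncomp M').+1.

Definition map_lt : cmap m -> cmap m -> Prop := clos_trans (cmap m) map_lt1.

Definition map_le M M' : Prop := M = M' \/ map_lt M M'.

Definition minimal M : Prop := forall M', ~ map_lt M' M.

End Poset.

(* A colouring of the vertices is given by the colour [col h] of the vertex to
   which the half-edge h is attached. *)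

Section Coloured.
Context {m : nat} {Col : eqType}.
Variable col : 'I_m -> Col.
Implicit Types M : cmap m.

Definition monochromatic M h : Prop :=
  forall x, x \in comp M h -> col x = col h.

Definition minimal_non_mono M h : Prop :=
  ~ monochromatic M h /\ minimal (component M h).

(* The two switched edges of M are {h1, einv M h1} and {h2, einv M h2}; they
   are the two edges on which einv M and einv M' differ. *)
Definition chromatic_switch M M' : Prop :=
  switch M M' /\
  exists h1 h2 : 'I_m,
    [/\ h2 != h1 /\ h2 != einv M h1,
        einv M' h1 != einv M h1 /\ einv M' h2 != einv M h2,
        col h1 != col (einv M h1), col h2 != col (einv M h2) &
        has (mem [:: col h2; col (einv M h2)])
            [:: col h1; col (einv M h1)]].

Definition P1 M : Prop :=
  forall h, monochromatic M h \/ minimal_non_mono M h.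

Definition admissible_step M M' : Prop :=
  [/\ map_lt M' M, chromatic_switch M M' & ~ P1 M].

Definition admissible_descendant M Mhat : Prop :=
  [/\ map_le Mhat M, P1 Mhat &
      Mhat <> M -> clos_trans (cmap m) admissible_step M Mhat].

End Coloured.

(* The label of a vertex is carried by each of its half-edges.  The boundary
   edges come with an arbitrary order, recorded by [bnd]. *)

Record imap (I : Type) (ell : I -> nat) (q : nat) := IMap {
  halfedges : nat;
  imap_map :> cmap halfedges;
  lab : 'I_halfedges -> I;
  lab_vperm : forall h, lab (vperm imap_map h) = lab h;
  lab_deg : forall h, #|porbit (vperm imap_map) h| = ell (lab h);
  bnd : q.-tuple 'I_halfedges;
  bnd_uniq : uniq bnd;
  bndE : bnd =i boundary imap_map
}.

Definition cplx (R : realType) : numClosedFieldType := R[i].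

Definition tensor (R : realType) (N p : nat) :=
  {ffun 'I_p -> 'I_N} -> cplx R.

Definition scalar_of (R : realType) (N : nat) (x : tensor R N 0) : cplx R :=
  x (ffun0 (card_ord 0)).

Definition matrix_tensor (R : realType) (N : nat) (X : 'M[cplx R]_N) :
  tensor R N 2 := fun i => X (i ord0) (i ord_max).

Section TraceAction.
Variables (R : realType) (N : nat) (I : Type) (ell : I -> nat).
Variable x : forall i : I, tensor R N (ell i).

(* An element of [N]^E(M) is an einv-invariant function on half-edges.  When
   ell (w h) is the degree of the vertex with least half-edge h, the tuple
   (iter t (vperm M) h)_t is the whole cycle of that vertex. *)
Definition trace_action (m q : nat) (M : cmap m) (w : 'I_m -> I)
    (b : q.-tuple 'I_m) : tensor R N q :=
  fun j =>
    N%:R ^- (if q == 0%N then ncomp M else 0%N) *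
    \sum_(i : {ffun 'I_m -> 'I_N} |
            [forall h, i (einv M h) == i h] &&
            [forall t : 'I_q, i (tnth b t) == j t])
      \prod_(h : 'I_m | vroot M h)
        x [ffun t : 'I_(ell (w h)) => i (iter t (vperm M) h)].

Definition imap_value (q : nat) (M : imap ell q) : tensor R N q :=
  trace_action M (lab (i:=M)) (bnd M).

End TraceAction.

(* Finite formal complex linear combinations of I-maps, as lists of weighted
   maps. *)
Definition lincomb (R : realType) (I : Type) (ell : I -> nat) (q : nat) :=
  seq (cplx R * imap ell q).

Definition lincomb_value (R : realType) (N : nat) (I : Type) (ell : I -> nat)
    (x : forall i : I, tensor R N (ell i)) (q : nat) (p : lincomb R ell q) :
  tensor R N q :=
  fun j => \sum_(t <- p) t.1 * imap_value x t.2 j.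

Local Open Scope classical_set_scope.

(* Each dimension N may come with its own probability space. *)

Section InProbability.
Variables (R : realType) (d : nat -> measure_display).
Variables (T : forall N, measurableType (d N)).
Variables (P : forall N, probability (T N) R).

Definition cvg0_in_probability (X : forall N, T N -> cplx R) : Prop :=
  forall eps : R, 0 < eps ->
    (fun N => P N [set w | eps%:C%C <= `|X N w|]) @ \oo --> 0%E.

(* The family A_c^N is A N w c, with w the point of the probability space.

   The maps with k j >= 1 boundary edges occurring in p j are taken connected.
   A map with boundary is not normalised (see [trace_action]), so a
   disconnected one would reintroduce coefficients depending on N: a vertex U
   together with a closed component carrying Tr (U U^* ) = N evaluates to N U,
   and asymptotic freeness then fails already for matrices, since for
   traceless diagonal A with A^2 = 1 the variable N tr (A U A U^* ) does not
   tend to 0. *)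
Definition asymptotically_free_in_probability (Col : finType)
    (I : Col -> finType) (ell : forall c, I c -> nat)
    (A : forall N, T N -> forall c (i : I c), tensor R N (ell c i)) : Prop :=
  forall (J : finType) (col : J -> Col) (k : J -> nat),
  (forall j, (0 < k j)%N) ->
  forall (p : forall j, lincomb R (ell (col j)) (k j)),
  (forall j, all (fun t => connected_map (imap_map t.2)) (p j)) ->
  forall M : imap k 0,
  let colour h := col (lab (i:=M) h) in
  let pA N w j := lincomb_value (A N w (col j)) (p j) in
  (forall Mhat, admissible_descendant colour M Mhat ->
     exists h : 'I_(halfedges M),
       minimal_non_mono colour Mhat h \/
       (monochromatic colour Mhat h /\
        cvg0_in_probability (fun N w =>
          scalar_of (trace_action (pA N w) (component Mhat h)
                    (fun i => lab (i:=M) (enum_val i)) [tuple])))) ->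
  cvg0_in_probability (fun N w => scalar_of (imap_value (pA N w) M)).

End InProbability.

Definition unitary_group (R : realType) (N : nat) : set 'M[cplx R]_N :=
  [set X | X \is unitarymx].

Definition orthogonal_group (R : realType) (N : nat) : set 'M[cplx R]_N :=
  [set X | X \is a realmx /\ X *m X^T = 1%:M].

(* The law of U, on the Borel sets of 'M_N, is carried by the group G and
   invariant under left translations by elements of G. *)
Definition haar_distributed (R : realType) (d : measure_display)
    (T : measurableType d) (P : probability T R) (N : nat)
    (G : set 'M[cplx R]_N) (U : T -> 'M[cplx R]_N) : Prop :=
  let borel : set (set 'M[cplx R]_N) := <<s open >> in
  [/\ forall B, borel B -> measurable (U @^-1` B),
      P (U @^-1` G) = 1%E &
      forall V, G V -> forall B, borel B ->
        P [set w | B (V *m U w)] = P [set w | B (U w)]].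

(* Colour [false] is the family of deterministic tensors, colour [true] the
   family {U, U^* }, indexed by [bool]. *)

Definition two_index (I0 : finType) (c : bool) : finType :=
  if c then (bool : finType) else I0.

Definition two_order (I0 : finType) (ell0 : I0 -> nat) (c : bool) :
    two_index I0 c -> nat :=
  if c return two_index I0 c -> nat then fun=> 2%N else ell0.

Local Open Scope sesquilinear_scope.

Definition two_families (R : realType) (N : nat) (I0 : finType)
    (ell0 : I0 -> nat) (A0 : forall i : I0, tensor R N (ell0 i))
    (U : 'M[cplx R]_N) (c : bool) :
    forall i : two_index I0 c, tensor R N (two_order ell0 i) :=
  if c return forall i : two_index I0 c, tensor R N (two_order ell0 i)
  then fun b : bool => matrix_tensor (if b then U else U ^t*)
  else A0.

Definition stable_under_conj (R : realType) (N : nat) (I0 : finType)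
    (ell0 : I0 -> nat) (A0 : forall i : I0, tensor R N (ell0 i)) : Prop :=
  forall i, exists (i' : I0) (e : ell0 i = ell0 i'),
    forall t : {ffun 'I_(ell0 i') -> 'I_N},
      A0 i' t = (A0 i [ffun s => t (cast_ord e s)])^*.

(* Main.v *)
Require Import Defs.
From Stdlib Require Import Relation_Operators.
From mathcomp Require Import all_boot all_order all_algebra all_fingroup.
From mathcomp Require Import complex spectral archimedean.
From mathcomp Require Import all_classical all_reals all_analysis.
From mathcomp Require Import measurable_realfun.
From mathcomp Require Import ring lra zify.

(* Left invariance of the law of U gives invariance under U -> V U V^T for the
   real plane rotations V, so that the derivatives along such V of polynomials
   in the entries of U have mean 0. For the value of a map this is a loop
   equation: given an edge joining the two colours, N - 1 times the mean of the
   (unnormalised) value of the map is a signed sum of the means of the maps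
   obtained by switching this edge with the other edges joining the two colours.
   After normalisation by N^-gamma, a switch that creates a component has
   weight of order 1 and every other switch has weight O(1/N).

   By induction on the number of edges joining the two colours, the loop
   equation bounds the mean of every map by those of the maps whose edges join
   vertices of the same colour; these are bounded by (A1) for the tensors and by
   unitarity for U. Applied inside a component that is neither monochromatic nor
   minimal, the equation replaces a map, up to O(1/N), by smaller maps obtained
   by chromatic switches; iterating this reaches admissible descendants. In a
   minimal non-monochromatic component no switch creates a component, so that
   the value is O(1/N).

   For convergence in probability one descends from the second moment, the mean
   of the disjoint union of m and its complex conjugate, in the m part only. A
   descendant with a monochromatic component tending to 0 in probability
   contributes o(1) by Cauchy-Schwarz, since this component is bounded and the
   rest has a bounded second moment. *)

Set Implicit Arguments.
Unset Strict Implicit.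
Unset Printing Implicit Defensive.

Import Order.TTheory GRing.Theory Num.Theory.
Import numFieldNormedType.Exports.
Local Open Scope ring_scope.
Local Open Scope sesquilinear_scope.

(** * Components of a pair of permutations and switches *)

(** An infinitesimal rotation acts on a tensor leg by leg, and the two ends of a contracted edge
    cancel because the generator is antisymmetric. Hence a map in [U] and its adjoint, with free
    legs, is again a tensor whose derivative is a sum over its free legs, and the loop equation can
    be written directly for the vertices [p j], whatever they are made of. They are expanded into
    maps in the original families only to bound maps without bichromatic edges, where connectedness
    of the substituted maps keeps the power of N right. Conjugation by V, rather than
    multiplication, makes both legs of [U] turn in the same way, and V is real so that conjugate
    entries turn like the entries themselves. The orthogonal matrices lie in both groups, so one
    argument covers the two cases. Since Haar measure is given as left invariant only, invariance
    under conjugation has to be proved. Complex conjugates enter through second moments: vertices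
    carry a flag for them, which preserves unitarity on [U] and is absorbed by stability under
    conjugation on the tensors. *)

Section GraphComponents.
Variables (H : finType).
Implicit Types (p a : {perm H}) (x y h l : H).

Definition gadj p a : rel H := [rel x y | (y == p x) || (y == a x)].
Definition gcomp p a h : {set H} := [set x | connect (gadj p a) h x].
Definition gncomp p a : nat := #|[set gcomp p a h | h : H]|.

Definition invariant_fun (X : Type) p a (f : H -> X) :=
  (forall x, f (p x) = f x) /\ (forall x, f (a x) = f x).

Lemma gadj_sym p a : connect_sym (gadj p a).
Proof.
suff W x y : connect (gadj p a) x y -> connect (gadj p a) y x.
  by move=> x y; apply/idP/idP; apply: W.
case/connectP=> s + ->{y}; elim: s x => //= z s IH x /andP[xz /IH zs].
apply: (connect_trans zs).
have back (q : {perm H}) : subrel (frel q) (gadj p a) ->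
    connect (gadj p a) (q x) x.
  move=> sq; apply: (connect_sub (e := frel q)) => [u v /sq|]; first exact: connect1.
  by rewrite fconnect_sym ?fconnect1 //; apply: perm_inj.
case/orP: xz => /eqP->; apply: back => u v /eqP <-; rewrite /gadj /= eqxx ?orbT //.
Qed.

Lemma gcomp_refl p a h : h \in gcomp p a h.
Proof. by rewrite inE connect0. Qed.

Lemma gcomp_eq p a h l : l \in gcomp p a h -> gcomp p a l = gcomp p a h.
Proof.
rewrite inE => hl; apply/setP => x; rewrite !inE.
by rewrite (same_connect (gadj_sym p a) hl).
Qed.

Lemma gcomp_mem p a h l : gcomp p a l = gcomp p a h -> l \in gcomp p a h.
Proof. by move=> <-; apply: gcomp_refl. Qed.

Lemma gcomp_memE p a h x : (x \in gcomp p a h) = (gcomp p a x == gcomp p a h).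
Proof. by apply/idP/eqP; [apply: gcomp_eq | apply: gcomp_mem]. Qed.

Lemma gcomp_p p a h : gcomp p a (p h) = gcomp p a h.
Proof. by apply: gcomp_eq; rewrite inE connect1 // /gadj /= eqxx. Qed.

Lemma gcomp_a p a h : gcomp p a (a h) = gcomp p a h.
Proof. by apply: gcomp_eq; rewrite inE connect1 // /gadj /= eqxx orbT. Qed.

Lemma invariant_connect (X : Type) p a (f : H -> X) h x :
  invariant_fun p a f -> x \in gcomp p a h -> f x = f h.
Proof.
move=> [fp fa]; rewrite inE => /connectP[s + ->].
elim: s h => //= y s IH h /andP[hy /IH ->].
by case/orP: hy => /eqP->.
Qed.

Let some_inj (X : Type) : injective (@Some X). Proof. by move=> x y []. Qed.

(** An invariant function factors through the components. Comparisons of component counts rest on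
    this: the components of one map are turned into an invariant function for another. *)
Lemma card_invariant (X : finType) p a (f : H -> X) :
  invariant_fun p a f -> (#|[set f h | h : H]| <= gncomp p a)%N.
Proof.
move=> fI; pose g (C : {set H}) := omap f [pick x in C].
rewrite /gncomp -(card_imset _ (@some_inj X)).
apply: leq_trans (leq_imset_card g _); apply: subset_leq_card.
apply/fintype.subsetP => _ /imsetP[_ /imsetP[h _ ->] ->].
apply/imsetP; exists (gcomp p a h); first exact: imset_f.
rewrite /g; case: pickP => [x /(invariant_connect fI) /= -> //|/(_ h)].
by rewrite gcomp_refl.
Qed.

Lemma gncomp_le_card p a : (gncomp p a <= #|H|)%N.
Proof. exact: leq_imset_card. Qed.

End GraphComponents.

Section Switching.
Variables (H : finType) (p a : {perm H}).
Hypothesis aK : involutive a.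

(** Products of permutations act from left to right: the edges [{h, a h}] and [{l, a l}] become
    [{h, a l}] and [{l, a h}]. The other way to re-pair these half-edges is [sw a h (a l)]. *)
Definition sw (a : {perm H}) (h l : H) : {perm H} :=
  (a * (tperm h l * tperm (a h) (a l)))%g.

Variables h l : H.
Hypotheses (ah : a h != h) (al : a l != l) (lh : l != h) (lah : l != a h).

Let alh : a l != h. Proof. by apply: contraNneq lah => <-; rewrite aK. Qed.

Lemma sw_h : sw a h l h = a l.
Proof. by rewrite /sw !permM [tperm h l _]tpermD ?tpermL // eq_sym. Qed.

Lemma sw_ah : sw a h l (a h) = l.
Proof.
by rewrite /sw !permM aK tpermL tpermD // eq_sym // eq_sym // eq_sym.
Qed.

Lemma sw_l : sw a h l l = a h.
Proof. by rewrite /sw !permM [tperm h l _]tpermD ?tpermR // eq_sym. Qed.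

Lemma sw_al : sw a h l (a l) = h.
Proof. by rewrite /sw !permM aK tpermR tpermD. Qed.

Lemma sw_other x : x != h -> x != a h -> x != l -> x != a l -> sw a h l x = a x.
Proof.
move=> xh xah xl xal; rewrite /sw !permM.
have axh : h != a x by apply: contraNneq xah => ->; rewrite aK.
have axl : l != a x by apply: contraNneq xal => ->; rewrite aK.
by rewrite !tpermD // (inj_eq perm_inj) eq_sym.
Qed.

Variant sw_spec x : H -> Type :=
  | SwH of x = h : sw_spec x (a l)
  | SwAH of x = a h : sw_spec x l
  | SwL of x = l : sw_spec x (a h)
  | SwAL of x = a l : sw_spec x h
  | SwO of x != h & x != a h & x != l & x != a l : sw_spec x (a x).

Lemma swP x : sw_spec x (sw a h l x).
Proof.
case: (eqVneq x h) => [->|xh]; first by rewrite sw_h; constructor.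
case: (eqVneq x (a h)) => [->|xah]; first by rewrite sw_ah; constructor.
case: (eqVneq x l) => [->|xl]; first by rewrite sw_l; constructor.
case: (eqVneq x (a l)) => [->|xal]; first by rewrite sw_al; constructor.
by rewrite sw_other //; constructor.
Qed.

Lemma swK : involutive (sw a h l).
Proof.
move=> x; case: (swP x) => [->|->|->|->|xh xah xl xal];
  rewrite ?sw_al ?sw_l ?sw_ah ?sw_h //.
by rewrite sw_other ?aK // (can2_eq aK aK) ?aK.
Qed.

Lemma sw_fpf : (forall x, a x != x) -> forall x, sw a h l x != x.
Proof.
move=> af x; case: (swP x) => [->|->|->|->|*] //.
- by rewrite eq_sym.
- by rewrite eq_sym.
Qed.

(** Here the four switched half-edges lie in one new component, so the new component of a half-edge
    is already invariant under [a]. *)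
Lemma gncomp_sw_merge : gcomp p (sw a h l) h = gcomp p (sw a h l) (a h) ->
  (gncomp p (sw a h l) <= gncomp p a)%N.
Proof.
move=> e; apply: card_invariant.
split=> x; first by rewrite gcomp_p.
have := gcomp_a p (sw a h l) x; case: (swP x) => [->|->|->|->|//].
- by [].
- by move=> _; rewrite aK.
- move=> <-; rewrite -e -(gcomp_a p _ (a l)) sw_al //.
- by move=> <-; rewrite aK e -(gcomp_a p _ (a h)) sw_ah.
Qed.

(** Gluing the new components of [h] and [a h] gives a function invariant under the old matching, at
    the cost of at most one value. *)
Let r1 x := if gcomp p (sw a h l) x == gcomp p (sw a h l) h
            then gcomp p (sw a h l) (a h) else gcomp p (sw a h l) x.

Let gl : gcomp p (sw a h l) l = gcomp p (sw a h l) (a h).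
Proof. by rewrite -(gcomp_a p _ (a h)) sw_ah. Qed.
Let gal : gcomp p (sw a h l) (a l) = gcomp p (sw a h l) h.
Proof. by rewrite -(gcomp_a p _ h) sw_h. Qed.

Let r1_inv : invariant_fun p a r1.
Proof.
rewrite /r1; split=> x; first by rewrite gcomp_p.
have := gcomp_a p (sw a h l) x; case: (swP x) => [->|->|->|->|_ _ _ _ ->//] _.
- by rewrite eqxx; case: ifP.
- by rewrite aK eqxx; case: ifP.
- by rewrite gal gl eqxx; case: ifP.
- by rewrite aK gal gl eqxx; case: ifP.
Qed.

Let r1_card : (gncomp p (sw a h l) <= #|[set r1 x | x : H]|.+1)%N.
Proof.
rewrite /gncomp (cardsD1 (gcomp p (sw a h l) h)) imset_f // add1n ltnS.
apply: subset_leq_card; apply/fintype.subsetP => C /setD1P[Ch /imsetP[x _ Cx]].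
by apply/imsetP; exists x => //; rewrite /r1 -Cx (negPf Ch).
Qed.

Lemma gncomp_sw_le : (gncomp p (sw a h l) <= (gncomp p a).+1)%N.
Proof. by apply: leq_trans r1_card _; rewrite ltnS card_invariant. Qed.

(** The value lost by the gluing [r1] is recovered by recording membership in the old component of
    [h]. *)
Lemma gncomp_sw_far : l \notin gcomp p a h ->
  (gncomp p (sw a h l) <= gncomp p a)%N.
Proof.
move=> lK; have [/gncomp_sw_merge //|ne] :=
  eqVneq (gcomp p (sw a h l) h) (gcomp p (sw a h l) (a h)).
pose f x := (r1 x, x \in gcomp p a h).
have fI : invariant_fun p a f.
  case: r1_inv => rp ra; split=> x; rewrite /f ?rp ?ra; congr pair.
    by rewrite !gcomp_memE gcomp_p.
  by rewrite !gcomp_memE gcomp_a.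
apply: leq_trans (card_invariant fI); apply: leq_trans r1_card _.
(* [h] and [l] have the same glued component but different flags, so forgetting the flag identifies
   two values. *)
rewrite (cardsD1 (r1 h, false)) (_ : _ \in _ = true); last first.
  apply/imsetP; exists l => //; rewrite /f (negPf lK); congr pair.
  by rewrite /r1 eqxx gl; case: eqP.
rewrite add1n ltnS.
have -> : [set r1 x | x : H] = [set q.1 | q in [set f x | x : H] :\ (r1 h, false)].
  apply/setP => C; apply/imsetP/imsetP => [[x _ ->]|[q /setD1P[_ /imsetP[x _ ->]] ->]].
    have [xx|] := boolP (f x == (r1 h, false)).
      exists (f h); rewrite ?imset_f // ?inE; last by case/eqP: xx.
      by rewrite imset_f // andbT /f gcomp_refl xpair_eqE andbF.
    by move=> nx; exists (f x) => //; rewrite !inE nx imset_f.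
  by exists x.
exact: leq_imset_card.
Qed.

End Switching.

(** * The loop equation *)

Section LoopEquation.
Variables (C : comNzRingType) (H : finType) (N : nat).
Implicit Types (i j : {ffun H -> 'I_N}) (a : {perm H}).

Definition upd i (l : H) (b : 'I_N) : {ffun H -> 'I_N} :=
  [ffun x => if x == l then b else i x].

Lemma upd_same i l : upd i l (i l) = i.
Proof. by apply/ffunP => x; rewrite ffunE; case: eqP => // ->. Qed.

Lemma upd_upd i l b c : upd (upd i l b) l c = upd i l c.
Proof. by apply/ffunP => x; rewrite !ffunE; case: eqP. Qed.

Lemma updE i l b x : upd i l b x = if x == l then b else i x.
Proof. by rewrite ffunE. Qed.

Lemma upd_l i l b : upd i l b l = b.
Proof. by rewrite ffunE eqxx. Qed.

Definition inv_idx a i := [forall x, i (a x) == i x].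

Lemma inv_idxP a i : reflect (forall x, i (a x) = i x) (inv_idx a i).
Proof. exact: 'forall_eqP. Qed.

Variables (phi : {ffun H -> 'I_N} -> C) (B : pred H).

Definition contract a : C := \sum_(i | inv_idx a i) phi i.

(** The action on the leg [l] of the antisymmetric generator of rotations in the plane [(x, y)]. *)
Definition lie_term (x y : 'I_N) i l : C :=
  phi (upd i l y) *+ (i l == x) - phi (upd i l x) *+ (i l == y).

Definition lie_invariant := forall x y i, \sum_(l | B l) lie_term x y i l = 0.

Variables (a : {perm H}) (h g : H).
Hypotheses (phiL : lie_invariant) (aK : involutive a)
  (af : forall x, a x != x) (ahg : a h = g) (Bg : B g) (Bh : ~~ B h).

Let agh : a g = h. Proof. by rewrite -ahg aK. Qed.
Let gh : g != h. Proof. by rewrite -ahg. Qed.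
Let hg : h != g. Proof. by rewrite eq_sym. Qed.

(** The two ends of the edge [{h, g}] get independent indices, which then serve as the plane
    [(x, y)] of the Lie identity; the plane thus varies with [i]. *)
Let K i := [forall x, (x != h) && (x != g) ==> (i (a x) == i x)].

Let KP i : reflect (forall x, x != h -> x != g -> i (a x) = i x) (K i).
Proof.
apply: (iffP forallP) => [Ki x xh xg|Ki x].
  by have /implyP := Ki x; rewrite xh xg => /(_ isT)/eqP.
by apply/implyP => /andP[xh xg]; apply/eqP/Ki.
Qed.

Let K_inv i : inv_idx a i = K i && (i g == i h).
Proof.
apply/inv_idxP/andP => [ii|[/KP Ki /eqP igh] x].
  by rewrite -{1}ahg ii eqxx; split=> //; apply/KP => x _ _; apply: ii.
case: (eqVneq x h) => [->|xh]; first by rewrite ahg.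
by case: (eqVneq x g) => [->|xg]; rewrite ?agh ?igh // Ki.
Qed.

(** In the leg [g] the first part of the Lie term forces [i g = i h] and gives the value once; the
    second overwrites the free index [i g], so each matched index function is met N times. *)
Let termg : \sum_(i | K i) lie_term (i h) (i g) i g = (1 - N%:R) * contract a.
Proof.
under eq_bigr => i _ do rewrite /lie_term upd_same eqxx.
rewrite mulrBl mul1r sumrB; congr (_ - _).
  by rewrite /contract; under [RHS]eq_bigl do rewrite K_inv; rewrite big_mkcondr;
     apply: eq_bigr => i _; case: eqP.
rewrite -[N in N%:R]card_ord mulr_natl -sumr_const exchange_big /=.
rewrite pair_big_dep /=.
rewrite (reindex_onto (fun p : {ffun H -> 'I_N} * 'I_N => upd p.1 g p.2)
          (fun i => (upd i g (i h), i g))) /=; last first.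
  by move=> i _; rewrite upd_upd upd_same.
symmetry; apply: eq_big => [[i b]|[i b] /= /andP[]].
  rewrite /= upd_l upd_upd !updE (negPf hg) xpair_eqE eqxx !andbT K_inv.
  congr (_ && _).
    apply/KP/KP => Ki x xh xg; have := Ki x xh xg;
    by rewrite !updE (negPf xg) (can2_eq aK aK) agh (negPf xh).
  by apply/eqP/eqP => [<-|e]; [rewrite upd_same | rewrite -{1}e upd_l].
rewrite K_inv => /andP[_ /eqP ig] _.
by rewrite upd_upd updE (negPf hg) -ig upd_same.
Qed.

Let Kl l j :=
  [forall x, [&& x != h, x != g, x != l & x != a l] ==> (j (a x) == j x)].

Let KlP l j : reflect (forall x, x != h -> x != g -> x != l -> x != a l ->
  j (a x) = j x) (Kl l j).
Proof.
apply: (iffP forallP) => [Ki x xh xg xl xal|Ki x].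
  by have /implyP := Ki x; rewrite xh xg xl xal => /(_ isT)/eqP.
by apply/implyP => /and4P[xh xg xl xal]; apply/eqP/Ki.
Qed.

(** The index [i l] erased by [upd] survives as [j (a l)], so [i] is recovered from
    [j = upd i l (i w)]. The two constraints left on [j] are those of a switched matching. *)
Let term l u w : l != h -> l != g -> u != l -> w != l ->
  \sum_(i | K i) phi (upd i l (i w)) *+ (i l == i u) =
  \sum_(j | Kl l j && (j (a l) == j u) && (j l == j w)) phi j.
Proof.
move=> lh lg ul wl.
have all : (a l == l) = false := negPf (af l).
rewrite (eq_bigr (fun i => if i l == i u then phi (upd i l (i w)) else 0)); last first.
  by move=> i _; case: ifP.
rewrite -big_mkcondr.
rewrite (reindex_onto (fun j => upd j l (j (a l))) (fun i => upd i l (i w))) /=; last first.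
  move=> i /andP[/KP Ki _]; rewrite upd_upd updE all Ki //.
  exact: upd_same.
apply: eq_big => [j|j /andP[_ /eqP ->] //].
rewrite upd_upd upd_l !updE (negPf ul) (negPf wl).
have -> : (upd j l (j w) == j) = (j l == j w).
  by apply/eqP/eqP => [{1}<-|<-]; rewrite ?upd_l ?upd_same.
congr (_ && _); congr (_ && _).
apply/KP/KlP => [Kj x xh xg xl xal|Kj x xh xg].
  by have := Kj x xh xg; rewrite !updE (negPf xl) (can2_eq aK aK) (negPf xal).
rewrite !updE; case: (eqVneq x l) => [->|xl]; first by rewrite all.
rewrite (can2_eq aK aK); case: (eqVneq x (a l)) => [->//|xal].
exact: Kj.
Qed.

Let contract_sw l : l != h -> l != g ->
  contract (sw a h l) =
  \sum_(j | Kl l j && (j (a l) == j h) && (j l == j g)) phi j.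
Proof.
move=> lh lg; apply: eq_bigl => j; rewrite -ahg in lg.
have P := swP aK (af h) (af l) lg.
have al := sw_al aK (af h) lg; have hh := sw_h (af h) lg.
have gg : sw a h l g = l by rewrite -{1}ahg; apply: sw_ah.
apply/inv_idxP/andP=> [jj|[/andP[/KlP Kj /eqP e1] /eqP e2] x].
  have -> : j (a l) = j h by rewrite -hh jj.
  have -> : j l = j g by rewrite -[in LHS]gg jj.
  rewrite !eqxx andbT; split=> //; apply/KlP.
  by move=> x xh xg xl xal; rewrite -(sw_other aK xh _ xl xal) ?ahg ?jj.
case: (P x) => [->|->|->|->|xh xah xl xal] //; rewrite ?ahg //.
by rewrite Kj // -ahg.
Qed.

Lemma loop_equation :
  (N%:R - 1) * contract a =
  \sum_(l | [&& B l, ~~ B (a l) & l != g])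
     (contract (sw a h l) - contract (sw a h (a l))).
Proof.
have : \sum_(i | K i) \sum_(l | B l) lie_term (i h) (i g) i l = 0.
  by apply: big1 => i _; apply: phiL.
rewrite exchange_big (bigD1 g) //= termg => /eqP.
rewrite addrC -opprB mulNr subr_eq0 => /eqP <-.
have E l : B l -> l != g ->
    \sum_(i | K i) lie_term (i h) (i g) i l =
    contract (sw a h l) - contract (sw a h (a l)).
  move=> Bl lg; have lh : l != h by apply: contraNneq Bh => <-.
  have alh : a l != h by rewrite -(inj_eq (@perm_inj _ a)) aK ahg.
  have alg : a l != g by rewrite -(inj_eq (@perm_inj _ a)) aK agh.
  rewrite /lie_term sumrB. rewrite (term lh lg _ _) 1?eq_sym // (term (u := g) (w := h) lh lg) 1?eq_sym // !contract_sw // aK.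
  congr (_ - _); apply: eq_bigl => j; rewrite -andbA [X in _ && X]andbC andbA.
  congr (_ && _ && _); apply/KlP/KlP => Kj x xh xg xl xal; apply: Kj => //.
    by rewrite aK in xal.
  by rewrite aK.
rewrite (eq_bigr _ (fun l Bl => E l (andP Bl).1 (andP Bl).2)).
(* Edges with both ends in [B] contribute nothing: exchanging their ends changes the sign. *)
rewrite (bigID (fun l => B (a l))) /= [X in X + _](_ : _ = 0) ?add0r.
  by apply: eq_bigl => l; rewrite andbAC -andbA.
rewrite sumrB; apply/eqP; rewrite subr_eq0; apply/eqP.
rewrite (reindex_inj (@perm_inj _ a)) /=; apply: eq_bigl => l.
rewrite aK; case: (boolP (B l)) => Bl; rewrite ?andbF //= ?andbT.
case: (boolP (B (a l))) => Bal /=; last by rewrite andbF.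
have -> : l != g by apply: contraNneq Bh => e; rewrite -agh -e.
by rewrite -(inj_eq (@perm_inj _ a)) aK agh; apply: contraNneq Bh => <-.
Qed.

End LoopEquation.

(** * Boundedness along chromatic switches *)

Section Modulus.
Variable R : rcfType.
Implicit Types (z w : R[i]) (x : R).

(** The norm on [R[i]] takes its values in [R[i]]; estimates are made with this copy in [R], where
    the order is total. *)
Definition nm z : R := complex.Re `|z|.

Lemma nmE z : (`|z| = (nm z)%:C%C).
Proof. by rewrite /nm normc_def. Qed.

Lemma nm_sqrt z : nm z = Num.sqrt (complex.Re z ^+ 2 + complex.Im z ^+ 2).
Proof. by rewrite /nm normc_def. Qed.

Lemma nm_ge0 z : 0 <= nm z.
Proof. by rewrite nm_sqrt sqrtr_ge0. Qed.

Lemma nmM z w : nm (z * w) = nm z * nm w.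
Proof. by apply: complexI; rewrite rmorphM /= -!nmE normrM. Qed.

Lemma nm_le_add z w : nm (z + w) <= nm z + nm w.
Proof. by rewrite -lecR rmorphD /= -!nmE ler_normD. Qed.

Lemma nmN z : nm (- z) = nm z.
Proof. by rewrite /nm normrN. Qed.

Lemma nm0 : nm 0 = 0.
Proof. by rewrite /nm normr0. Qed.

Lemma nm1 : nm 1 = 1.
Proof. by rewrite /nm normr1. Qed.

Lemma nm_nat n : nm n%:R = n%:R.
Proof. by apply: complexI; rewrite -nmE normr_nat rmorph_nat. Qed.

Lemma nmV z : nm z^-1 = (nm z)^-1.
Proof. by apply: complexI; rewrite -nmE normfV nmE fmorphV. Qed.

Lemma nmX z n : nm (z ^+ n) = nm z ^+ n.
Proof. by elim: n => [|n IH]; rewrite ?nm1 // !exprS nmM IH. Qed.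

Lemma nm_sum (I : Type) (r : seq I) (P : pred I) (F : I -> R[i]) :
  nm (\sum_(i <- r | P i) F i) <= \sum_(i <- r | P i) nm (F i).
Proof.
elim/big_rec2: _ => [|i y z _ le]; first by rewrite nm0.
by apply: le_trans (nm_le_add _ _) _; rewrite lerD2l.
Qed.

Lemma nmJ z : nm (z^*)%C = nm z.
Proof. by rewrite /nm normcJ. Qed.

Lemma nm_eq0 z : (nm z == 0) = (z == 0).
Proof. by rewrite -(inj_eq (@complexI _)) -nmE normr_eq0. Qed.

Lemma nm_Re z : `|complex.Re z| <= nm z.
Proof. by rewrite -lecR -nmE normc_ge_Re. Qed.

Lemma nm_sqr z : nm z ^+ 2 = complex.Re z ^+ 2 + complex.Im z ^+ 2.
Proof. by rewrite nm_sqrt sqr_sqrtr // addr_ge0 ?sqr_ge0. Qed.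

Lemma nm_Im z : `|complex.Im z| <= nm z.
Proof.
by rewrite -(ler_pXn2r (n := 2)) ?nnegrE ?nm_ge0 // real_normK ?num_real //
  nm_sqr lerDr sqr_ge0.
Qed.

Lemma nm_le_ReIm z : nm z <= `|complex.Re z| + `|complex.Im z|.
Proof.
rewrite -(ler_pXn2r (n := 2)) ?nnegrE ?nm_ge0 ?addr_ge0 //.
rewrite nm_sqr sqrrD !real_normK ?num_real // lerD2r lerDl.
by rewrite mulrn_wge0 // mulr_ge0.
Qed.

Lemma mul_conj_nm z : z * (z^*)%C = (nm z ^+ 2)%:C%C.
Proof. by rewrite -sqr_normc nmE rmorphXn. Qed.

End Modulus.

(** * Bounded and vanishing sequences *)

Section Sequences.
Variable R : realType.
Implicit Types (f g W : nat -> R) (a b : nat -> R[i]).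

(* W is an a priori unknown quantity, reabsorbed later thanks to the 1/N. *)
Definition bounded_up_to W f :=
  exists2 K : R, 0 <= K &
    exists N0, forall N, (N0 <= N)%N -> f N <= K + K / N%:R * W N.

Definition bigO a := exists K : R, exists N0, forall N, (N0 <= N)%N -> nm (a N) <= K.

Definition litO a := forall e : R, 0 < e ->
  exists N0, forall N, (N0 <= N)%N -> nm (a N) <= e.

Lemma bounded_up_to_le W f g N0 : (forall N, (N0 <= N)%N -> f N <= g N) ->
  bounded_up_to W g -> bounded_up_to W f.
Proof.
move=> fg [K K0 [N1 gK]]; exists K => //; exists (maxn N0 N1) => N.
by rewrite geq_max => /andP[h1 h2]; apply: le_trans (fg _ h1) (gK _ h2).
Qed.

Lemma bounded_up_to_add W f g : (forall N, 0 <= W N) ->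
  bounded_up_to W f -> bounded_up_to W g ->
  bounded_up_to W (fun N => f N + g N).
Proof.
move=> W0 [K K0 [N1 fK]] [L L0 [N2 gL]]; exists (K + L); first exact: addr_ge0.
exists (maxn N1 N2) => N; rewrite geq_max => /andP[h1 h2].
apply: le_trans (lerD (fK _ h1) (gL _ h2)) _.
by rewrite !mulrDl addrACA.
Qed.

Lemma bounded_up_to_scale W f (c : R) : (forall N, 0 <= W N) -> 0 <= c ->
  bounded_up_to W f -> bounded_up_to W (fun N => c * f N).
Proof.
move=> W0 c0 [K K0 [N1 fK]]; exists (c * K); first exact: mulr_ge0.
by exists N1 => N h; rewrite -!mulrA -mulrDr ler_wpM2l // mulrA fK.
Qed.

Lemma bounded_up_to_cst W (K : R) : (forall N, 0 <= W N) ->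
  bounded_up_to W (fun _ => K).
Proof.
move=> W0; exists `|K| => //; exists 0%N => N _; apply: le_trans (ler_norm _) _.
by rewrite lerDl !mulr_ge0 // invr_ge0.
Qed.

Lemma bounded_up_to_sum W (I : Type) (r : seq I) (P : pred I) (F : I -> nat -> R) :
  (forall N, 0 <= W N) ->
  (forall i, P i -> bounded_up_to W (F i)) ->
  bounded_up_to W (fun N => \sum_(i <- r | P i) F i N).
Proof.
move=> W0 FB; elim: r => [|i r IH].
  apply: (bounded_up_to_le (N0 := 0) (g := fun=> 0)); last exact: bounded_up_to_cst.
  by move=> N _; rewrite big_nil.
case: (boolP (P i)) => Pi.
  apply: (bounded_up_to_le (N0 := 0)) (bounded_up_to_add W0 (FB _ Pi) IH).
  by move=> N _; rewrite big_cons Pi.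
by apply: (bounded_up_to_le (N0 := 0)) IH => N _; rewrite big_cons (negPf Pi).
Qed.

(** Once N is at least [2 * K], the term to be reabsorbed is at most half of [f]. *)
Lemma bounded_up_to_absorb f : bounded_up_to f f ->
  (forall N, 0 <= f N) -> exists K N0, forall N, (N0 <= N)%N -> f N <= K.
Proof.
move=> [K K0 [N0 fK]] f0; exists (2 * K).
have [N1 hN1] : exists N1, 2 * K <= N1%:R :> R.
  by exists (Num.Def.archi_bound (2 * K)); apply/ltW/archi_boundP/mulr_ge0.
exists (maxn N0 N1.+1) => N; rewrite geq_max => /andP[h1 h2].
have Np : 0 < N%:R :> R by rewrite ltr0n (leq_trans _ h2).
have KN : K / N%:R <= 1 / 2.
  rewrite ler_pdivrMr // mulrC mulrA mulr1 ler_pdivlMr // mulrC.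
  by apply: le_trans hN1 _; rewrite ler_nat ltnW.
have := fK _ h1; have := f0 N; nra.
Qed.

Lemma bigO_bounded W a : (forall N, 0 <= W N) ->
  bigO a -> bounded_up_to W (fun N => nm (a N)).
Proof.
move=> W0 [K [N0 aK]]; apply: (bounded_up_to_le aK); exact: bounded_up_to_cst.
Qed.

Lemma litO_le a b N0 (K : R) : (forall N, (N0 <= N)%N -> nm (a N) <= K * nm (b N)) ->
  litO b -> litO a.
Proof.
move=> ab bo e e0; have K1 : 0 < `|K| + 1 by rewrite ltr_wpDl.
have [N1 h] := bo _ (divr_gt0 e0 K1); exists (maxn N0 N1) => N.
rewrite geq_max => /andP[h1 h2]; apply: le_trans (ab _ h1) _.
have := h _ h2; rewrite ler_pdivlMr // => h3; apply: le_trans h3.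
rewrite mulrC ler_wpM2l ?nm_ge0 //; apply: le_trans (ler_norm _) _.
by rewrite lerDl.
Qed.

Lemma litO0 : litO (fun=> 0).
Proof. by move=> e e0; exists 0%N => N _; rewrite nm0 ltW. Qed.

Lemma litO_add a b : litO a -> litO b -> litO (fun N => a N + b N).
Proof.
move=> ao bo e e0; have e2 : 0 < e / 2 by apply: divr_gt0.
have [N1 h1] := ao _ e2; have [N2 h2] := bo _ e2.
exists (maxn N1 N2) => N; rewrite geq_max => /andP[/h1 i1 /h2 i2].
apply: le_trans (nm_le_add _ _) _; lra.
Qed.

Lemma litO_sum (I : Type) (r : seq I) (P : pred I) (F : I -> nat -> R[i]) :
  (forall i, P i -> litO (F i)) -> litO (fun N => \sum_(i <- r | P i) F i N).
Proof.
move=> Fo; elim: r => [|i r IH].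
  by apply: (litO_le (N0 := 0) (K := 0)) litO0 => N _; rewrite big_nil nm0 mul0r.
case: (boolP (P i)) => Pi.
  apply: (litO_le (N0 := 0) (K := 1)) (litO_add (Fo _ Pi) IH).
  by move=> N _; rewrite big_cons Pi mul1r.
apply: (litO_le (N0 := 0) (K := 1)) IH.
by move=> N _; rewrite big_cons (negPf Pi) mul1r.
Qed.

Lemma nat_large (x : R) : exists n : nat, x <= n%:R.
Proof.
exists (Num.Def.archi_bound `|x|); apply: le_trans (ler_norm x) _.
exact/ltW/archi_boundP.
Qed.

Lemma litO_bigO_div a b (c : R) N0 : bigO b ->
  (forall N, (N0 <= N)%N -> nm (a N) <= c / N%:R * nm (b N)) -> litO a.
Proof.
move=> [K [N1 bK]] ab e e0; have [n hn] := nat_large (`|c| * `|K| / e).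
exists (maxn N0 (maxn N1 n.+1)) => N; rewrite !geq_max => /and3P[h1 h2 h3].
have Np : 0 < N%:R :> R by rewrite ltr0n (leq_trans _ h3).
apply: le_trans (ab _ h1) _.
apply: (@le_trans _ _ (`|c| / N%:R * `|K|)).
  apply: (@le_trans _ _ (`|c| / N%:R * nm (b N))).
    by rewrite ler_wpM2r ?nm_ge0 // ler_wpM2r ?invr_ge0 ?ler_norm ?ler0n.
  rewrite ler_wpM2l ?divr_ge0 ?ler0n //; apply: le_trans (bK _ h2) _.
  exact: ler_norm.
rewrite mulrAC ler_pdivrMr // [e * _]mulrC -ler_pdivrMr //; apply: le_trans hn _.
by rewrite ler_nat ltnW.
Qed.

End Sequences.

(** * The loop equation for normalised values *)

Section LargeN.
Variables (R : realType) (H : finType) (p : {perm H}) (B : pred H).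
Variable phi : forall N, {ffun H -> 'I_N} -> R[i].
Hypothesis phiL : forall N, (0 < N)%N -> lie_invariant (phi (N := N)) B.

Definition nval N (a : {perm H}) : R[i] :=
  contract (phi (N := N)) a / N%:R ^+ gncomp p a.

Definition matching (a : {perm H}) :=
  [forall x, a (a x) == x] && [forall x, a x != x].

Lemma matchingP (a : {perm H}) :
  reflect (involutive a /\ forall x, a x != x) (matching a).
Proof.
apply: (iffP andP) => [[/'forall_eqP aK /forallP af]|[aK af]]; first by split.
by split; [apply/'forall_eqP | apply/forallP].
Qed.

(** The ratio of the normalisations of [b] and [a], divided by the factor N - 1 of the loop
    equation. *)
Let weight N a b : R[i] := N%:R ^+ gncomp p b / ((N%:R - 1) * N%:R ^+ gncomp p a).

Lemma nval_loop N a g : (1 < N)%N -> matching a -> B g -> ~~ B (a g) ->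
  nval N a =
  \sum_(l | [&& B l, ~~ B (a l) & l != g])
     (weight N a (sw a (a g) l) * nval N (sw a (a g) l) -
      weight N a (sw a (a g) (a l)) * nval N (sw a (a g) (a l))).
Proof.
move=> N1 /matchingP[aK af] Bg Bag.
have N0 : N%:R != 0 :> R[i] by rewrite pnatr_eq0 -lt0n ltnW.
have N10 : N%:R - 1 != 0 :> R[i].
  by rewrite subr_eq0 -[1]/(1%:R) eqr_nat neq_ltn N1 orbT.
have W b : weight N a b * nval N b =
    ((N%:R - 1) * N%:R ^+ gncomp p a)^-1 * contract (phi (N := N)) b.
  rewrite /weight /nval; move: (expf_neq0 (gncomp p b) N0).
  move: (_ ^+ gncomp p b) (_ * _ ^+ gncomp p a) => x y x0.
  by rewrite mulrC mulrA divfK // mulrC.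
under eq_bigr do rewrite !W -mulrBr.
rewrite -mulr_sumr -(loop_equation (phiL (ltnW N1)) aK af _ Bg Bag) ?aK //.
by rewrite /nval invfM mulrACA mulVf // mul1r mulrC.
Qed.

(** [k] measures how far [b] falls short of having one component more than [a]; the constant 2
    bounds N / (N - 1). *)
Lemma nm_weight N a b k : (1 < N)%N -> (gncomp p b + k <= (gncomp p a).+1)%N ->
  nm (weight N a b) <= 2 / N%:R ^+ k.
Proof.
move=> N1 le; rewrite /weight nmM nmV nmM !nmX nm_nat.
have N1R : 1 < N%:R :> R by rewrite ltr1n.
have N0R : 0 < N%:R :> R by apply: lt_trans N1R.
have -> : nm (N%:R - 1 : R[i]) = N%:R - 1.
  by rewrite -(natrB _ (ltnW N1)) nm_nat natrB // ltnW.
rewrite ler_pdivrMr; last by rewrite mulr_gt0 ?exprn_gt0 ?subr_gt0.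
rewrite mulrAC ler_pdivlMr ?exprn_gt0 // -exprD.
apply: (@le_trans _ _ (N%:R ^+ (gncomp p a).+1)).
  by rewrite ler_weXn2l // ltW.
rewrite exprS mulrA ler_wpM2r ?exprn_ge0 ?(ltW N0R) //.
have : 2 <= N%:R :> R by rewrite (ler_nat _ 2).
lra.
Qed.

Lemma matching_sw a h l : matching a -> l != h -> l != a h -> matching (sw a h l).
Proof.
move=> /matchingP[aK af] lh lah; apply/matchingP; split; first exact: swK.
exact: sw_fpf.
Qed.

(** Only the end in [B] is counted, hence one half-edge for each edge joining the two colours. *)
Definition chromatic (a : {perm H}) : {set H} := [set x | B x & ~~ B (a x)].

(** This switch joins the two ends in [B] with each other and the two ends outside [B] with each
    other, so both edges leave the count. *)
Lemma chromatic_sw_lt a g l : matching a -> B g -> ~~ B (a g) -> B l ->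
  ~~ B (a l) -> l != g -> (#|chromatic (sw a (a g) l)| < #|chromatic a|)%N.
Proof.
move=> /matchingP[aK af] Bg Bag Bl Bal lg.
have lag : l != a g by apply: contraNneq Bag => <-.
have lg' : l != a (a g) by rewrite aK.
apply: proper_card; apply/properP; split.
  apply/fintype.subsetP => x; rewrite !inE => /andP[Bx].
  case: (swP aK (af (a g)) (af l) lg' x) => [xE|_|_|xE|_ _ _ _ ->].
  - by rewrite xE (negPf Bag) in Bx.
  - by rewrite Bl.
  - by rewrite aK Bg.
  - by rewrite xE (negPf Bal) in Bx.
  - by rewrite Bx.
exists g; first by rewrite inE Bg.
rewrite inE Bg /= negbK.
by have := sw_ah aK (h := a g) (af l) lg'; rewrite aK => ->.
Qed.

(** The opposite re-pairing matches each of the two ends in [B] with an end outside [B]. *)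
Lemma chromatic_sw_eq a g l : matching a -> B g -> ~~ B (a g) -> B l ->
  ~~ B (a l) -> l != g -> chromatic (sw a (a g) (a l)) = chromatic a.
Proof.
move=> /matchingP[aK af] Bg Bag Bl Bal lg.
have alg : a l != g by apply: contraNneq Bal => ->.
have alg' : a l != a (a g) by rewrite aK.
apply/setP => x; rewrite !inE; case: (boolP (B x)) => //= Bx.
case: (swP aK (af (a g)) (af (a l)) alg' x) => [xE|->|xE|->|].
- by rewrite xE (negPf Bag) in Bx.
- by rewrite aK Bag Bal.
- by rewrite xE (negPf Bal) in Bx.
- by rewrite !aK Bag Bal.
- by [].

Qed.

(* Induction on the number of chromatic half-edges. Switches may keep it
   constant, but then either the number of components grows, which can happen
   only #|H| times, or the coefficient is O(1/N) and the sum W of all maps at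
   the same level absorbs the term. *)
Theorem nval_bounded :
  (forall a, matching a -> (forall x, B (a x) = B x) -> bigO (nval ^~ a)) ->
  forall a, matching a -> bigO (nval ^~ a).
Proof.
move=> base a; have [n] := ubnP #|chromatic a|; elim: n a => // n IHn a.
rewrite ltnS leq_eqVlt => /predU1P[|/IHn//].
pose S b := matching b && (#|chromatic b| == n).
pose W N := \sum_(b | S b) nm (nval N b).
have W0 N : 0 <= W N by apply: sumr_ge0 => b _; apply: nm_ge0.
move=> an ma; have Sa : S a by rewrite /S ma an eqxx.
suff bW b : S b -> bounded_up_to W (fun N => nm (nval N b)).
  have [K [N0 WK]] := bounded_up_to_absorb (bounded_up_to_sum _ W0 bW) W0.
  exists K, N0 => N /WK; apply: le_trans; rewrite /W (bigD1 a) //= lerDl.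
  by apply: sumr_ge0 => *; apply: nm_ge0.
have [k] := ubnP (#|H| - gncomp p b)%N; elim: k b => // k IHk b kb /andP[mb /eqP bn].
have [/matchingP[aK af]] := mb.
have [bB|[g]] := set_0Vmem (chromatic b).
  apply: (bigO_bounded W0); apply: (base _ mb) => x.
  have := bB => /setP/(_ x); have := bB => /setP/(_ (b x)); rewrite !inE aK.
  by case: (B x); case: (B (b x)).
rewrite inE => /andP[Bg Bbg].
pose t N l := nm (weight N b (sw b (b g) l) * nval N (sw b (b g) l)) +
    nm (weight N b (sw b (b g) (b l)) * nval N (sw b (b g) (b l))).
apply: (@bounded_up_to_le _ _ _
   (fun N => \sum_(l | [&& B l, ~~ B (b l) & l != g]) t N l) 2).
  move=> N N1; rewrite (nval_loop N1 mb Bg Bbg).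
  apply: le_trans (nm_sum _ _ _) _; apply: ler_sum => l _.
  rewrite /t -[X in _ <= _ + X]nmN; exact: nm_le_add.
apply: bounded_up_to_sum => // l /and3P[Bl Bbl lg].
have lbg : l != b g by apply: contraNneq Bbg => <-.
have blbg : b l != b g by rewrite (inj_eq perm_inj).
have blg : b l != g by apply: contraNneq Bbl => ->.
have le2 c l' N : l' != g -> l' != b g -> (1 < N)%N -> c = sw b (b g) l' ->
    nm (weight N b c * nval N c) <= 2 * nm (nval N c).
  move=> lg' lbg' N1 ->; rewrite nmM ler_wpM2r ?nm_ge0 //.
  have := @nm_weight N b (sw b (b g) l') 0 N1; rewrite expr0 divr1; apply.
  by rewrite addn0 gncomp_sw_le // aK.
apply: bounded_up_to_add => //.
  apply: (bounded_up_to_le (N0 := 2) (g := fun N => 2 * nm (nval N (sw b (b g) l)))).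
    by move=> N N1; apply: (le2 _ l).
  apply: bounded_up_to_scale => //; apply: bigO_bounded => //; apply: IHn.
    by rewrite -bn; apply: chromatic_sw_lt.
  by apply: matching_sw; rewrite ?aK.
set c := sw b (b g) (b l).
have mc : matching c by apply: matching_sw; rewrite ?aK.
have Sc : S c by rewrite /S mc chromatic_sw_eq // bn eqxx.
have [cb|bc] := leqP (gncomp p c) (gncomp p b).
  exists 2 => //; exists 2 => N N1; apply: (@le_trans _ _ (2 / N%:R * W N)).
    rewrite nmM ler_pM ?nm_ge0 //.
      by have := @nm_weight N b c 1 N1; rewrite expr1 addn1; apply.
    by rewrite /W (bigD1 c) //= lerDl; apply: sumr_ge0 => *; apply: nm_ge0.
  by rewrite lerDr.
apply: (bounded_up_to_le (N0 := 2) (g := fun N => 2 * nm (nval N c))).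
  by move=> N N1; apply: (le2 _ (b l)).
apply: bounded_up_to_scale => //; apply: IHk => //.
by move: (gncomp_le_card p c) kb bc; clear; lia.
Qed.

(** The condition [B l != B (a l)] does not choose an end because the loop equation contains the
    switches at [l] and at [a l]. Each of them is discarded either by its weight or by its value. *)
Theorem nval_step a g :
  (forall b, matching b -> bigO (nval ^~ b)) ->
  matching a -> B g -> ~~ B (a g) ->
  (forall l, l != g -> l != a g -> B l != B (a l) ->
     (gncomp p (sw a (a g) l) <= gncomp p a)%N \/
     litO (nval ^~ (sw a (a g) l))) ->
  litO (nval ^~ a).
Proof.
move=> bO ma Bg Bag small; have /matchingP[aK af] := ma.
have one l : l != g -> l != a g -> B l != B (a l) ->
    litO (fun N => weight N a (sw a (a g) l) * nval N (sw a (a g) l)).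
  move=> lg lag Bl.
  have [le|o] := small _ lg lag Bl.
    apply: (litO_bigO_div (N0 := 2) (c := 2) (bO (sw a (a g) l) _)).
      by apply: matching_sw; rewrite ?aK.
    move=> N N1; rewrite nmM ler_wpM2r ?nm_ge0 //.
    by have := @nm_weight N a (sw a (a g) l) 1 N1; rewrite expr1 addn1; apply.
  apply: (litO_le (N0 := 2) (K := 2) _ o) => N N1.
  rewrite nmM ler_wpM2r ?nm_ge0 //.
  have := @nm_weight N a (sw a (a g) l) 0 N1; rewrite expr0 divr1; apply.
  by rewrite addn0 gncomp_sw_le // aK.
pose t l N := weight N a (sw a (a g) l) * nval N (sw a (a g) l) +
   - (weight N a (sw a (a g) (a l)) * nval N (sw a (a g) (a l))).
apply: (@litO_le _ _ (fun N => \sum_(l | [&& B l, ~~ B (a l) & l != g]) t l N) 2 1).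
  by move=> N N1; rewrite mul1r (nval_loop N1 ma Bg Bag).
apply: litO_sum => l /and3P[Bl Bal lg].
apply: litO_add.
  by apply: one; rewrite ?Bl ?(negPf Bal) //; apply: contraNneq Bag => <-.
apply: (@litO_le _ _ (fun N => weight N a (sw a (a g) (a l)) *
   nval N (sw a (a g) (a l))) 0 1) => [N _|]; first by rewrite nmN mul1r.
apply: one; rewrite ?aK ?Bl ?(negPf Bal) //; last by rewrite (inj_eq perm_inj).
by apply: contraNneq Bal => ->.
Qed.

End LargeN.

(** * Disjoint unions, components and descendants *)

Section SplitComponents.
Variables (H1 H2 H : finType) (p1 a1 : {perm H1}) (p2 a2 : {perm H2}).
Variables (p a : {perm H}) (f1 : H1 -> H) (f2 : H2 -> H).
Hypotheses (f1I : injective f1) (f2I : injective f2)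
  (f12 : forall x y, f1 x != f2 y)
  (fC : forall z, (exists x, z = f1 x) \/ (exists y, z = f2 y))
  (p1E : forall x, p (f1 x) = f1 (p1 x)) (a1E : forall x, a (f1 x) = f1 (a1 x))
  (p2E : forall y, p (f2 y) = f2 (p2 y)) (a2E : forall y, a (f2 y) = f2 (a2 y)).

Let F z : {set H1} + {set H2} :=
  if [pick x | f1 x == z] is Some x then inl (gcomp p1 a1 x)
  else if [pick y | f2 y == z] is Some y then inr (gcomp p2 a2 y) else inl finset.set0.

Let F1 x : F (f1 x) = inl (gcomp p1 a1 x).
Proof.
by rewrite /F; case: pickP => [x' /eqP/f1I -> //|/(_ x)]; rewrite eqxx.
Qed.

Let F2 y : F (f2 y) = inr (gcomp p2 a2 y).
Proof.
rewrite /F; case: pickP => [x /eqP e|_]; first by have := f12 x y; rewrite e eqxx.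
by case: pickP => [x' /eqP/f2I -> //|/(_ y)]; rewrite eqxx.
Qed.

Let imF (X : finType) (f : H -> X) :
  [set f z | z : H] = [set f (f1 x) | x : H1] :|: [set f (f2 y) | y : H2].
Proof.
apply/setP => C; rewrite finset.in_setU; apply/imsetP/orP => [[z _ ->]|].
  by case: (fC z) => -[t ->]; [left|right]; apply/imsetP; exists t.
by case=> /imsetP[t _ ->]; [exists (f1 t)|exists (f2 t)].
Qed.

(** The splitting is given by two embeddings instead of a sum type, so that it also serves for a
    component and its complement and, with an empty second part, for a relabelling. *)
Lemma gncomp_split : gncomp p a = (gncomp p1 a1 + gncomp p2 a2)%N.
Proof.
apply/eqP; rewrite eqn_leq; apply/andP; split.
  rewrite {1}/gncomp imF (leq_trans (leq_card_setU _ _).1) // leq_add //;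
  by apply: card_invariant; split=> x;
     rewrite -?p1E -?p2E -?a1E -?a2E ?gcomp_p ?gcomp_a.
have FI : invariant_fun p a F.
  by split=> z; case: (fC z) => -[t ->]; rewrite ?p1E ?p2E ?a1E ?a2E ?F1 ?F2
    ?gcomp_p ?gcomp_a.
apply: leq_trans (card_invariant FI); rewrite imF cardsU.
rewrite (_ : _ :&: _ = finset.set0) ?cards0 ?subn0; last first.
  apply/setP => C; rewrite !inE; apply/negP => /andP[/imsetP[x _ ->] /imsetP[y _]].
  by rewrite F1 F2.
rewrite /gncomp.
rewrite (_ : [set F (f1 x) | x : H1] = inl @: [set gcomp p1 a1 x | x : H1]); last first.
  by rewrite -imset_comp; apply: eq_imset => x; apply: F1.
rewrite (_ : [set F (f2 x) | x : H2] = inr @: [set gcomp p2 a2 x | x : H2]); last first.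
  by rewrite -imset_comp; apply: eq_imset => x; apply: F2.
have inlI : injective (@inl {set H1} {set H2}) by move=> u v [].
have inrI : injective (@inr {set H1} {set H2}) by move=> u v [].
by rewrite (card_imset _ inlI) (card_imset _ inrI).
Qed.

End SplitComponents.

Section SumPerm.
Variables (H1 H2 : finType).

Definition sum_fun (p1 : {perm H1}) (p2 : {perm H2}) (z : H1 + H2) : H1 + H2 :=
  match z with inl x => inl (p1 x) | inr y => inr (p2 y) end.

Lemma sum_fun_inj p1 p2 : injective (sum_fun p1 p2).
Proof. by move=> [x|x] [y|y] //= [] /perm_inj ->. Qed.

Definition sum_perm p1 p2 : {perm (H1 + H2)%type} := perm (@sum_fun_inj p1 p2).

Lemma sum_perml p1 p2 x : sum_perm p1 p2 (inl x) = inl (p1 x).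
Proof. by rewrite permE. Qed.

Lemma sum_permr p1 p2 x : sum_perm p1 p2 (inr x) = inr (p2 x).
Proof. by rewrite permE. Qed.

Lemma gncomp_sum p1 a1 p2 a2 :
  gncomp (sum_perm p1 p2) (sum_perm a1 a2) = (gncomp p1 a1 + gncomp p2 a2)%N.
Proof.
apply: (@gncomp_split _ _ _ _ _ _ _ _ _ inl inr) => //; try by move=> u v [].
- by move=> [x|x]; [left|right]; exists x.
- exact: sum_perml.
- exact: sum_perml.
- exact: sum_permr.
- exact: sum_permr.
Qed.

Lemma matching_sum a1 a2 : matching (sum_perm a1 a2) = matching a1 && matching a2.
Proof.
apply/matchingP/andP => [[aK af]|[/matchingP[aK af] /matchingP[bK bf]]].
  split; apply/matchingP; split=> x.
  - by have := aK (inl x); rewrite !sum_perml => -[].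
  - by apply: contraNneq (af (inl x)) => e; rewrite sum_perml e.
  - by have := aK (inr x); rewrite !sum_permr => -[].
  - by apply: contraNneq (af (inr x)) => e; rewrite sum_permr e.
split=> -[x|x]; rewrite ?sum_perml ?sum_permr ?aK ?bK //.
- by have := af x; apply: contraNneq => -[->].
- by have := bf x; apply: contraNneq => -[->].
Qed.

Lemma sw_sum a1 a2 x l : sw (sum_perm a1 a2) (inl x) (inl l) = sum_perm (sw a1 x l) a2.
Proof.
have t u v w : tperm (inl u : H1 + H2) (inl v) (inl w) = inl (tperm u v w).
  case: tpermP => [[->]|[->]|/eqP n1 /eqP n2]; rewrite ?tpermL ?tpermR //.
  by rewrite tpermD // eq_sym; [apply: contraNneq n1 => -> | apply: contraNneq n2 => ->].
apply/permP => -[z|z]; rewrite ?sum_perml ?sum_permr /sw !permM ?sum_perml ?sum_permr ?t //.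
by rewrite !tpermD.
Qed.

Lemma gcomp_suml p1 a1 p2 a2 x y :
  inr y \notin gcomp (sum_perm p1 p2) (sum_perm a1 a2) (inl x).
Proof.
apply/negP => /(@invariant_connect _ _ _ _ (fun z => if z is inl _ then true else false)) E.
suff : false = true by []; apply: E.
by split=> -[z|z]; rewrite ?sum_perml ?sum_permr.
Qed.

End SumPerm.

Section SwitchProducts.
Variables (H : finType) (a : {perm H}) (h l : H).
Hypothesis aK : involutive a.

Lemma involutive_perm_mul : (a * a)%g = 1%g.
Proof. by apply/permP => x; rewrite permM aK perm1. Qed.

(** [switch] fixes the order of the two involutions. The order on maps puts the smaller map first
    and a chromatic switch puts the larger one first, so both products are needed. *)
Lemma involutive_mul_sw : (a * sw a h l)%g = (tperm h l * tperm (a h) (a l))%g.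
Proof. by rewrite /sw mulgA involutive_perm_mul mul1g. Qed.

Lemma sw_mul_involutive : (sw a h l * a)%g = (tperm (a h) (a l) * tperm h l)%g.
Proof.
have aV : (a^-1)%g = a.
  by apply: (mulgI a); rewrite mulgV involutive_perm_mul.
by rewrite /sw -mulgA -{1}aV -[LHS]/(_ ^ a)%g conjMg !tpermJ !aK.
Qed.

Hypotheses (af : forall x, a x != x) (lh : l != h) (lah : l != a h).

Lemma uniq_switch : uniq [:: h; l; a h; a l].
Proof.
have hl : h != l by rewrite eq_sym.
have hah : h != a h by rewrite eq_sym.
have hal : h != a l by rewrite -(can2_eq aK aK) eq_sym.
have lal : l != a l by rewrite eq_sym.
by rewrite /= !inE !negb_or (inj_eq perm_inj) hl hah hal lah lal.
Qed.

Lemma uniq_switch' : uniq [:: a h; a l; h; l].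
Proof. by have := uniq_switch; rewrite -(rot_uniq 2). Qed.

End SwitchProducts.

Section MinimalComponent.
Variables (m : nat) (M : cmap m) (h : 'I_m).

Let K := Defs.comp M h.

Lemma comp_gcomp x : Defs.comp M x = gcomp (vperm M) (einv M) x.
Proof. by []. Qed.

Lemma ncomp_gncomp n (M' : cmap n) : ncomp M' = gncomp (vperm M') (einv M').
Proof. by []. Qed.

Lemma einv_matching n (M' : cmap n) : in_M0 M' -> matching (einv M').
Proof.
move=> /eqP M0; apply/matchingP; split=> x; first exact: eqP (forallP (einvK M') x).
by have /setP/(_ x) := M0; rewrite !inE => ->.
Qed.

Lemma component_vpermE x : enum_val (vperm (component M h) x) = vperm M (enum_val x).
Proof. by rewrite permE restr_funE. Qed.

Lemma component_einvE x : enum_val (einv (component M h) x) = einv M (enum_val x).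
Proof. by rewrite permE restr_funE. Qed.

Lemma component_in_M0 : in_M0 M -> in_M0 (component M h).
Proof.
move=> /einv_matching/matchingP[_ f]; apply/eqP/setP => x; rewrite !inE.
by apply: contraNF (f (enum_val x)) => /eqP e; rewrite -component_einvE e.
Qed.

(** Giving the value [None] outside the component makes a function that is invariant only inside it
    invariant everywhere. *)
Lemma comp_invariant (X : eqType) (f : 'I_m -> X) :
  (forall x, x \in K -> f (vperm M x) = f x) ->
  (forall x, x \in K -> f (einv M x) = f x) -> forall x, x \in K -> f x = f h.
Proof.
move=> fp fa x xK; pose F y := if y \in K then Some (f y) else None.
have hK : h \in K by apply: gcomp_refl.
have FI : invariant_fun (vperm M) (einv M) F.
  split=> y; rewrite /F /K comp_gcomp !gcomp_memE ?gcomp_p ?gcomp_a -gcomp_memE;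
  by case: ifP => // yK; rewrite ?fp ?fa.
by have := invariant_connect FI xK; rewrite /F xK hK => -[].
Qed.

Lemma ncomp_component : ncomp (component M h) = 1%N.
Proof.
have hK : h \in K by apply: gcomp_refl.
pose f x := gcomp (vperm (component M h)) (einv (component M h)) (enum_rank_in hK x).
have e x y : x \in K -> enum_val y = x -> enum_rank_in hK x = y.
  by move=> _ <-; rewrite enum_valK_in.
have fC : forall x, x \in K -> f x = f h.
  apply: comp_invariant => x xK; rewrite /f.
    rewrite (e _ (vperm (component M h) (enum_rank_in hK x))) ?gcomp_p ?comp_vperm //.
    by rewrite component_vpermE enum_rankK_in.
  rewrite (e _ (einv (component M h) (enum_rank_in hK x))) ?gcomp_a ?comp_einv //.
  by rewrite component_einvE enum_rankK_in.
rewrite ncomp_gncomp /gncomp.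
rewrite (_ : [set _ | _ : _] = [set f h]) ?cards1 //.
apply/setP => C; rewrite inE; apply/imsetP/eqP => [[x _ ->]|->].
  by rewrite -(fC (enum_val x)) ?enum_valP // /f enum_valK_in.
by exists (enum_rank_in hK h).
Qed.

(** A switch inside the component that adds a component to the whole map would, carried out on the
    component alone, split it in two and give a smaller map. *)
Lemma minimal_sw x l : in_M0 M -> minimal (component M h) ->
  x \in K -> l \in K -> l != x -> l != einv M x ->
  (gncomp (vperm M) (sw (einv M) x l) <= ncomp M)%N.
Proof.
move=> M0 Kmin xK lK lx lax; have /matchingP[aK af] := einv_matching M0.
rewrite leqNgt; apply/negP => lt.
have ne : gcomp (vperm M) (sw (einv M) x l) x !=
          gcomp (vperm M) (sw (einv M) x l) (einv M x).
  by apply: contraTneq lt => /gncomp_sw_merge; rewrite -leqNgt; apply.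
have mK := einv_matching (component_in_M0 M0).
have /matchingP[cK cf] := mK.
pose i := enum_rank_in xK x; pose j := enum_rank_in xK l.
have iE : enum_val i = x by rewrite enum_rankK_in.
have jE : enum_val j = l by rewrite enum_rankK_in.
have ji : j != i by apply: contraNneq lx => e; rewrite -iE -jE e.
have jai : j != einv (component M h) i.
  by apply: contraNneq lax => e; rewrite -iE -component_einvE -e jE.
have mK' := matching_sw mK ji jai; have /matchingP[sK sf] := mK'.
have sKb : [forall y, sw (einv (component M h)) i j (sw (einv (component M h)) i j y) == y].
  exact/'forall_eqP.
pose M' := CMap (vperm (component M h)) sKb.
have swE y : enum_val (einv M' y) = sw (einv M) x l (enum_val y).
  rewrite /M' /=; case: (swP cK (cf i) (cf j) jai y) => [->|->|->|->|n1 n2 n3 n4];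
    rewrite ?component_einvE ?iE ?jE ?sw_h ?sw_ah ?sw_l ?sw_al //.
  rewrite sw_other //.
  - by apply: contraNneq n1 => e; apply/eqP/enum_val_inj; rewrite e iE.
  - by apply: contraNneq n2 => e; apply/eqP/enum_val_inj; rewrite e component_einvE iE.
  - by apply: contraNneq n3 => e; apply/eqP/enum_val_inj; rewrite e jE.
  - by apply: contraNneq n4 => e; apply/eqP/enum_val_inj; rewrite e component_einvE jE.
have inM' : in_M0 M' by apply/eqP/setP => y; rewrite !inE; apply/negbTE/sf.
have n2 : ncomp M' = 2%N.
  apply/eqP; rewrite eqn_leq; apply/andP; split.
    have := @gncomp_sw_le _ (vperm (component M h)) _ cK i j (cf i) (cf j) jai.
    by rewrite -(ncomp_gncomp (component M h)) ncomp_component.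
  pose f (y : 'I_#|Defs.comp M h|) := gcomp (vperm M) (sw (einv M) x l) (enum_val y).
  have fI : invariant_fun (vperm M') (einv M') f.
    by split=> y; rewrite /f ?swE ?gcomp_a //= component_vpermE gcomp_p.
  apply: leq_trans (card_invariant fI).
  rewrite (cardsD1 (f i)) imset_f // (cardsD1 (f (einv (component M h) i))).
  by rewrite finset.in_setD1 imset_f // /f component_einvE iE eq_sym ne.
apply: (Kmin M'); apply: t_step; split; last by rewrite n2 ncomp_component.
split=> //; first exact: component_in_M0.
exists (einv (component M h) i), (einv (component M h) j), i, j; split.
  exact: uniq_switch'.
exact: sw_mul_involutive.
Qed.

End MinimalComponent.

(** * Descent along admissible paths *)

Section AdmissibleDescent.
Variables (R : realType) (m : nat) (H2 : finType).
Variables (M : cmap m) (p2 a2 : {perm H2}) (col : 'I_m -> bool) (B2 : pred H2).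

Let B (z : 'I_m + H2) := match z with inl x => col x | inr y => B2 y end.
Let p := sum_perm (vperm M) p2.

Variable phi : forall N, {ffun ('I_m + H2)%type -> 'I_N} -> R[i].
Hypotheses (phiL : forall N, (0 < N)%N -> lie_invariant (phi (N := N)) B)
  (phiO : forall b, matching b -> bigO (nval p phi ^~ b))
  (a2m : matching a2) (colp : forall x, col (vperm M x) = col x).

(** The half-edges in [H2] are spectators: their matching [a2] stays fixed while the map on ['I_m]
    is switched. *)
Let v (M' : cmap m) N := nval p phi N (sum_perm (einv M') a2).

(** Only switches that create a component and take place inside the component of [h] have to be
    controlled. Their location is recorded so that minimality of this component can exclude them. *)
Lemma descent_step (M' : cmap m) h : vperm M' = vperm M -> in_M0 M' ->
  ~ monochromatic col M' h ->
  (forall M1, map_lt1 M1 M' -> chromatic_switch col M' M1 ->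
     (exists x l, [/\ x \in Defs.comp M' h, l != x, l != einv M' x,
        l \in Defs.comp M' h & einv M1 = sw (einv M') x l]) -> litO (v M1)) ->
  litO (v M').
Proof.
move=> vM M0 nmono IH; have mM := einv_matching M0; have /matchingP[aK af] := mM.
(* Colours are constant on vertices, so a component without bichromatic edge would be monochromatic.
   The end of colour [true] is called [g]. *)
have [g gK [Bg Bag]] : exists2 g, g \in Defs.comp M' h & col g /\ ~~ col (einv M' g).
  apply: contrapT => no; apply: nmono => x xK.
  apply: (comp_invariant (M := M')) xK => y yK; first by rewrite vM colp.
  case: (boolP (col y)) => cy.
    by apply: contrapT => /negP cay; apply: no; exists y => //; split=> //; case: (col _) cay.
  apply/negbTE/negP => cay; apply: no; exists (einv M' y); last by rewrite aK.
  exact: comp_einv.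
pose h1 := einv M' g.
have sumM : matching (sum_perm (einv M') a2) by rewrite matching_sum mM.
apply: (nval_step phiL phiO sumM (g := inl g)); rewrite ?sum_perml // => -[l|y] lg lag Bl.
  have {}lg : l != g by apply: contraNneq lg => ->.
  have {}lag : l != h1 by apply: contraNneq lag => ->.
  have lah1 : l != einv M' h1 by rewrite aK.
  rewrite sw_sum !gncomp_sum leq_add2r.
  have [le|gt] := leqP (gncomp (vperm M) (sw (einv M') h1 l)) (gncomp (vperm M) (einv M')).
    by left.
  right.
  have mM1 := matching_sw mM lag lah1; have /matchingP[sK sf] := mM1.
  have sKb : [forall y, sw (einv M') h1 l (sw (einv M') h1 l y) == y] by exact/'forall_eqP.
  pose M1 := CMap (vperm M') sKb.
  have inM1 : in_M0 M1 by apply/eqP/setP => y; rewrite !inE; apply/negbTE/sf.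
  have nM1 : ncomp M1 = (ncomp M').+1.
    apply/eqP; rewrite eqn_leq; apply/andP; split; rewrite /= ncomp_gncomp /= vM.
      by rewrite ncomp_gncomp vM gncomp_sw_le.
    by rewrite ncomp_gncomp vM.
  have h1K : h1 \in Defs.comp M' h by apply: comp_einv.
  apply: (IH M1).
  - split=> //; split=> //; exists (einv M' h1), (einv M' l), h1, l; split.
      exact: uniq_switch'.
    by rewrite /M1 /= sw_mul_involutive.
  - split.
      split=> //; exists h1, l, (einv M' h1), (einv M' l); split.
        exact: uniq_switch.
      by rewrite /M1 /= involutive_mul_sw.
    exists h1, l; split=> //.
    + rewrite /M1 /= sw_h ?af // sw_l ?af // (inj_eq perm_inj) lag.
      by rewrite (inj_eq perm_inj) eq_sym lag.
    + by rewrite /h1 aK Bg (negPf Bag).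
    + by move: Bl; rewrite /B sum_perml.
    + rewrite /h1 aK Bg (negPf Bag); move: Bl; rewrite /B sum_perml /=.
      by case: (col l); case: (col (einv M' l)).
  - exists h1, l; split=> //; rewrite /M1 //.
    apply: contraTT gt => lK; rewrite -leqNgt.
    apply: gncomp_sw_far => //.
    by rewrite -vM (gcomp_eq h1K).
(* There remain the edges among the spectators: they are never in the component of [g], so these
   switches create no component. *)
have inlI : injective (@inl 'I_m H2) by move=> ? ? [].
left; apply: gncomp_sw_far => //.
- by case/matchingP: sumM.
- by rewrite !sum_perml (inj_eq inlI) af.
- by rewrite sum_permr; case/matchingP: a2m => _ f; apply: contraNneq (f y) => -[->].
- by rewrite sum_perml.
exact: gcomp_suml.
Qed.

Lemma minimal_non_mono_small (M' : cmap m) h : vperm M' = vperm M -> in_M0 M' ->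
  minimal_non_mono col M' h -> litO (v M').
Proof.
move=> vM M0 [nmono Kmin]; apply: (descent_step vM M0 nmono) => M1 [_ n1].
move=> [[_ _ v1 _] _] [x [l [xK lx lax lK aE]]].
have := minimal_sw M0 Kmin xK lK lx lax.
by rewrite -aE v1 -ncomp_gncomp n1 ltnn.
Qed.

(** Each step adds a component, and there are at most [m]. A map satisfying (P1) is its own
    admissible descendant; otherwise a descendant of [M1] is one of [M'], its path being preceded by
    the step from [M'] to [M1]. *)
Theorem descent (M' : cmap m) : vperm M' = vperm M -> in_M0 M' ->
  (forall Mhat, admissible_descendant col M' Mhat ->
     (exists h, minimal_non_mono col Mhat h) \/ litO (v Mhat)) ->
  litO (v M').
Proof.
have [n] := ubnP (m - ncomp M')%N; elim: n M' => // n IH M' nM vM M0 adm.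
have [P1M|nP1] := pselect (P1 col M').
  have [|[h hmin]|//] := adm M'; last exact: minimal_non_mono_small hmin.
  by split=> //; left.
have [h nmono] : exists h, ~ monochromatic col M' h.
  apply: contrapT => no; apply: nP1 => h; left; apply: contrapT => nmono.
  by apply: no; exists h.
apply: (descent_step vM M0 nmono) => M1 lt1 chr _.
have [[inM1 _ v1 _] n1] := lt1.
have st : admissible_step col M' M1 by split=> //; apply: t_step.
apply: IH => //.
  have := gncomp_le_card (vperm M1) (einv M1).
  rewrite -ncomp_gncomp card_ord; lia.
  by rewrite v1.
move=> Mhat [le1 P1hat path]; apply: adm; split=> //.
  right; case: le1 => [->|lt]; first exact: t_step.
  exact: t_trans lt (t_step _ _ _ _ lt1).
move=> _; have [->|ne] := pselect (Mhat = M1); first exact: t_step.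
exact: t_trans (t_step _ _ _ _ st) (path ne).
Qed.

End AdmissibleDescent.

(** * Polynomial functions of a random matrix *)

Local Open Scope classical_set_scope.

Section PolynomialFunctions.
Variables (R : realType) (N : nat).
Local Notation C := (cplx R).
Local Notation M := 'M[C]_N.

(** An inductive class, so that measurability, boundedness on unitary matrices and separation of
    variables are proved by induction. *)
Inductive polf : (M -> C) -> Prop :=
| polf_const c : polf (fun=> c)
| polf_entry i j : polf (fun X => X i j)
| polf_add F G : polf F -> polf G -> polf (fun X => F X + G X)
| polf_mul F G : polf F -> polf G -> polf (fun X => F X * G X)
| polf_conj F : polf F -> polf (fun X => (F X)^*).

Lemma polf_sum (I : Type) (r : seq I) (Q : pred I) (F : I -> M -> C) :
  (forall i, polf (F i)) -> polf (fun X => \sum_(i <- r | Q i) F i X).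
Proof.
move=> FP; elim: r => [|i r IH].
  by under eq_fun do rewrite big_nil; apply: polf_const.
under eq_fun do rewrite big_cons; case: (Q i) => //; exact: polf_add.
Qed.

Lemma polf_comp F (f : M -> M) : (forall i j, polf (fun X => f X i j)) ->
  polf F -> polf (fun X => F (f X)).
Proof.
move=> fP; elim=> [c|i j|G K _ IG _ IK|G K _ IG _ IK|G _ IG].
- exact: polf_const.
- exact: fP.
- exact: polf_add.
- exact: polf_mul.
- exact: polf_conj.
Qed.

Lemma polf_mulmx (A B : M) F : polf F -> polf (fun X => F (A *m X *m B)).
Proof.
apply: polf_comp => i j; under eq_fun do rewrite mxE.
apply: polf_sum => k; apply: polf_mul; last exact: polf_const.
under eq_fun do rewrite mxE.
by apply: polf_sum => l; apply: polf_mul; [exact: polf_const|exact: polf_entry].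
Qed.

Lemma trmxCE (X : M) i j : (X ^t*) i j = (X j i)^*.
Proof. by rewrite !mxE. Qed.

Lemma adjmxK (X : M) : (X ^t*) ^t* = X.
Proof. by apply/matrixP => i j; rewrite !trmxCE conjCK. Qed.

Lemma adjmxM (X Y : M) : (X *m Y) ^t* = Y ^t* *m X ^t*.
Proof. by rewrite trmx_mul map_mxM. Qed.

Lemma polf_adj F : polf F -> polf (fun X => F (X ^t*)).
Proof.
apply: polf_comp => i j; under eq_fun do rewrite trmxCE.
exact/polf_conj/polf_entry.
Qed.

Lemma conjE (z : C) : z^* = (z^*)%C.
Proof. by []. Qed.

Let W := g_sigma_algebraType (@open M).

Lemma ReD (z w : C) : complex.Re (z + w) = complex.Re z + complex.Re w.
Proof. by case: z w => ? ? []. Qed.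

Lemma ImD (z w : C) : complex.Im (z + w) = complex.Im z + complex.Im w.
Proof. by case: z w => ? ? []. Qed.

Lemma ReB (z w : C) : complex.Re (z - w) = complex.Re z - complex.Re w.
Proof. by case: z w => ? ? []. Qed.

Lemma ImB (z w : C) : complex.Im (z - w) = complex.Im z - complex.Im w.
Proof. by case: z w => ? ? []. Qed.

Lemma ReM (z w : C) : complex.Re (z * w) =
  complex.Re z * complex.Re w - complex.Im z * complex.Im w.
Proof. by case: z w => ? ? []. Qed.

Lemma ImM (z w : C) : complex.Im (z * w) =
  complex.Re z * complex.Im w + complex.Im z * complex.Re w.
Proof. by case: z w => ? ? []. Qed.

Lemma ReJ (z : C) : complex.Re z^* = complex.Re z.
Proof. by rewrite conjE; case: z. Qed.

Lemma ImJ (z : C) : complex.Im z^* = - complex.Im z.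
Proof. by rewrite conjE; case: z. Qed.

Lemma continuous_Re : continuous (@complex.Re R : C -> R).
Proof.
move=> z A /= /(nbhs_ballP (complex.Re z)) [e /= e0 eA].
apply/nbhs_ballP; exists (e%:C)%C => /=; first by rewrite ltcR.
move=> w zw; apply: eA; have {}zw : `|z - w| < (e%:C)%C :> C := zw.
change (`|complex.Re z - complex.Re w| < e); rewrite -ReB -ltcR.
by apply: le_lt_trans zw; exact: normc_ge_Re.
Qed.

Lemma continuous_Im : continuous (@complex.Im R : C -> R).
Proof.
move=> z A /= /(nbhs_ballP (complex.Im z)) [e /= e0 eA].
apply/nbhs_ballP; exists (e%:C)%C => /=; first by rewrite ltcR.
move=> w zw; apply: eA; have {}zw : `|z - w| < (e%:C)%C :> C := zw.
change (`|complex.Im z - complex.Im w| < e); rewrite -ImB -ltcR.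
by apply: le_lt_trans zw; rewrite nmE lecR; exact: nm_Im.
Qed.

Lemma continuous_borel (f : M -> R) : continuous f -> measurable_fun setT (f : W -> R).
Proof.
move=> fc; apply: (@measurability _ _ W R setT f _ (measurable_realfun.RGenOpens.measurableE R)).
move=> _ [_ [x [y ->]] <-]; rewrite setTI; apply: sub_sigma_algebra.
apply: open_comp; [by move=> ? _; exact: fc | exact: interval_open].
Qed.

Lemma polf_measurable F : polf F ->
  measurable_fun setT ((fun X => complex.Re (F X)) : W -> R) /\
  measurable_fun setT ((fun X => complex.Im (F X)) : W -> R).
Proof.
elim=> [c|i j|G K _ [IG1 IG2] _ [IK1 IK2]|G K _ [IG1 IG2] _ [IK1 IK2]|G _ [IG1 IG2]].
- by split; apply: measurable_cst.
- split; apply: continuous_borel => X; apply: continuous_comp;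
    by [exact: coord_continuous | exact: continuous_Re | exact: continuous_Im].
- split.
    under eq_fun do rewrite ReD; exact: measurable_funD.
  under eq_fun do rewrite ImD; exact: measurable_funD.
- split; [under eq_fun do rewrite ReM | under eq_fun do rewrite ImM].
    by apply: measurable_funB; apply: measurable_funM.
  by apply: measurable_funD; apply: measurable_funM.
- split; [under eq_fun do rewrite ReJ | under eq_fun do rewrite ImJ] => //.
  exact: measurable_funN.
Qed.

Definition borel_set : set (set M) := <<s open >>.

Lemma borelP (A : set M) : borel_set A = measurable (A : set W).
Proof. by []. Qed.

Lemma unitary_entry (X : M) i j : unitary_group X -> nm (X i j) <= 1.
Proof.
move=> /= /unitarymxP /matrixP/(_ i i); rewrite !mxE eqxx mulr1n => e.
have {}e : \sum_k nm (X i k) ^+ 2 = 1.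
  apply: (@complexI R); rewrite rmorph_sum /= -[RHS]e; apply: eq_bigr => k _.
  by rewrite trmxCE conjE mul_conj_nm.
rewrite -(ler_pXn2r (n := 2)) ?nnegrE ?nm_ge0 // expr1n -e (bigD1 j) //= lerDl.
by apply: sumr_ge0 => k _; rewrite exprn_ge0 // nm_ge0.
Qed.

Lemma polf_bounded F : polf F ->
  exists2 K : R, 0 <= K & forall X, unitary_group X -> nm (F X) <= K.
Proof.
elim=> [c|i j|G K _ [a a0 aG] _ [b b0 bK]|G K _ [a a0 aG] _ [b b0 bK]|G _ [a a0 aG]].
- by exists (nm c); rewrite ?nm_ge0.
- by exists 1 => // X; apply: unitary_entry.
- exists (a + b) => [|X XU]; first exact: addr_ge0.
  by apply: le_trans (nm_le_add _ _) (lerD (aG _ XU) (bK _ XU)).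
- exists (a * b) => [|X XU]; first exact: mulr_ge0.
  by rewrite nmM ler_pM ?nm_ge0 ?aG ?bK.
- by exists a => // X XU; rewrite conjE nmJ aG.
Qed.

(** Each entry of the product is a finite sum of products of a function of [X] and a function of
    [Y]. This algebraic form stands in for Fubini's theorem. *)
Lemma polf_separable F : polf F -> exists (K : finType) (g h : K -> M -> C),
  [/\ forall k, polf (g k), forall k, polf (h k) &
      forall X Y, F (X ^t* *m Y) = \sum_k g k X * h k Y].
Proof.
elim=> [c|i j|F1 F2 _ [K1 [g1 [h1 [gP1 hP1 E1]]]] _ [K2 [g2 [h2 [gP2 hP2 E2]]]]|
  F1 F2 _ [K1 [g1 [h1 [gP1 hP1 E1]]]] _ [K2 [g2 [h2 [gP2 hP2 E2]]]]|
  F1 _ [K1 [g1 [h1 [gP1 hP1 E1]]]]].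
- exists unit, (fun _ _ => c), (fun _ _ => 1); split=> [k|k|X Y].
  + exact: polf_const.
  + exact: polf_const.
  + by rewrite big_const card_unit /= addr0 mulr1.
- exists 'I_N, (fun k X => (X k i)^*), (fun k Y => Y k j); split=> [k|k|X Y].
  + exact/polf_conj/polf_entry.
  + exact/polf_entry.
  + by rewrite mxE; apply: eq_bigr => k _; rewrite trmxCE.
- exists (K1 + K2)%type, (fun k => match k with inl k => g1 k | inr k => g2 k end),
    (fun k => match k with inl k => h1 k | inr k => h2 k end).
  split=> [[]|[]|X Y] //.
  by rewrite big_sumType /= E1 E2.
- exists (K1 * K2)%type, (fun k X => g1 k.1 X * g2 k.2 X),
    (fun k X => h1 k.1 X * h2 k.2 X).
  split=> [k|k|X Y]; rewrite ?E1 ?E2; try by apply: polf_mul.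
  rewrite mulr_suml -(pair_big xpredT xpredT (fun k1 k2 => g1 k1 X * g2 k2 X *
    (h1 k1 Y * h2 k2 Y))) /=.
  apply: eq_bigr => k1 _; rewrite mulr_sumr; apply: eq_bigr => k2 _.
  by rewrite mulrACA.
- exists K1, (fun k X => (g1 k X)^*), (fun k X => (h1 k X)^*).
  split=> [k|k|X Y]; try exact: polf_conj.
  by rewrite E1 rmorph_sum; apply: eq_bigr => k _; rewrite rmorphM.
Qed.

End PolynomialFunctions.

(** * Integration against the law of [U] *)

Section Expectation.
Context (R : realType) (N : nat) (d : measure_display) (T : measurableType d).
Variables (P : probability T R) (G : set 'M[cplx R]_N) (U : T -> 'M[cplx R]_N).
Local Notation C := (cplx R).
Local Notation M := 'M[C]_N.
Hypotheses (haar : haar_distributed P G U) (mG : borel_set G)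
  (GU : G `<=` unitary_group (R := R) (N := N)).

Let W := g_sigma_algebraType (@open M).
Let D := U @^-1` G.

Let mU (f : M -> R) : measurable_fun setT (f : W -> R) -> measurable_fun setT (f \o U).
Proof.
move=> mf _ B mB; rewrite setTI -[_ @^-1` _]/(U @^-1` (f @^-1` B)).
case: haar => h _ _; apply: h; have := mf measurableT B mB.
by rewrite setTI.
Qed.

Let mD : measurable D. Proof. by case: haar => h _ _; apply: h. Qed.
Let PD : P D = 1%E. Proof. by case: haar. Qed.
Let PDm : (P : {measure set T -> \bar R}) D = 1%E := PD.

Definition bfun (f : M -> R) := measurable_fun setT (f : W -> R) /\
  exists K : R, forall X, G X -> `|f X| <= K.

(** Polynomials are bounded on the group only, hence the restriction to the event [D], of
    probability 1, that [U] lies in it. *)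
Definition Ere (f : M -> R) : R := (\int[P]_(w in D) f (U w))%R.

Lemma bfun_integrable f : bfun f -> P.-integrable D (EFin \o (f \o U)).
Proof.
move=> [mf [K fK]]; apply: measurable_bounded_integrable => //.
- by rewrite -ge0_fin_numE ?fin_num_measure.
- exact: measurable_funS (mU mf).
- exists K; split; first exact: num_real.
  by move=> x Kx w Dw; apply: le_trans (fK _ Dw) (ltW Kx).
Qed.

Lemma Ere_add f g : bfun f -> bfun g -> Ere (fun X => f X + g X) = Ere f + Ere g.
Proof. by move=> bf bg; apply: RintegralD => //; apply: bfun_integrable. Qed.

Lemma Ere_scale c f : bfun f -> Ere (fun X => c * f X) = c * Ere f.
Proof. by move=> bf; apply: RintegralZl => //; apply: bfun_integrable. Qed.

Lemma Ere_cst c : Ere (fun=> c) = c.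
Proof. by rewrite /Ere Rintegral_cst // PDm mulr1. Qed.

Lemma Ere_eq f g : (forall X, G X -> f X = g X) -> Ere f = Ere g.
Proof. by move=> fg; apply: eq_Rintegral => w; rewrite inE => /fg. Qed.

Lemma Ere_le f g : bfun f -> bfun g -> (forall X, G X -> f X <= g X) -> Ere f <= Ere g.
Proof.
by move=> bf bg fg; apply: le_Rintegral => //; try exact: bfun_integrable; move=> w /fg.
Qed.

Lemma bfun_cst c : bfun (fun=> c).
Proof. by split; [apply: measurable_cst | exists `|c|]. Qed.

Lemma Ere_abs f (K : R) : bfun f -> (forall X, G X -> `|f X| <= K) -> `|Ere f| <= K.
Proof.
move=> bf fK; rewrite ler_norml; apply/andP; split.
  rewrite -(Ere_cst (- K)); apply: Ere_le => //; first exact: bfun_cst.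
  by move=> X /fK; rewrite ler_norml => /andP[].
rewrite -[leRHS](Ere_cst K); apply: Ere_le => //; first exact: bfun_cst.
by move=> X /fK; rewrite ler_norml => /andP[].
Qed.

(** Invariance is an equality between probabilities of Borel sets, so both means are read off the
    laws of real random variables. *)
Lemma Ere_left f V : bfun f -> bfun (fun X => f (V *m X)) -> G V ->
  (forall X, G (V *m X) <-> G X) ->
  Ere (fun X => f (V *m X)) = Ere f.
Proof.
move=> [mf bf] [mfV bfV] GV VG.
(* The indicator of [G] replaces the restriction to [D] and makes the function bounded on all
   matrices. *)
pose F (X : M) : R := f X * \1_G X.
have mF : measurable_fun setT (F : W -> R).
  by apply: measurable_funM => //; apply: measurable_indic.
have mFV : measurable_fun setT ((fun X => F (V *m X)) : W -> R).
  have -> : (fun X => F (V *m X)) = (fun X => f (V *m X) * \1_G X).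
    by apply/funext => X; rewrite /F !indicE; congr (_ * (nat_of_bool _)%:R);
      apply/idP/idP; rewrite !inE => /VG.
  by apply: measurable_funM => //; apply: measurable_indic.
have toF (g : M -> R) : Ere g = (\int[P]_w (g (U w) * \1_G (U w)))%R.
  rewrite /Ere Rintegral_mkcond; apply: eq_Rintegral => w _.
  by rewrite patchE indicE /D; have -> : (w \in U @^-1` G) = (U w \in G);
    rewrite ?inE //; case: ifP => _; rewrite ?mulr1 ?mulr0.
have bF (H : M -> R) : measurable_fun setT (H : W -> R) ->
    (exists K : R, forall X, `|H X| <= K) -> P.-integrable setT (EFin \o (H \o U)).
  move=> mH [K HK]; apply: measurable_bounded_integrable => //.
  - by rewrite -ge0_fin_numE ?fin_num_measure.
  - exact: mU.
  - by exists K; split; [exact: num_real | move=> x Kx w _; apply: le_trans (HK _) (ltW Kx)].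
have toP (H : M -> R) : measurable_fun setT (H : W -> R) ->
    (exists K : R, forall X, `|H X| <= K) ->
    (\int[P]_w H (U w))%R = fine (\int[pushforward P (H \o U)]_x x%:E)%E.
  move=> mH bH; rewrite integral_pushforward //; first exact: mU.
  - exact: (bF _ mH bH).
have bdF : exists K : R, forall X, `|F X| <= K.
  have [K fK] := bf; exists `|K| => X; rewrite /F indicE.
  case: (boolP (X \in G)) => [|_]; last by rewrite mulr0 normr0.
  by rewrite inE => /fK h; rewrite mulr1 (le_trans h) ?ler_norm.
rewrite !toF.
transitivity (\int[P]_w F (V *m U w))%R.
  apply: eq_Rintegral => w _; rewrite /F !indicE; congr (_ * (nat_of_bool _)%:R).
  by apply/idP/idP; rewrite !inE => /VG.
rewrite (toP (fun X => F (V *m X)) mFV); last by have [K FK] := bdF; exists K => X.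
rewrite (toP F mF bdF); congr fine; apply: eq_measure_integral;
  [exact: mU | exact: mU | move=> ? ? A mA _].
have [_ _ inv] := haar.
rewrite /pushforward /=; apply: (inv V GV (F @^-1` A)).
by have := mF measurableT A mA; rewrite setTI.
Qed.

Lemma polf_bfun F : polf F ->
  bfun (fun X => complex.Re (F X)) /\ bfun (fun X => complex.Im (F X)).
Proof.
move=> pF; have [m1 m2] := polf_measurable pF; have [K _ FK] := polf_bounded pF.
by split; split=> //; exists K => X /GU/FK; apply: le_trans; [exact: nm_Re | exact: nm_Im].
Qed.

Definition Ex (F : M -> C) : C :=
  (Ere (fun X => complex.Re (F X)) +i* Ere (fun X => complex.Im (F X)))%C.

Lemma Ex_eq F F' : (forall X, G X -> F X = F' X) -> Ex F = Ex F'.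
Proof. by move=> e; congr (_ +i* _)%C; apply: Ere_eq => X /e ->. Qed.

Lemma Ex_add F F' : polf F -> polf F' -> Ex (fun X => F X + F' X) = Ex F + Ex F'.
Proof.
move=> /polf_bfun[r1 i1] /polf_bfun[r2 i2].
by congr (_ +i* _)%C; rewrite -Ere_add //; apply: Ere_eq => X _; rewrite ?ReD ?ImD.
Qed.

Lemma bfun_scale c f : bfun f -> bfun (fun X => c * f X).
Proof.
move=> [mf [K fK]]; split; first by apply: measurable_funM.
by exists (`|c| * K) => X /fK h; rewrite normrM ler_wpM2l.
Qed.

Lemma Ex_scale c F : polf F -> Ex (fun X => c * F X) = c * Ex F.
Proof.
move=> /polf_bfun[r1 i1].
case: c => x y; rewrite /Ex; apply/eqP; rewrite eq_complex /=; apply/andP; split.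
  rewrite -[in eqbRHS](Ere_scale x r1) -mulNr -(Ere_scale _ i1) -Ere_add;
    try exact: bfun_scale.
  by apply/eqP/Ere_eq => X _; rewrite ReM mulNr.
rewrite -[in eqbRHS](Ere_scale x i1) -(Ere_scale _ r1) -Ere_add;
    try exact: bfun_scale.
by apply/eqP/Ere_eq => X _; rewrite ImM.
Qed.

Lemma Ex_cst c : Ex (fun=> c) = c.
Proof. by rewrite /Ex !Ere_cst; case: c. Qed.

Lemma Ex_sum (I : Type) (r : seq I) (Q : pred I) (F : I -> M -> C) :
  (forall i, polf (F i)) ->
  Ex (fun X => \sum_(i <- r | Q i) F i X) = \sum_(i <- r | Q i) Ex (F i).
Proof.
move=> FP; elim: r => [|i r IH].
  by under Ex_eq => X _ do rewrite big_nil; rewrite Ex_cst big_nil.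
under Ex_eq => X _ do rewrite big_cons; rewrite big_cons.
by case: (Q i) => //; rewrite Ex_add ?IH //; apply: polf_sum.
Qed.

Lemma Ex_bound F (K : R) : polf F -> (forall X, G X -> nm (F X) <= K) ->
  nm (Ex F) <= 2 * K.
Proof.
(* The factor 2 comes from bounding the real and the imaginary part separately. *)
move=> /polf_bfun[r1 i1] FK; apply: le_trans (nm_le_ReIm _) _.
rewrite mulr_natl mulr2n; apply: lerD; apply: Ere_abs => // X /FK; apply: le_trans.
  exact: nm_Re.
exact: nm_Im.
Qed.

Hypotheses (GM : forall V X, G V -> G X -> G (V *m X))
  (GA : forall X, G X -> G (X ^t*)) (G1 : G 1%:M).

Let GVX V X : G V -> (G (V *m X) <-> G X).
Proof.
move=> GV; split; last exact: GM.
move=> /(GM (GA GV)); rewrite mulmxA.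
have /unitarymxP : V ^t* \is unitarymx by rewrite trmxC_unitary; apply: GU.
by rewrite adjmxK => ->; rewrite mul1mx.
Qed.

Lemma Ex_left F V : polf F -> G V -> Ex (fun X => F (V *m X)) = Ex F.
Proof.
move=> pF GV; have [r1 i1] := polf_bfun pF.
have pFV : polf (fun X => F (V *m X)).
  by have := polf_mulmx V 1%:M pF; under eq_fun do rewrite mulmx1.
have [r2 i2] := polf_bfun pFV.
by congr (_ +i* _)%C; apply: Ere_left => // X; apply: GVX.
Qed.

(* Averages F (X^t* Y V) over X and over Y: as a finite sum of products
   g X * h Y it needs no measure on the product. *)
Lemma Ex_right F V : polf F -> G V ->
  Ex (fun X => F (X *m V)) = Ex (fun X => F (X ^t*)).
Proof.
move=> pF GV; pose FV X := F (X *m V).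
have pFV : polf FV.
  by have := polf_mulmx 1%:M V pF; under eq_fun do rewrite mul1mx.
have [K [g [h [pg ph E]]]] := polf_separable pFV.
have E1 X : G X -> \sum_k g k X * Ex (h k) = Ex FV.
  move=> GX; rewrite -(Ex_left pFV (GA GX)).
  under [RHS]Ex_eq => Y _ do rewrite E.
  rewrite Ex_sum => [|k]; last by apply: polf_mul; [exact: polf_const|].
  by apply: eq_bigr => k _; rewrite Ex_scale.
have E2 Y : G Y -> \sum_k h k Y * Ex (g k) = Ex (fun X => F (X ^t*)).
  move=> GY; have pA := polf_adj pF.
  have GYV : G ((Y *m V) ^t*) by apply/GA/GM.
  rewrite -(Ex_left pA GYV).
  transitivity (Ex (fun X => FV (X ^t* *m Y))); last first.
    apply: Ex_eq => X _; rewrite /FV -mulmxA; congr F.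
    by rewrite [RHS]adjmxM adjmxK.
  under [RHS]Ex_eq => X _ do rewrite E.
  rewrite Ex_sum => [|k]; last by apply: polf_mul; [|exact: polf_const].
  apply: eq_bigr => k _; rewrite -Ex_scale //; apply: Ex_eq => X _; exact: mulrC.
transitivity (\sum_k Ex (g k) * Ex (h k)).
  rewrite -[LHS]/(Ex FV) -[LHS]Ex_cst -(Ex_eq E1) Ex_sum => [|k].
    by apply: eq_bigr => k _; rewrite mulrC -Ex_scale //; apply: Ex_eq => X _; exact: mulrC.
  by apply: polf_mul; [|exact: polf_const].
rewrite -[RHS]Ex_cst -(Ex_eq E2) Ex_sum => [|k].
  by apply: eq_bigr => k _; rewrite -Ex_scale //; apply: Ex_eq => X _; exact: mulrC.
by apply: polf_mul; [|exact: polf_const].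
Qed.

Lemma Ex_conj F V : polf F -> G V -> Ex (fun X => F (V *m X *m V ^t*)) = Ex F.
Proof.
move=> pF GV; pose F' X := F (X *m V ^t*).
have pF' : polf F'.
  by have := polf_mulmx 1%:M (V ^t*) pF; under eq_fun do rewrite mul1mx.
rewrite -[LHS]/(Ex (fun X => F' (V *m X))) Ex_left // Ex_right //; last exact: GA.
(* The mean of [F (X *m V)] has been shown not to depend on [V], so the identity can be put in its
   place. *)
by rewrite -(Ex_right pF G1); apply: Ex_eq => X _; rewrite mulmx1.
Qed.

End Expectation.

(** * Plane rotations and the Lie derivative of the mean *)

Section Groups.
Variables (R : realType) (N : nat).
Local Notation C := (cplx R).
Local Notation M := 'M[C]_N.
Let W := g_sigma_algebraType (@open M).

Lemma borel_level (F : M -> C) (c : C) : polf F -> borel_set [set X | F X = c].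
Proof.
move=> /polf_measurable[r i]; rewrite borelP.
have -> : [set X | F X = c] =
  [set X | complex.Re (F X) = complex.Re c] `&` [set X | complex.Im (F X) = complex.Im c].
  apply/seteqP; split=> X /=; first by move=> ->.
  by case: (F X) c => ? ? [? ?] /= [-> ->].
apply: measurableI.
  rewrite -[X in measurable X]setTI.
  exact: (r measurableT [set complex.Re c] (measurable_set1 _)).
rewrite -[X in measurable X]setTI.
exact: (i measurableT [set complex.Im c] (measurable_set1 _)).
Qed.

Lemma borel_forall (I : finType) (A : I -> set M) :
  (forall i, borel_set (A i)) -> borel_set [set X | forall i, A i X].
Proof.
move=> mA; rewrite borelP.
have -> : [set X | forall i, A i X] = \big[setI/setT]_(i <- enum I) A i.
  apply/seteqP; split=> X /=.
    by move=> h; elim: (enum I) => [|i r IH]; rewrite ?big_nil ?big_cons //; split.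
  move=> h i; have : i \in enum I by rewrite mem_enum.
  elim: (enum I) h => // j r IH; rewrite big_cons inE => -[h1 h2] /predU1P[->//|].
  exact: IH.
by elim/big_ind: _ => [|? ? h1 h2|i _]; [exact: measurableT|exact: measurableI|exact: mA].
Qed.

Lemma polf_entry_mul (A B : M -> M) i j : (forall k l, polf (fun X => A X k l)) ->
  (forall k l, polf (fun X => B X k l)) -> polf (fun X => (A X *m B X) i j).
Proof.
move=> pA pB; under eq_fun do rewrite mxE.
by apply: polf_sum => k; apply: polf_mul.
Qed.

Lemma borel_mx_eq (A : M -> M) (B : M) : (forall k l, polf (fun X => A X k l)) ->
  borel_set [set X | A X = B].
Proof.
move=> pA; have -> : [set X | A X = B] = [set X | forall k : 'I_N * 'I_N, A X k.1 k.2 = B k.1 k.2].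
  apply/seteqP; split=> X /= => [-> //|h].
  by apply/matrixP => i j; apply: (h (i, j)).
by apply: (borel_forall (A := fun k => [set X | A X k.1 k.2 = B k.1 k.2])) => k;
  apply: borel_level.
Qed.

Lemma borel_unitary : borel_set (@unitary_group R N).
Proof.
have -> : @unitary_group R N = [set X | X *m X ^t* = 1%:M].
  by apply/seteqP; split=> X /= /unitarymxP.
apply: borel_mx_eq => k l; apply: polf_entry_mul => i j; first exact: polf_entry.
by under eq_fun do rewrite trmxCE; apply/polf_conj/polf_entry.
Qed.

Lemma realmx_conj (X : M) : (X \is a realmx) = (map_mx Num.conj X == X).
Proof.
apply/mxOverP/eqP => [h|h i j].
  by apply/matrixP => i j; rewrite mxE; apply/CrealP/h.
by apply/CrealP; rewrite -[in RHS]h mxE.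
Qed.

Lemma orthogonal_unitary : @orthogonal_group R N `<=` @unitary_group R N.
Proof.
move=> X /= [Xr XX]; apply/unitarymxP; rewrite -[RHS]XX; congr (_ *m _).
by rewrite -map_trmx; move: Xr; rewrite realmx_conj => /eqP ->.
Qed.

Lemma borel_orthogonal : borel_set (@orthogonal_group R N).
Proof.
have -> : @orthogonal_group R N =
    [set X | map_mx Num.conj X - X = 0] `&` [set X | X *m X^T = 1%:M].
  apply/seteqP; split=> X; rewrite /orthogonal_group /mkset /setI /=.
    by rewrite realmx_conj => -[/eqP h1 h2]; split=> //; rewrite h1 subrr.
  by rewrite realmx_conj => -[h1 h2]; split=> //; rewrite -subr_eq0 h1.
rewrite borelP; apply: measurableI; rewrite -borelP.
  apply: borel_mx_eq => k l; under eq_fun do rewrite !mxE.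
  apply: polf_add; first exact/polf_conj/polf_entry.
  under eq_fun do rewrite -mulN1r.
  by apply: polf_mul; [exact: polf_const|exact: polf_entry].
apply: borel_mx_eq => k l; apply: polf_entry_mul => i j; first exact: polf_entry.
by under eq_fun do rewrite mxE; apply: polf_entry.
Qed.

End Groups.

(** * Plane rotations and first-order expansions *)

Section Derivation.
Variables (R : realType) (N : nat) (a b : 'I_N).
Hypothesis ab : a != b.
Local Notation C := (cplx R).
Local Notation M := 'M[C]_N.

(** The image of [f] under the infinitesimal rotation [E_ab - E_ba], read at [i]. *)
Definition gen_row (f : 'I_N -> C) (i : 'I_N) : C :=
  f b *+ (i == a) - f a *+ (i == b).

Definition givens_row (c s : R) (f : 'I_N -> C) (i : 'I_N) : C :=
  if i == a then c%:C%C * f a + s%:C%C * f b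
  else if i == b then c%:C%C * f b - s%:C%C * f a else f i.

Definition givens (c s : R) : M := \matrix_(i, j) givens_row c s (fun k => (k == j)%:R) i.

Let ba : b == a = false. Proof. by rewrite eq_sym (negPf ab). Qed.

Lemma sum_delta (f : 'I_N -> C) i : \sum_j (i == j)%:R * f j = f i.
Proof.
by rewrite (bigD1 i) //= eqxx mul1r big1 ?addr0 // => j /negPf; rewrite eq_sym => ->; rewrite mul0r.
Qed.

Lemma givens_mul c s f i : \sum_j givens c s i j * f j = givens_row c s f i.
Proof.
under eq_bigr do rewrite mxE /givens_row.
rewrite /givens_row; case: eqP => _; last case: eqP => _; last exact: sum_delta.
  under eq_bigr do rewrite mulrDl -!mulrA.
  by rewrite big_split /= -!mulr_sumr !sum_delta.
under eq_bigr do rewrite mulrBl -!mulrA.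
by rewrite sumrB /= -!mulr_sumr !sum_delta.
Qed.

Lemma conj_real (x : R) : (x%:C%C : C)^* = x%:C%C.
Proof. by rewrite conjE conjc_real. Qed.

Lemma conj_natb (k : bool) : (k%:R : C)^* = k%:R.
Proof. exact: rmorph_nat. Qed.

Lemma givens_real c s i j : (givens c s i j)^* = givens c s i j.
Proof.
rewrite mxE /givens_row; case: eqP => _; last case: eqP => _.
- by rewrite rmorphD !rmorphM /= !conj_natb !conj_real.
- by rewrite rmorphB !rmorphM /= !conj_natb !conj_real.
- exact: conj_natb.
Qed.

Lemma givens_adj c s : givens c s ^t* = (givens c s)^T.
Proof. by apply/matrixP => i j; rewrite trmxCE givens_real [RHS]mxE. Qed.

Lemma givens_orth c s : c ^+ 2 + s ^+ 2 = 1 -> orthogonal_group (givens c s).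
Proof.
move=> cs; split.
  apply/mxOverP => i j; apply/CrealP; exact: givens_real.
have csC : (c%:C%C ^+ 2 + s%:C%C ^+ 2 : C) = 1.
  by rewrite -!rmorphXn -rmorphD cs.
apply/matrixP => i j; rewrite mxE.
under eq_bigr => k _ do rewrite [_^T k j]mxE.
rewrite (givens_mul c s (fun k => givens c s j k) i) mxE.
rewrite /givens_row !mxE /givens_row.
case: (eqVneq i a) => [ia|ia].
  case: (eqVneq j a) => [ja|ja].
    by rewrite ?ia ?ja ?eqxx ?ba ?(negPf ab) !mulr1 !mulr0 ?addr0 ?add0r -!expr2 csC.
  case: (eqVneq j b) => [jb|jb].
    rewrite ?ia ?jb ?eqxx ?ba ?(negPf ab) !mulr1 !mulr0 ?addr0 ?add0r ?subr0 ?sub0r.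
    by rewrite mulrN mulrC addNr.
  by rewrite ?ia ?(negPf ja) ?(negPf jb) ![_ == j]eq_sym ?(negPf ja) ?(negPf jb) !mulr0 addr0.
case: (eqVneq i b) => [ib|ib].
  case: (eqVneq j a) => [ja|ja].
    rewrite ?ib ?ja ?eqxx ?ba ?(negPf ab) !mulr1 !mulr0 ?addr0 ?add0r.
    by rewrite mulrC subrr.
  case: (eqVneq j b) => [jb|jb].
    rewrite ?ib ?jb ?eqxx ?ba ?(negPf ab) !mulr1 !mulr0 ?addr0 ?add0r ?subr0 ?sub0r.
    by rewrite mulrN opprK -!expr2 csC.
  by rewrite ?ib ?(negPf ja) ?(negPf jb) ![_ == j]eq_sym ?(negPf ja) ?(negPf jb) !mulr0 subr0.
case: (eqVneq j a) => [ja|ja].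
  by rewrite ?ja ?(negPf ia) ?(negPf ib) !mulr0 addr0.
case: (eqVneq j b) => [jb|jb].
  by rewrite ?jb ?(negPf ia) ?(negPf ib) !mulr0 subr0.
by rewrite eq_sym.
Qed.

(* Derivative of F (V X V^T) along the rotations V of the plane (a, b). *)
Inductive der : (M -> C) -> (M -> C) -> Prop :=
| der_const c : der (fun=> c) (fun=> 0)
| der_entry i j : der (fun X => X i j)
    (fun X => gen_row (fun k => X k j) i + gen_row (fun k => X i k) j)
| der_add F F' G G' : der F F' -> der G G' ->
    der (fun X => F X + G X) (fun X => F' X + G' X)
| der_mul F F' G G' : der F F' -> der G G' ->
    der (fun X => F X * G X) (fun X => F' X * G X + F X * G' X)
| der_conj F F' : der F F' -> der (fun X => (F X)^*) (fun X => (F' X)^*).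

Lemma polf_muln F n : polf F -> polf (fun X : M => F X *+ n).
Proof.
move=> pF; under eq_fun do rewrite -mulr_natl.
by apply: polf_mul => //; apply: polf_const.
Qed.

Lemma polf_opp F : polf F -> polf (fun X : M => - F X).
Proof.
move=> pF; under eq_fun do rewrite -mulN1r.
by apply: polf_mul => //; apply: polf_const.
Qed.

Lemma der_polf F F' : der F F' -> polf F /\ polf F'.
Proof.
elim=> {F F'} [c|i j|F F' G G' _ [pF pF'] _ [pG pG']|F F' G G' _ [pF pF'] _ [pG pG']|F F' _ [pF pF']].
- by split; apply: polf_const.
- split; first exact: polf_entry.
  by apply: polf_add; apply: polf_add; try apply: polf_opp; apply: polf_muln; apply: polf_entry.
- by split; apply: polf_add.
- by split; [|apply: polf_add]; apply: polf_mul.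
- by split; apply: polf_conj.
Qed.

(** Cosine and sine of the angle; [0 <= c] keeps the rotation on the side of the identity, where
    [1 - c] is at most [s ^+ 2], so that [s] can serve as parameter. *)
Definition rotation (c s : R) := [/\ c ^+ 2 + s ^+ 2 = 1, 0 <= c & `|s| <= 1].

Lemma rotation_c c s : rotation c s -> `|c - 1| <= s ^+ 2.
Proof.
move=> [cs c0 s1].
have c1 : c <= 1 by have := sqr_ge0 s; nra.
by rewrite distrC ger0_norm ?subr_ge0 //; nra.
Qed.

Lemma nm_real (x : R) : nm (x%:C%C) = `|x|.
Proof. by rewrite nm_sqrt /= expr0n /= addr0 sqrtr_sqr. Qed.

Lemma givens_row_taylor c s f i (K : R) : rotation c s -> (forall k, nm (f k) <= K) ->
  nm (givens_row c s f i - f i - s%:C%C * gen_row f i) <= K * s ^+ 2.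
Proof.
move=> rot fK; have c1 := rotation_c rot.
have K0 : 0 <= K by apply: le_trans (nm_ge0 _) (fK i).
have B k : nm ((c - 1)%:C%C * f k) <= K * s ^+ 2.
  by rewrite nmM nm_real mulrC ler_pM ?nm_ge0.
rewrite /givens_row /gen_row; have [->|ia] := eqVneq i a.
  rewrite (negPf ab) mulr1n mulr0n subr0.
  rewrite (_ : _ - _ - _ = (c - 1)%:C%C * f a) //.
  by rewrite rmorphB mulrBl mul1r addrAC addrK.
have [->|ib] := eqVneq i b.
  rewrite mulr1n mulr0n sub0r.
  rewrite (_ : _ - _ - _ = (c - 1)%:C%C * f b) //.
  by rewrite rmorphB mulrBl mul1r mulrN opprK addrAC subrK.
by rewrite !mulr0n subr0 mulr0 subrr subr0 nm0 mulr_ge0 // sqr_ge0.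
Qed.

Lemma nm_gen_row f i (K : R) : (forall k, nm (f k) <= K) -> nm (gen_row f i) <= 2 * K.
Proof.
move=> fK; have K0 : 0 <= K by apply: le_trans (nm_ge0 _) (fK i).
have B k (e : bool) : nm (f k *+ e) <= K by case: e; rewrite ?mulr0n ?nm0 ?mulr1n.
by rewrite mulr_natl mulr2n; apply: le_trans (nm_le_add _ _) _; rewrite nmN lerD.
Qed.

Definition conj_by (V X : M) : M := V *m X *m V ^t*.

Lemma conj_by_givens c s (X : M) i j : conj_by (givens c s) X i j =
  givens_row c s (fun l => givens_row c s (fun k => X k l) i) j.
Proof.
rewrite /conj_by givens_adj mxE -(givens_mul c s _ j); apply: eq_bigr => l _.
by rewrite [_^T l j]mxE mulrC; congr (_ * _); rewrite mxE givens_mul.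
Qed.

Lemma conj_by_unitary V (X : M) : unitary_group V -> unitary_group X ->
  unitary_group (conj_by V X).
Proof.
rewrite /unitary_group /conj_by /= => VU XU.
have VaU : V ^t* \is unitarymx by rewrite (trmxC_unitary V).
exact: (mul_unitarymx (mul_unitarymx VU XU) VaU).
Qed.

Lemma taylor_entry i j (X : M) c s : rotation c s -> unitary_group X ->
  nm (conj_by (givens c s) X i j - X i j -
    s%:C%C * (gen_row (fun k => X k j) i + gen_row (fun k => X i k) j)) <= 11 * s ^+ 2.
Proof.
move=> rot XU; have [cs c0 s1] := rot.
have x1 k l : nm (X k l) <= 1 by apply: unitary_entry.
rewrite conj_by_givens; set Y := fun l => givens_row c s (fun k => X k l) i.
have Y0 l : nm (Y l - X i l) <= 3 * `|s|.
  have h1 := givens_row_taylor (f := fun k => X k l) i rot (fun k => x1 k l).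
  have h2 := @nm_gen_row (fun k => X k l) i 1 (fun k => x1 k l).
  rewrite -[_ - _](subrK (s%:C%C * gen_row (fun k => X k l) i)).
  apply: le_trans (nm_le_add _ _) _; rewrite nmM nm_real.
  move: h1 h2; rewrite -(real_normK (num_real s)).
  move: (nm _) (nm _) (`|s|) (normr_ge0 s) s1 => x y z; nra.
have Y1 l : nm (Y l) <= 4.
  rewrite -(subrK (X i l) (Y l)); apply: le_trans (nm_le_add _ _) _.
  have := Y0 l; have := x1 i l; move: s1; lra.
have h1 := givens_row_taylor (f := fun k => X k j) i rot (fun k => x1 k j).
have h2 := givens_row_taylor (f := Y) j rot Y1.
have h3 : nm (gen_row Y j - gen_row (fun k => X i k) j) <= 2 * (3 * `|s|).
  rewrite (_ : _ - _ = gen_row (fun l => Y l - X i l) j); first exact: nm_gen_row.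
  by rewrite /gen_row !mulrnBl; ring.
set r1 := gen_row (fun k => X k j) i; set r2 := gen_row (fun k => X i k) j.
(* Turning the second index costs [4 * s ^+ 2], turning the first one [s ^+ 2], and replacing [Y] by
   the row of [X] in the generator [6 * s ^+ 2]: in all 11. *)
rewrite (_ : _ - _ - _ = (givens_row c s Y j - Y j - s%:C%C * gen_row Y j) +
  (Y j - X i j - s%:C%C * r1) + s%:C%C * (gen_row Y j - r2)); last by ring.
apply: le_trans (nm_le_add _ _) _.
apply: le_trans (lerD (nm_le_add _ _) (lexx _)) _.
rewrite nmM nm_real.
have h4 : `|s| * nm (gen_row Y j - r2) <= `|s| * (2 * (3 * `|s|)) by rewrite ler_wpM2l.
apply: le_trans (lerD (lerD h2 h1) h4) _.
by rewrite -(real_normK (num_real s)); lra.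
Qed.

(** The remainder is uniform over the unitary matrices, so that the expansion can be averaged. *)
Lemma der_taylor F F' : der F F' -> exists2 K : R, 0 <= K &
  forall c s X, rotation c s -> unitary_group X ->
    nm (F (conj_by (givens c s) X) - F X - s%:C%C * F' X) <= K * s ^+ 2.
Proof.
have gU c s : rotation c s -> unitary_group (givens c s).
  by case=> cs _ _; apply/orthogonal_unitary/givens_orth.
elim=> {F F'} [k|i j|F F' G G' _ [K1 K10 h1] _ [K2 K20 h2]|F F' G G' dF [K1 K10 h1] dG [K2 K20 h2]|F F' _ [K1 K10 h1]].
- by exists 0 => // c s X _ _; rewrite subrr mulr0 subr0 nm0 mul0r.
- by exists 11 => // c s X; apply: taylor_entry.
- exists (K1 + K2) => [|c s X rot XU]; first exact: addr_ge0.
  rewrite (_ : _ - _ - _ = (F (conj_by (givens c s) X) - F X - s%:C%C * F' X) +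
    (G (conj_by (givens c s) X) - G X - s%:C%C * G' X)); last by ring.
  by apply: le_trans (nm_le_add _ _) _; rewrite mulrDl lerD ?h1 ?h2.
- have [pF pF'] := der_polf dF; have [pG pG'] := der_polf dG.
  have [a1 a10 ha1] := polf_bounded pF; have [a2 a20 ha2] := polf_bounded pF'.
  have [b1 b10 hb1] := polf_bounded pG; have [b2 b20 hb2] := polf_bounded pG'.
  exists (a1 * K2 + a2 * b2 + a2 * K2 + K1 * b1) => [|c s X rot XU].
    by rewrite !addr_ge0 // mulr_ge0.
  have XU' := conj_by_unitary (gU _ _ rot) XU.
  have [_ _ s1] := rot.
  set e1 := F (conj_by (givens c s) X) - F X - s%:C%C * F' X.
  set e2 := G (conj_by (givens c s) X) - G X - s%:C%C * G' X.
  have {}h1 : nm e1 <= K1 * s ^+ 2 by apply: h1.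
  have {}h2 : nm e2 <= K2 * s ^+ 2 by apply: h2.
  rewrite (_ : _ - _ - _ = F X * e2 + s%:C%C ^+ 2 * (F' X * G' X) +
     s%:C%C * (F' X * e2) + e1 * G (conj_by (givens c s) X)); last first.
    by rewrite /e1 /e2; ring.
  apply: le_trans (nm_le_add _ _) _; rewrite [leRHS]mulrDl; apply: lerD; last first.
    by rewrite nmM mulrAC ler_pM ?nm_ge0 // hb1.
  apply: le_trans (nm_le_add _ _) _; rewrite [leRHS]mulrDl; apply: lerD; last first.
    rewrite !nmM nm_real; apply: (@le_trans _ _ (1 * (nm (F' X) * nm e2))).
      by rewrite ler_wpM2r ?mulr_ge0 ?nm_ge0.
    by rewrite mul1r -mulrA ler_pM ?nm_ge0 // ha2.
  apply: le_trans (nm_le_add _ _) _; rewrite [leRHS]mulrDl; apply: lerD.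
    by rewrite nmM -mulrA ler_pM ?nm_ge0 // ha1.
  rewrite nmM nmX nm_real nmM real_normK ?num_real // mulrC ler_wpM2r ?sqr_ge0 //.
  by rewrite ler_pM ?nm_ge0 ?ha2 ?hb2.
- exists K1 => // c s X rot XU; have -> : (F (conj_by (givens c s) X))^* - (F X)^* - s%:C%C * (F' X)^* =
      (F (conj_by (givens c s) X) - F X - s%:C%C * F' X)^*.
    by rewrite !rmorphB rmorphM /= conj_real.
  by rewrite conjE nmJ; apply: h1.
Qed.

Section MeanDerivative.
Context (d : measure_display) (T : measurableType d) (P : probability T R).
Variables (G : set M) (U : T -> M).
Hypotheses (haar : haar_distributed P G U) (mG : borel_set G)
  (GU : G `<=` unitary_group (R := R) (N := N))
  (GM : forall V X, G V -> G X -> G (V *m X)) (GA : forall X, G X -> G (X ^t*))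
  (GO : orthogonal_group (R := R) (N := N) `<=` G).

(* Invariance under a rotation of angle s gives [s * Ex F' = O(s^2)]. *)
Lemma mean_der F F' : der F F' -> Ex P G U F' = 0.
Proof.
move=> dF; have [pF pF'] := der_polf dF; have [K K0 hK] := der_taylor dF.
have G1 : G 1%:M.
  apply: GO; split; last by rewrite mul1mx trmx1.
  by apply/mxOverP => i j; rewrite mxE; case: eqP => _; rewrite ?mulr1n ?mulr0n ?rpred1 ?rpred0.
have small c s : rotation c s -> `|s| * nm (Ex P G U F') <= 2 * (K * s ^+ 2).
  move=> rot; have GV : G (givens c s) by apply: GO; case: rot => cs _ _; apply: givens_orth.
  pose F1 (X : M) := F (conj_by (givens c s) X).
  have pF1 : polf F1 by apply: polf_mulmx.
  have pD : polf (fun X => F1 X + (-1) * F X + (- s%:C%C) * F' X).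
    by do !apply: polf_add; try apply: polf_mul => //; try exact: polf_const.
  have -> : `|s| * nm (Ex P G U F') =
      nm (Ex P G U (fun X => F1 X + (-1) * F X + (- s%:C%C) * F' X)).
    rewrite (Ex_add haar mG GU) ?(Ex_add haar mG GU) ?(Ex_scale haar mG GU) //.
    - rewrite (Ex_conj haar mG GU GM GA G1 pF GV) mulN1r subrr add0r nmM nmN nm_real //.
    - by apply: polf_mul => //; apply: polf_const.
    - by apply: polf_add => //; apply: polf_mul => //; apply: polf_const.
    - by apply: polf_mul => //; apply: polf_const.
  apply: (Ex_bound haar mG GU pD) => X GX.
  by rewrite mulN1r mulNr; apply: hK => //; apply: GU.
apply/eqP; rewrite -nm_eq0; apply/negPn/negP => ne.
have e0 : 0 < nm (Ex P G U F') by rewrite lt_def ne nm_ge0.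
set e := nm _ in e0 small.
(* Small enough for [2 * K * s < e], against the bound [e <= 2 * K * s] left after division by [s].
   The summand 1 covers [K = 0]. *)
pose s := Num.min 1 (e / (2 * K + 1) / 2).
have K1 : 0 < 2 * K + 1 by rewrite ltr_wpDl // mulr_ge0.
have s0 : 0 < s by rewrite lt_min ltr01 !divr_gt0.
have s1 : s <= 1 by rewrite ge_min lexx.
have rot : rotation (Num.sqrt (1 - s ^+ 2)) s.
  split; rewrite ?sqrtr_ge0 ?gtr0_norm //.
  by rewrite sqr_sqrtr ?subrK // subr_ge0 expr_le1 // ltW.
have := small _ _ rot; rewrite gtr0_norm //.
have : s <= e / (2 * K + 1) / 2 by rewrite ge_min lexx orbT.
rewrite ler_pdivlMr // ler_pdivlMr // => h1 h2.
have : e <= 2 * K * s by rewrite -(ler_pM2l s0); move: h2; rewrite expr2; lra.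
have := mulr_ge0 K0 (ltW s0); nra.
Qed.

End MeanDerivative.

End Derivation.

(** * Second moments *)

Section SecondMoments.
Context (R : realType) (N : nat) (d : measure_display) (T : measurableType d).
Variables (P : probability T R) (G : set 'M[cplx R]_N) (U : T -> 'M[cplx R]_N).
Local Notation C := (cplx R).
Local Notation M := 'M[C]_N.
Hypotheses (haar : haar_distributed P G U) (mG : borel_set G)
  (GU : G `<=` unitary_group (R := R) (N := N)).

Let W := g_sigma_algebraType (@open M).
Let E := Ere P G U.
Let Ec := Ex P G U.
Implicit Types (F : M -> C) (f g : M -> R) (S : set M).

Definition sqnm (F : M -> C) X := nm (F X) ^+ 2.

Lemma sqnmE F X : sqnm F X = complex.Re (F X * (F X)^*).
Proof. by rewrite /sqnm conjE mul_conj_nm. Qed.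

Lemma polf_sq F : polf F -> polf (fun X => F X * (F X)^*).
Proof. by move=> pF; apply: polf_mul => //; apply: polf_conj. Qed.

Lemma bfun_sqnm F : polf F -> bfun G (sqnm F).
Proof.
move=> pF; have [b _] := polf_bfun GU (polf_sq pF).
by rewrite (_ : sqnm F = fun X => complex.Re (F X * (F X)^*)) //;
  apply/funext => X; rewrite sqnmE.
Qed.

Lemma Ere_sqnm F : E (sqnm F) = complex.Re (Ec (fun X => F X * (F X)^*)).
Proof. by rewrite /Ec /Ex /=; congr Ere; apply/funext => X; rewrite sqnmE. Qed.

Lemma Ere_dominated f g : bfun G f -> bfun G g -> (forall X, G X -> `|f X| <= g X) ->
  `|E f| <= E g.
Proof.
move=> bf bg fg; rewrite ler_norml -(mulN1r (E g)) -(Ere_scale haar mG _ bg).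
apply/andP; split; apply: (Ere_le haar mG) => //.
- exact: bfun_scale.
- by move=> X /fg; rewrite ler_norml mulN1r => /andP[].
- by move=> X /fg; rewrite ler_norml => /andP[].
Qed.

Lemma bfun_add f g : bfun G f -> bfun G g -> bfun G (fun X => f X + g X).
Proof.
move=> [mf [K fK]] [mg [L gL]]; split; first exact: measurable_funD.
by exists (K + L) => X GX; apply: le_trans (ler_normD _ _) (lerD (fK _ GX) (gL _ GX)).
Qed.

(** This additive form of the Cauchy-Schwarz inequality avoids square roots; the weight [t] is
    chosen at the point of use. The halves of the arithmetic-geometric inequality are spent on
    adding the real and imaginary parts. *)
Lemma Ex_cauchy F F' (t : R) : polf F -> polf F' -> 0 < t ->
  nm (Ec (fun X => F X * F' X)) <= t^-1 * E (sqnm F) + t * E (sqnm F').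
Proof.
move=> pF pF' t0; have pM : polf (fun X => F X * F' X) by apply: polf_mul.
have [b1 b2] := polf_bfun GU pM.
pose g X := (t^-1 / 2) * sqnm F X + (t / 2) * sqnm F' X.
have bg : bfun G g by apply: bfun_add; apply: bfun_scale; apply: bfun_sqnm.
have Eg : E g = (t^-1 / 2) * E (sqnm F) + (t / 2) * E (sqnm F').
  rewrite /g /E (Ere_add haar mG); last 2 first.
  - by apply: bfun_scale; apply: bfun_sqnm.
  - by apply: bfun_scale; apply: bfun_sqnm.
  by rewrite !(Ere_scale haar mG) //; apply: bfun_sqnm.
have gE X : nm (F X * F' X) <= g X.
  rewrite nmM /g /sqnm; set x := nm (F X); set y := nm (F' X).
  have tV : t * t^-1 = 1 by rewrite divff // gt_eqF.
  have : 0 <= t^-1 * (x - t * y) ^+ 2 by rewrite mulr_ge0 ?sqr_ge0 // invr_ge0 ltW.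
  have -> : t^-1 * (x - t * y) ^+ 2 = t^-1 * x ^+ 2 - 2 * (t * t^-1) * x * y + (t * t^-1) * t * y ^+ 2.
    by ring.
  rewrite tV; lra.
have h1 : `|E (fun X => complex.Re (F X * F' X))| <= E g.
  by apply: Ere_dominated => // X _; apply: le_trans (nm_Re _) (gE X).
have h2 : `|E (fun X => complex.Im (F X * F' X))| <= E g.
  by apply: Ere_dominated => // X _; apply: le_trans (nm_Im _) (gE X).
have h3 := le_trans (nm_le_ReIm _) (lerD h1 h2 :
  `|complex.Re (Ec (fun X => F X * F' X))| + `|complex.Im (Ec (fun X => F X * F' X))| <= _).
by apply: le_trans h3 _; rewrite Eg; lra.
Qed.

Definition large (F : M -> C) (e : R) : set M := [set X | e <= nm (F X)].

Lemma borel_large F e : polf F -> 0 < e -> borel_set (large F e).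
Proof.
move=> pF e0; have [[m _] _] := polf_bfun GU (polf_sq pF).
have := m measurableT `[e ^+ 2, +oo[%classic (measurable_itv _).
rewrite setTI borelP; congr measurable; apply/seteqP; split=> X /=;
  rewrite in_itv /= andbT -sqnmE /sqnm /large /= ler_pXn2r ?nnegrE ?nm_ge0 ?(ltW e0) //.
Qed.

(** [E] does not see the part of [S] outside [G], while [P] does; but [U] lies outside [G] with
    probability 0. *)
Lemma Ere_indic S : borel_set S -> E \1_S = fine (P (U @^-1` S)).
Proof.
move=> mS; have [mU PG _] := haar.
have mUS : measurable (U @^-1` S) by apply: mU.
have mUG : measurable (U @^-1` G) by apply: mU.
rewrite /E /Ere /Rintegral.
have -> : (fun w => (\1_S (U w))%:E) = (fun w => (\1_(U @^-1` S) w)%:E : \bar R).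
  by apply/funext => w; rewrite !indicE.
rewrite integral_indic //; congr fine.
apply/eqP; rewrite eq_le; apply/andP; split.
  apply: le_measure; rewrite ?inE //; try exact: measurableI.
have mUGc : measurable (~` (U @^-1` G)) by apply: measurableC.
have PGc : P (~` (U @^-1` G)) = 0%E by rewrite probability_setC // PG subee.
apply: (@le_trans _ _ (P (U @^-1` S `&` U @^-1` G) + P (~` (U @^-1` G)))%E); last first.
  by rewrite PGc adde0.
apply: le_trans (measureU2 _ _ _) => //; last exact: measurableI.
apply: le_measure; rewrite ?inE //; first by apply: measurableU => //; exact: measurableI.
by move=> w Sw; have [Gw|nGw] := pselect (G (U w)); [left|right].
Qed.

Lemma bfun_indic S : borel_set S -> bfun G \1_S.
Proof.
move=> mS; split; first exact: measurable_indic.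
by exists 1 => X _; rewrite indicE; case: (_ \in _); rewrite ?normr1 ?normr0.
Qed.

(** For a bounded function, smallness in probability gives smallness in mean square: the threshold
    [e] is used off the large event and the bound [K] on it. *)
Lemma second_moment_split F (K e : R) : polf F -> 0 < e ->
  (forall X, G X -> nm (F X) <= K) ->
  E (sqnm F) <= e ^+ 2 + K ^+ 2 * fine (P [set w | (e%:C)%C <= `|F (U w)|]).
Proof.
move=> pF e0 FK; have mS := borel_large pF e0.
have -> : [set w | (e%:C)%C <= `|F (U w)|] = U @^-1` (large F e).
  by apply/seteqP; split=> w /=; rewrite nmE lecR.
rewrite -Ere_indic // -[e ^+ 2](Ere_cst haar mG) -(Ere_scale haar mG (K ^+ 2)); last first.
  exact: bfun_indic.
rewrite -(Ere_add haar mG); [|exact: bfun_cst|by apply/bfun_scale/bfun_indic].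
apply: (Ere_le haar mG) => //; first exact: bfun_sqnm.
  by apply: bfun_add; [exact: bfun_cst|by apply/bfun_scale/bfun_indic].
move=> X GX; rewrite /sqnm indicE; case: (boolP (X \in large F e)) => [_|].
  rewrite mulr1; apply: (@le_trans _ _ (K ^+ 2)); last by rewrite lerDr sqr_ge0.
  by rewrite ler_pXn2r ?nnegrE ?nm_ge0 ?FK // (le_trans (nm_ge0 _) (FK _ GX)).
rewrite mulr0 addr0 notin_setE /large /= => /negP; rewrite -ltNge => h.
by rewrite ler_pXn2r ?nnegrE ?nm_ge0 ?(ltW e0) ?(ltW h).
Qed.

Lemma chebyshev_large F (e : R) : polf F -> 0 < e ->
  (P [set w | ((e%:C)%C <= `|F (U w)|)%R] <= ((e ^+ 2)^-1 * E (sqnm F))%:E)%E.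
Proof.
move=> pF e0; have mS := borel_large pF e0.
have -> : [set w | (e%:C)%C <= `|F (U w)|] = U @^-1` (large F e).
  by apply/seteqP; split=> w /=; rewrite nmE lecR.
have fn : P (U @^-1` (large F e)) \is a fin_num by rewrite fin_num_measure //; case: haar => h _ _; apply: h.
rewrite -(fineK fn) lee_fin -Ere_indic // ler_pdivlMl ?exprn_gt0 //.
rewrite -(Ere_scale haar mG); last exact: bfun_indic.
apply: (Ere_le haar mG) => //; first by apply/bfun_scale/bfun_indic.
  exact: bfun_sqnm.
move=> X _; rewrite /sqnm indicE; case: (boolP (X \in large F e)) => [|_].
  by rewrite inE /large /= mulr1 => h; rewrite ler_pXn2r ?nnegrE ?nm_ge0 ?(ltW e0) //.
by rewrite /= mulr0n mulr0 sqr_ge0.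
Qed.

End SecondMoments.

Local Close Scope classical_set_scope.

(** * Maps without matching and their tensors *)

(* Maps on an arbitrary finite set of half-edges, without their matching; the
   root of a vertex is the half-edge at which its cycle is started, and a flag
   tells whether the tensor is to be conjugated. *)
Record gmap (I : Type) (ell : I -> nat) (H : finType) := GMap {
  gpi : {perm H};
  grt : pred H;
  glab : H -> I;
  gflag : H -> bool;
  glab_pi : forall h, glab (gpi h) = glab h;
  gflag_pi : forall h, gflag (gpi h) = gflag h;
  gdeg : forall h, #|porbit gpi h| = ell (glab h);
  grt_ex : forall h, exists r, grt r && (r \in porbit gpi h);
  grt_uniq : forall r r', grt r -> grt r' -> r' \in porbit gpi r -> r = r'
}.

Section Legs.
Variables (I : Type) (ell : I -> nat) (H : finType) (G : gmap ell H).
Local Notation p := (gpi G).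

Definition rt h := xchoose (grt_ex G h).

Lemma rt_root h : grt G (rt h).
Proof. by case/andP: (xchooseP (grt_ex G h)). Qed.

Lemma rt_mem h : rt h \in porbit p h.
Proof. by case/andP: (xchooseP (grt_ex G h)). Qed.

Lemma rt_eq h r : grt G r -> (rt h == r) = (h \in porbit p r).
Proof.
move=> rr; apply/eqP/idP => [<-|hr]; first by rewrite porbit_sym rt_mem.
apply: (@grt_uniq _ _ _ G); rewrite ?rt_root // porbit_sym.
move: hr; rewrite -eq_porbit_mem => /eqP <-; exact: rt_mem.
Qed.

Lemma glab_iter n h : glab G (iter n p h) = glab G h.
Proof. by elim: n => //= n IH; rewrite glab_pi. Qed.

Lemma porbit_iter r h : h \in porbit p r -> exists n, h = iter n p r.
Proof. by case/porbitP => n ->; exists n; rewrite permX. Qed.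

Lemma glab_rt h : glab G (rt h) = glab G h.
Proof. by have [n ->] := porbit_iter (rt_mem h); rewrite glab_iter. Qed.

Lemma rt_iter n r : grt G r -> rt (iter n p r) = r.
Proof. by move=> rr; apply/eqP; rewrite rt_eq // -permX mem_porbit. Qed.

Lemma iter_inj_leg (r : H) s t : (s < ell (glab G r))%N -> (t < ell (glab G r))%N ->
  iter s p r = iter t p r -> s = t.
Proof.
rewrite -!gdeg => sn tn e; apply/eqP.
by rewrite -(nth_uniq r _ _ (uniq_traject_porbit p r)) ?size_traject // !nth_traject // e.
Qed.

(** The position of [h] in its cycle, counted from the root. Root and position determine the
    half-edge, which turns products and sums over half-edges into iterated ones over vertices and
    legs. *)
Definition ix h := index h (traject p (rt h) (ell (glab G h))).

Lemma ix_lt h : (ix h < ell (glab G h))%N.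
Proof.
rewrite /ix -[X in (_ < X)%N](size_traject p (rt h)) index_mem -glab_rt -gdeg.
by rewrite -porbit_traject porbit_sym rt_mem.
Qed.

Lemma iter_ix h : iter (ix h) p (rt h) = h.
Proof.
rewrite -(nth_traject _ (ix_lt h)) nth_index // -glab_rt -gdeg.
by rewrite -porbit_traject porbit_sym rt_mem.
Qed.

Lemma ix_iter r s : grt G r -> (s < ell (glab G r))%N -> ix (iter s p r) = s.
Proof.
move=> rr sn; apply: (@iter_inj_leg r) => //.
  by rewrite -[X in (_ < ell X)%N](glab_iter s) ix_lt.
by rewrite -{2}(rt_iter s rr) iter_ix.
Qed.

Lemma big_legs (S : Type) (idx : S) (op : Monoid.com_law idx) (F : H -> S) :
  \big[op/idx]_l F l =
  \big[op/idx]_(h | grt G h) \big[op/idx]_(s < ell (glab G h)) F (iter s p h).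
Proof.
rewrite (partition_big rt (grt G)) => [|l _] /=; last exact: rt_root.
apply: eq_bigr => r rr; rewrite -gdeg.
rewrite (eq_bigl (fun l => l \in porbit p r)); last by move=> l; apply: rt_eq.
rewrite (eq_bigl (mem (traject p r #|porbit p r|))); last exact: porbit_traject.
rewrite -big_uniq ?uniq_traject_porbit //.
rewrite (big_nth r) size_traject big_mkord; apply: eq_bigr => s _.
by rewrite nth_traject.
Qed.

Section Values.
Variables (R : realType) (N : nat).

Definition gloc (x : forall i, tensor R N (ell i)) (h : H) (i : {ffun H -> 'I_N}) :
    cplx R :=
  let v := x (glab G h) [ffun t : 'I_(ell (glab G h)) => i (iter t p h)] in
  if gflag G h then v^* else v.

Definition gphi (x : forall i, tensor R N (ell i)) (i : {ffun H -> 'I_N}) : cplx R :=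
  \prod_(h | grt G h) gloc x h i.

Lemma upd_leg_same (r : H) (s : 'I_(ell (glab G r))) (i : {ffun H -> 'I_N}) c :
  [ffun t : 'I_(ell (glab G r)) => upd i (iter s p r) c (iter t p r)] =
  upd [ffun t : 'I_(ell (glab G r)) => i (iter t p r)] s c.
Proof.
apply/ffunP => t; rewrite !ffunE; congr (if _ then _ else _).
by apply/eqP/eqP => [/iter_inj_leg/val_inj -> //|->].
Qed.

Lemma gloc_upd_other x (r r' : H) s i c : grt G r -> grt G r' -> r' != r ->
  gloc x r' (upd i (iter s p r) c) = gloc x r' i.
Proof.
move=> gr gr' rr'; rewrite /gloc.
have -> : [ffun t : 'I_(ell (glab G r')) => upd i (iter s p r) c (iter t p r')] =
   [ffun t : 'I_(ell (glab G r')) => i (iter t p r')] => //.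
apply/ffunP => t; rewrite !ffunE; case: eqP => // e.
by case/eqP: rr'; rewrite -(rt_iter t gr') e rt_iter.
Qed.

Lemma lie_term_gphi x a b i (r : H) (s : 'I_(ell (glab G r))) : grt G r ->
  lie_term (gphi x) a b i (iter s p r) =
  lie_term (gloc x r) a b i (iter s p r) * \prod_(h | grt G h && (h != r)) gloc x h i.
Proof.
move=> gr; rewrite /lie_term /gphi.
have E c : \prod_(h | grt G h) gloc x h (upd i (iter s p r) c) =
   gloc x r (upd i (iter s p r) c) * \prod_(h | grt G h && (h != r)) gloc x h i.
  rewrite (bigD1 r) //=; congr (_ * _); apply: eq_bigr => h /andP[gh hr].
  exact: gloc_upd_other.
by rewrite !E mulrBl !mulrnAl.
Qed.

(** The generator is real, hence commutes with the conjugation carried by the flag. *)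
Lemma lie_term_gloc x a b i (r : H) (s : 'I_(ell (glab G r))) :
  lie_term (gloc x r) a b i (iter s p r) =
  let v := lie_term (x (glab G r)) a b [ffun t : 'I_(ell (glab G r)) => i (iter t p r)] s in
  if gflag G r then v^* else v.
Proof.
rewrite /lie_term /gloc !upd_leg_same ffunE; case: ifP => _ //.
by rewrite rmorphB !rmorphMn.
Qed.

End Values.
End Legs.

(** * Orthogonal invariance of contractions *)

Section LieTerms.
Variables (C : comNzRingType) (H : finType) (N q : nat).
Variables (phi : {ffun H -> 'I_N} -> C) (al : {perm H}) (bnd : q.-tuple H).
Implicit Types (j : {ffun 'I_q -> 'I_N}) (i : {ffun H -> 'I_N}).
Hypotheses (alK : involutive al) (bnd_uniq : uniq bnd)
  (bndE : forall h, (h \in bnd) = (al h == h)).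

Definition inv_bnd (j : {ffun 'I_q -> 'I_N}) (i : {ffun H -> 'I_N}) :=
  inv_idx al i && [forall t : 'I_q, i (tnth bnd t) == j t].

Lemma inv_bndP j i : reflect ((forall x, i (al x) = i x) /\
  forall t, i (tnth bnd t) = j t) (inv_bnd j i).
Proof.
apply: (iffP andP) => [[/inv_idxP h1 /'forall_eqP h2]|[h1 h2]]; split=> //.
  exact/inv_idxP.
exact/'forall_eqP.
Qed.

Definition contract_bnd (j : {ffun 'I_q -> 'I_N}) : C := \sum_(i | inv_bnd j i) phi i.

Let al_bnd t : al (tnth bnd t) = tnth bnd t.
Proof. by apply/eqP; rewrite -bndE mem_tnth. Qed.

Let tnth_inj s t : tnth bnd s = tnth bnd t -> s = t.
Proof. by move/tuple_uniqP: bnd_uniq; apply. Qed.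

Lemma contract_bnd_upd j a b s :
  \sum_(i | inv_bnd j i) phi (upd i (tnth bnd s) b) *+ (i (tnth bnd s) == a) =
  contract_bnd (upd j s b) *+ (j s == a).
Proof.
set l := tnth bnd s.
have all : al l = l by apply: al_bnd.
transitivity ((\sum_(i | inv_bnd j i) phi (upd i l b)) *+ (j s == a)).
  rewrite -sumrMnl; apply: eq_bigr => i /inv_bndP[_ ij]; by rewrite ij.
congr (_ *+ _); rewrite /contract_bnd.
rewrite (reindex_onto (fun i => upd i l (j s)) (fun i => upd i l b)) /=; last first.
  by move=> i /inv_bndP[_ /(_ s) <-]; rewrite upd_upd upd_same.
apply: eq_big => [i|i /andP[_ /eqP ->] //].
apply/andP/inv_bndP => [[/inv_bndP[ii ij] /eqP]|[ii ij]].
  rewrite upd_upd => e; have il : i l = b by rewrite -e upd_l.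
  split=> [x|t].
    have := ii x; rewrite !updE.
    have [->|xl] := eqVneq x l; first by rewrite all.
    by case: eqP => [e1|//]; case/eqP: xl; rewrite -(alK x) e1 all.
  rewrite updE; have [->|ts] := eqVneq t s; first by [].
  have := ij t; rewrite updE; case: eqP => // /tnth_inj e1.
  by rewrite e1 eqxx in ts.
have il : i l = b by rewrite ij upd_l.
split; last by rewrite upd_upd -il upd_same.
apply/inv_bndP; split=> [x|t]; rewrite !updE.
  have [->|xl] := eqVneq x l; first by rewrite all eqxx.
  by case: eqP => [e1|_]; [case/eqP: xl; rewrite -(alK x) e1 all | rewrite ii].
case: eqP => [/tnth_inj -> //|ne].
by rewrite ij updE; case: eqP => // e; case: ne; rewrite e.
Qed.

(** In both sums the argument of [phi] has index [b] at [l] and index [a] at [al l], and is matched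
    on all other edges. *)
Lemma contract_bnd_internal j a b l : al l != l ->
  \sum_(i | inv_bnd j i) phi (upd i l b) *+ (i l == a) =
  \sum_(i | inv_bnd j i) phi (upd i (al l) a) *+ (i (al l) == b).
Proof.
move=> all; set m := al l.
have am : al m = l by rewrite /m alK.
have lm : (l == m) = false by rewrite eq_sym (negPf all).
have ml : (m == l) = false by apply: negPf.
have lb t : (tnth bnd t == l) = false.
  by apply/negP => /eqP e; case/eqP: all; rewrite -e al_bnd.
have mb t : (tnth bnd t == m) = false.
  by apply/negP => /eqP e; case/eqP: all; rewrite -/m -am -e al_bnd e.
have inv2 c i : inv_bnd j i -> inv_bnd j (upd (upd i l c) m c).
  move=> /inv_bndP[ii ij]; apply/inv_bndP; split=> [x|t]; rewrite !updE ?lb ?mb //.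
  have [->|xl] := eqVneq x l; first by rewrite -/m eqxx lm.
  have [->|xm] := eqVneq x m; first by rewrite am eqxx lm.
  by rewrite !(can2_eq alK alK) am -/m (negPf xl) (negPf xm) ii.
have mk (P : pred {ffun H -> 'I_N}) F c k :
    \sum_(i | P i) F i *+ (i k == c) = \sum_(i | P i && (i k == c)) F i :> C.
  by rewrite big_mkcondr; apply: eq_bigr => i _; case: eqP.
rewrite !mk.
rewrite (reindex_onto (fun i => upd (upd i l a) m a) (fun i => upd (upd i l b) m b)) /=;
    last first.
  move=> i /andP[/inv_bndP[ii _] /eqP il]; have im : i m = a by rewrite ii il.
  apply/ffunP => x; rewrite !updE.
  have [->|xm] := eqVneq x m; first by [].
  by have [->|xl] := eqVneq x l.
apply: eq_big => [i|i /andP[/andP[_ _] /eqP e]].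
  apply/andP/andP => [[/andP[h1 _] /eqP e]|[h1 /eqP im]].
    have im : i m = b by rewrite -e upd_l.
    have il : i l = b by rewrite -e updE lm upd_l.
    split; last by rewrite im.
    rewrite -e; exact: inv2.
  have /inv_bndP[ii _] := h1; have il : i l = b by rewrite -im /m ii.
  split.
    by rewrite inv2 //= updE lm upd_l.
  apply/eqP/ffunP => x; rewrite !updE.
  have [->|xm] := eqVneq x m; first by [].
  by have [->|xl] := eqVneq x l.
congr phi; apply/ffunP => x; rewrite !updE.
have im : i m = b by rewrite -e upd_l.
have il : i l = b by rewrite -e updE lm upd_l.
have [->|xl] := eqVneq x l; first by rewrite lm.
by [].
Qed.

(** The two ends of an internal edge cancel by antisymmetry of the generator. The boundary legs,
    which are the fixed points of [al], survive. *)
Lemma lie_term_contract_bnd j a b :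
  \sum_(i | inv_bnd j i) \sum_l lie_term phi a b i l =
  \sum_(s < q) lie_term contract_bnd a b j s.
Proof.
rewrite exchange_big /= (bigID (fun l => al l == l)) /=.
rewrite [X in _ + X](_ : _ = 0) ?addr0; last first.
  rewrite /lie_term; under eq_bigr do rewrite sumrB.
  rewrite sumrB (reindex_inj (@perm_inj _ al)) /=; apply/eqP; rewrite subr_eq0.
  apply/eqP; apply: eq_big => [l|l all]; first by rewrite alK eq_sym.
  by apply/esym/contract_bnd_internal; move: all; rewrite alK eq_sym.
rewrite (eq_bigl (mem bnd)); last by move=> l; rewrite /= bndE.
rewrite -big_uniq // big_tuple; apply: eq_bigr => s _.
by rewrite /lie_term sumrB !contract_bnd_upd.
Qed.

End LieTerms.

(** * The Leibniz rule over the vertices of a map *)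

Section Leibniz.
Variables (R : realType) (N : nat) (a b : 'I_N).
Local Notation C := (cplx R).
Local Notation M := 'M[C]_N.

Lemma der_eq F F' G G' : der a b F F' -> F =1 G -> F' =1 G' -> @der R N a b G G'.
Proof. by move=> dF /funext <- /funext <-. Qed.

Lemma der_sum (I : Type) (r : seq I) (Q : pred I) (F F' : I -> M -> C) :
  (forall i, Q i -> der a b (F i) (F' i)) ->
  der a b (fun X => \sum_(i <- r | Q i) F i X) (fun X => \sum_(i <- r | Q i) F' i X).
Proof.
move=> dF; elim: r => [|i r IH].
  by apply: der_eq (der_const a b 0) _ _ => X; rewrite big_nil.
case: (boolP (Q i)) => Qi.
  by apply: der_eq (der_add (dF i Qi) IH) _ _ => X; rewrite big_cons Qi.
by apply: der_eq IH _ _ => X; rewrite big_cons (negPf Qi).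
Qed.

Lemma der_scale c F F' : der a b F F' ->
  @der R N a b (fun X => c * F X) (fun X => c * F' X).
Proof.
by move=> dF; apply: der_eq (der_mul (der_const a b c) dF) _ _ => X //; rewrite mul0r add0r.
Qed.

Lemma der_prod (I : finType) (Q : pred I) (F F' : I -> M -> C) :
  (forall i, Q i -> der a b (F i) (F' i)) ->
  der a b (fun X => \prod_(i | Q i) F i X)
    (fun X => \sum_(i | Q i) F' i X * \prod_(j | Q j && (j != i)) F j X).
Proof.
move=> dF.
suff W (r : seq I) : uniq r -> der a b (fun X => \prod_(i <- r | Q i) F i X)
    (fun X => \sum_(i <- r | Q i) F' i X * \prod_(j <- r | Q j && (j != i)) F j X).
  exact: (W (index_enum I) (index_enum_uniq I)).
elim: r => [_|i r IH /= /andP[ir ur]].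
  by apply: der_eq (der_const a b 1) _ _ => X; rewrite big_nil.
have ne j : j \in r -> j != i by move=> jr; apply: contraNneq ir => <-.
case: (boolP (Q i)) => Qi; last first.
  apply: der_eq (IH ur) _ _ => X; rewrite big_cons (negPf Qi) //.
  by apply: eq_bigr => j Qj; rewrite big_cons (negPf Qi).
apply: der_eq (der_mul (dF i Qi) (IH ur)) _ _ => X; rewrite big_cons Qi //.
congr (_ * _ + _).
  rewrite big_cons eqxx andbF big_seq_cond [RHS]big_seq_cond.
  apply: eq_bigl => j; case: (boolP (j \in r)) => //= jr; by rewrite ne // andbT.
rewrite mulr_sumr big_seq_cond [RHS]big_seq_cond; apply: eq_bigr => j /andP[jr Qj].
by rewrite big_cons Qi /= eq_sym ne // mulrCA.
Qed.

Variables (I : Type) (ell : I -> nat) (col : I -> bool).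
Variable x : M -> forall i : I, tensor R N (ell i).
Arguments x : clear implicits.
Hypothesis dx : forall k (t : {ffun 'I_(ell k) -> 'I_N}),
  der a b (fun X => x X k t)
    (fun X => if col k then \sum_s lie_term (x X k) a b t s else 0).

(** Each half-edge belongs to exactly one vertex, so differentiating vertex by vertex and leg by leg
    runs once over the half-edges of the moving colour. *)
Lemma der_gphi (H : finType) (G : gmap ell H) (i : {ffun H -> 'I_N}) :
  der a b (fun X => gphi G (x X) i)
    (fun X => \sum_(l | col (glab G l)) lie_term (gphi G (x X)) a b i l).
Proof.
pose D h X := if col (glab G h) then
  \sum_(s < ell (glab G h)) lie_term (gloc G (x X) h) a b i (iter s (gpi G) h) else 0.
have dl h : grt G h -> der a b (fun X => gloc G (x X) h i) (D h).
  move=> gh; rewrite /gloc; set t := [ffun t : 'I_(ell (glab G h)) => i (iter t (gpi G) h)].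
  have dt := dx (k := glab G h) t.
  case fh: (gflag G h).
    apply: der_eq (der_conj dt) _ _ => X //; rewrite /D; case: ifP => _; rewrite ?rmorph0 //.
    by rewrite rmorph_sum; apply: eq_bigr => s _; rewrite lie_term_gloc fh.
  apply: der_eq dt _ _ => X //; rewrite /D; case: ifP => _ //.
  by apply: eq_bigr => s _; rewrite lie_term_gloc fh.
apply: der_eq (der_prod dl) _ _ => X //.
rewrite [RHS]big_mkcond [RHS](big_legs G) /=; apply: eq_bigr => h gh.
rewrite /D; case ch: (col (glab G h)).
  rewrite mulr_suml; apply: eq_bigr => s _.
  by rewrite glab_iter ch lie_term_gphi.
by rewrite mul0r big1 // => s _; rewrite glab_iter ch.
Qed.

End Leibniz.

Section VertexRoots.
Variables (m : nat) (M : cmap m).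

Lemma vroot_ex h : exists r, vroot M r && (r \in porbit (vperm M) h).
Proof.
have [r rh rmin] := arg_minnP (fun x : 'I_m => val x) (porbit_id (vperm M) h).
have {}rh : r \in porbit (vperm M) h := rh.
exists r; rewrite rh andbT; apply/'forall_implyP => x xr; apply: rmin.
have e : porbit (vperm M) r = porbit (vperm M) h.
  by apply/eqP; rewrite eq_porbit_mem.
by rewrite e in xr.
Qed.

Lemma vroot_uniq r r' : vroot M r -> vroot M r' -> r' \in porbit (vperm M) r -> r = r'.
Proof.
move=> /'forall_implyP h /'forall_implyP h' rr'; apply/val_inj/eqP.
by rewrite eqn_leq h //= h' // porbit_sym.
Qed.

End VertexRoots.

Section GmapOfImap.
Variables (I : Type) (ell : I -> nat) (q : nat) (f : bool) (Q : imap ell q).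

Definition gmap_of_imap : gmap ell 'I_(halfedges Q) :=
  @GMap I ell _ (vperm Q) (vroot Q) (lab (i := Q)) (fun=> f) (@lab_vperm _ _ _ Q)
    (fun=> erefl) (@lab_deg _ _ _ Q) (vroot_ex Q) (@vroot_uniq _ Q).

Lemma bnd_fixed h : (h \in bnd Q) = (einv Q h == h).
Proof. by rewrite bndE inE. Qed.

Lemma einv_involutive m (M : cmap m) : involutive (einv M).
Proof. by move=> h; apply/eqP; apply: (forallP (einvK M)). Qed.

End GmapOfImap.

Lemma imap_valueE (R : realType) (N : nat) (I : Type) (ell : I -> nat) (q : nat)
    (x : forall i, tensor R N (ell i)) (Q : imap ell q) j : (0 < q)%N ->
  imap_value x Q j = contract_bnd (gphi (gmap_of_imap false Q) x) (einv Q) (bnd Q) j.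
Proof.
by move=> q0; rewrite /imap_value /trace_action eqn0Ngt q0 expr0 invr1 mul1r.
Qed.

Lemma imap_value0E (R : realType) (N : nat) (I : Type) (ell : I -> nat)
    (x : forall i, tensor R N (ell i)) (Q : imap ell 0) :
  scalar_of (imap_value x Q) =
  contract (gphi (gmap_of_imap false Q) x) (einv Q) / N%:R ^+ ncomp Q.
Proof.
rewrite /scalar_of /imap_value /trace_action eqxx mulrC; congr (_ / _).
apply: eq_bigl => i; rewrite andb_idr // => _; apply/forallP => -[].
by [].
Qed.

Section WordDerivation.
Variables (R : realType) (N : nat) (a b : 'I_N).
Local Notation C := (cplx R).
Local Notation M := 'M[C]_N.
Variables (I0 : finType) (ell0 : I0 -> nat) (A0 : forall i : I0, tensor R N (ell0 i)).
Let fam (X : M) (c : bool) (k : two_index I0 c) := @two_families R N I0 ell0 A0 X c k.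
Arguments fam : clear implicits.

(** Conjugation by a real rotation turns the row and the column index by the same matrix, and
    passing to the adjoint only exchanges the two legs. *)
Lemma der_two_families c (k : two_index I0 c) (t : {ffun 'I_(two_order ell0 k) -> 'I_N}) :
  der a b (fun X => fam X c k t)
    (fun X => if c then \sum_s lie_term (fam X c k) a b t s else 0).
Proof.
case: c k t => k t; last exact: der_const.
have u0 c : upd t ord0 c ord0 = c by rewrite upd_l.
have u1 c : upd t ord_max c ord_max = c by rewrite upd_l.
have u2 c : upd t ord0 c ord_max = t ord_max by rewrite updE.
have u3 c : upd t ord_max c ord0 = t ord0 by rewrite updE.
have s2 (F : 'I_2 -> C) : \sum_s F s = F ord0 + F ord_max.
  by rewrite big_ord_recl big_ord1; congr (_ + F _); apply: val_inj.
case: k t u0 u1 u2 u3 => t u0 u1 u2 u3.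
  apply: der_eq (der_entry R a b (t ord0) (t ord_max)) _ _ => X //.
  by rewrite s2 /lie_term /gen_row /fam /= /matrix_tensor u0 u1 u2 u3 u0 u1 u2 u3.
apply: der_eq (der_conj (der_entry R a b (t ord_max) (t ord0))) _ _ => X.
  by rewrite /fam /= /matrix_tensor trmxCE.
rewrite s2 /lie_term /gen_row /fam /= /matrix_tensor !trmxCE u0 u1 u2 u3 u0 u1 u2 u3.
by rewrite rmorphD !rmorphB !rmorphMn addrC.
Qed.

Lemma der_imap_value c q (Q : imap (@two_order I0 ell0 c) q) j : (0 < q)%N ->
  der a b (fun X => imap_value (fam X c) Q j)
    (fun X => if c then \sum_s lie_term (imap_value (fam X c) Q) a b j s else 0).
Proof.
move=> q0; have E X : imap_value (fam X c) Q =
    contract_bnd (gphi (gmap_of_imap false Q) (fam X c)) (einv Q) (bnd Q).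
  by apply/funext => j'; apply: imap_valueE.
apply: (@der_eq _ _ _ _ (fun X => contract_bnd (gphi (gmap_of_imap false Q) (fam X c))
    (einv Q) (bnd Q) j)).
- apply: der_sum => i _.
  exact: (der_gphi (col := fun _ => c) (x := fun X k => fam X c k)
    (@der_two_families c) (gmap_of_imap false Q) i).
- by move=> X; rewrite E.
move=> X /=; rewrite E; case: c Q E => Q E; last by rewrite big1 // => i _; rewrite big_pred0.
rewrite -(lie_term_contract_bnd _ (@einv_involutive _ Q) (bnd_uniq Q) (@bnd_fixed _ _ _ Q)).
by [].
Qed.

(** A combination with free legs transforms like a single tensor, so the loop equation applies to
    maps with vertices [p j] before any expansion. *)
Lemma der_lincomb_value c q (p : lincomb R (@two_order I0 ell0 c) q) j : (0 < q)%N ->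
  der a b (fun X => lincomb_value (fam X c) p j)
    (fun X => if c then \sum_s lie_term (lincomb_value (fam X c) p) a b j s else 0).
Proof.
move=> q0.
apply: der_eq (der_sum p (Q := xpredT)
  (fun t _ => der_scale t.1 (der_imap_value t.2 j q0))) _ _ => X //.
case: c p => p; last by rewrite big1 // => t _; rewrite mulr0.
under eq_bigr do rewrite mulr_sumr.
rewrite exchange_big /=; apply: eq_bigr => s _; rewrite /lie_term /lincomb_value.
by rewrite -!sumrMnl -sumrB; apply: eq_bigr => t _; rewrite mulrBr !mulrnAr.
Qed.

End WordDerivation.

(** * Substitution of maps into vertices *)

Section ContractSplit.
Variables (C : comNzRingType) (H1 H2 H : finType) (N : nat).
Variables (a1 : {perm H1}) (a2 : {perm H2}) (a : {perm H}).
Variables (f1 : H1 -> H) (f2 : H2 -> H).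
Hypotheses (f1I : injective f1) (f2I : injective f2)
  (f12 : forall x y, f1 x != f2 y)
  (fC : forall z, (exists x, z = f1 x) \/ (exists y, z = f2 y))
  (a1E : forall x, a (f1 x) = f1 (a1 x)) (a2E : forall y, a (f2 y) = f2 (a2 y)).

Let g (z : H1 + H2) := match z with inl x => f1 x | inr y => f2 y end.

Let gI : injective g.
Proof.
move=> [x|x] [y|y] //= e; first by rewrite (f1I e).
- by have := f12 x y; rewrite e eqxx.
- by have := f12 y x; rewrite e eqxx.
- by rewrite (f2I e).
Qed.

Lemma split_bij : bijective g.
Proof.
have gs z : exists s, g s == z.
  by case: (fC z) => -[x ->]; [exists (inl x) | exists (inr x)].
exists (fun z => xchoose (gs z)) => z; last exact: (eqP (xchooseP (gs z))).
by apply: gI; apply: (eqP (xchooseP (gs (g z)))).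
Qed.

Lemma big_split_type (S : Type) (idx : S) (op : Monoid.com_law idx) (P : pred H) (F : H -> S) :
  \big[op/idx]_(z | P z) F z =
  op (\big[op/idx]_(x | P (f1 x)) F (f1 x)) (\big[op/idx]_(y | P (f2 y)) F (f2 y)).
Proof. by rewrite (reindex g) ?big_sumType //; apply: onW_bij split_bij. Qed.

Variables (phi : {ffun H -> 'I_N} -> C) (phi1 : {ffun H1 -> 'I_N} -> C)
  (phi2 : {ffun H2 -> 'I_N} -> C).
Hypothesis phiE : forall i, phi i = phi1 [ffun x => i (f1 x)] * phi2 [ffun y => i (f2 y)].

Lemma contract_split : contract phi a = contract phi1 a1 * contract phi2 a2.
Proof.
have [g' gK g'K] := split_bij.
rewrite /contract big_distrlr /= pair_big /=.
pose mk (u : {ffun H1 -> 'I_N} * {ffun H2 -> 'I_N}) : {ffun H -> 'I_N} :=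
  [ffun z => match g' z with inl x => u.1 x | inr y => u.2 y end].
pose km (i : {ffun H -> 'I_N}) := ([ffun x => i (f1 x)], [ffun y => i (f2 y)]).
have mk1 u x : mk u (f1 x) = u.1 x by rewrite ffunE (gK (inl x)).
have mk2 u x : mk u (f2 x) = u.2 x by rewrite ffunE (gK (inr x)).
rewrite (reindex_onto mk km) /=; last first.
  move=> i _; apply/ffunP => z; rewrite -(g'K z).
  by case: (g' z) => t; rewrite /= ?mk1 ?mk2 !ffunE.
have kmK u : km (mk u) = u.
  by case: u => u1 u2; congr pair; apply/ffunP => x; rewrite ffunE ?mk1 ?mk2.
apply: eq_big => [u|u _]; last first.
  by rewrite phiE; congr (phi1 _ * phi2 _); apply/ffunP => x; rewrite ffunE ?mk1 ?mk2.
rewrite kmK eqxx andbT; apply/inv_idxP/andP => [h|[/inv_idxP h1 /inv_idxP h2] z].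
  by split; apply/inv_idxP => x; [rewrite -!mk1 -a1E h | rewrite -!mk2 -a2E h].
by case: (fC z) => -[t ->]; rewrite ?a1E ?a2E ?mk1 ?mk2 ?h1 ?h2.
Qed.

End ContractSplit.

Section DependentDistributivity.
Variables (C : comNzRingType) (V A : finType) (X : V -> finType).

Definition res v (j : {ffun {v : V & X v} -> A}) : {ffun X v -> A} :=
  [ffun x => j (Tagged X x)].

(** The factors are sums over functions with different domains [X v]. Each function is extended to
    the whole sigma type by the default value [a0], so that the usual distributivity, with one
    common type, applies. *)
Lemma prod_sum_ffun (P : forall v, pred {ffun X v -> A}) (F : forall v, {ffun X v -> A} -> C)
    (a0 : A) :
  \prod_v \sum_(j | P v j) F v j =
  \sum_(j : {ffun {v : V & X v} -> A} | [forall v, P v (res v j)])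
     \prod_v F v (res v j).
Proof.
pose S := {ffun {v : V & X v} -> A}.
pose ext v (j : {ffun X v -> A}) : S :=
  [ffun y => if tag y =P v is ReflectT e then j (eq_rect _ X (tagged y) _ e) else a0].
have extE v j x : ext v j (Tagged X x) = j x.
  by rewrite ffunE /=; case: eqP => // e; rewrite (eq_axiomK e).
have ext_out v j y : tag y != v -> ext v j y = a0.
  by move=> ne; rewrite ffunE; case: eqP => // e; rewrite e eqxx in ne.
have resK v j : res v (ext v j) = j.
  by apply/ffunP => x; rewrite ffunE extE.
pose supp v (j : S) := [forall y, (tag y != v) ==> (j y == a0)].
have step v : \sum_(j | P v j) F v j = \sum_(j : S | P v (res v j) && supp v j) F v (res v j).
  rewrite (reindex_onto (ext v) (res v)) /=; last first.
    move=> j /andP[_ /'forall_implyP sj]; apply/ffunP => -[w y].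
    case: (eqVneq w v) => [e|ne]; last by rewrite ext_out //; apply/esym/eqP/sj.
    by case: v / e sj => sj; rewrite extE ffunE.
  apply: eq_big => [j|j _]; last by rewrite resK.
  rewrite resK eqxx andbT [supp _ _](_ : _ = true) ?andbT //.
  by apply/'forall_implyP => y ne; rewrite ext_out.
under eq_bigr do rewrite step.
rewrite bigA_distr_big_dep /=.
pose mk (f : {ffun V -> S}) : S := [ffun y => f (tag y) y].
pose km (j : S) : {ffun V -> S} := [ffun v => ext v (res v j)].
have resmk v f : res v (mk f) = res v (f v).
  by apply/ffunP => x; rewrite !ffunE.
have mkK j : mk (km j) = j.
  apply/ffunP => -[v x]; rewrite ffunE /= [km j _]ffunE.
  by rewrite -[LHS]/(ext v (res v j) (Tagged X x)) extE ffunE.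
rewrite [RHS](reindex_onto mk km) /=; last by move=> j _; exact: mkK.
apply: eq_big => [f|f _]; last by apply: eq_bigr => v _; rewrite resmk.
have inQ v : (f v \in [pred j | P v (res v j) && supp v j]) =
  P v (res v (f v)) && supp v (f v) by rewrite inE.
apply/familyP/andP => [h|[/forallP h /eqP e] v].
  split; first by apply/forallP => v; rewrite resmk; have := h v; rewrite inQ => /andP[].
  apply/eqP/ffunP => v; apply/ffunP => y; rewrite ffunE resmk.
  have := h v; rewrite inQ => /andP[_ /'forall_implyP sv].
  case: y => w y; case: (eqVneq w v) => [e|ne]; last by rewrite ext_out //; apply/esym/eqP/sv.
  by case: v / e sv => _; rewrite (extE w) ffunE.
rewrite inQ -resmk h /=; apply/'forall_implyP => y ne.
by rewrite -e ffunE ext_out.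
Qed.

End DependentDistributivity.

Section EmbedOrbits.
Variables (H H1 : finType) (p : {perm H}) (p1 : {perm H1}) (f : H1 -> H).
Hypotheses (fI : injective f) (pE : forall x, p (f x) = f (p1 x)).

Lemma iter_embed n x : iter n p (f x) = f (iter n p1 x).
Proof. by elim: n => //= n ->. Qed.

Lemma mem_porbit_embed x y : (f y \in porbit p (f x)) = (y \in porbit p1 x).
Proof.
apply/porbitP/porbitP => -[n]; rewrite permX => e; exists n.
  by rewrite permX; apply: fI; rewrite e iter_embed.
by rewrite permX iter_embed e.
Qed.

Lemma porbit_embed x z : z \in porbit p (f x) -> exists y, z = f y.
Proof.
by case/porbitP => n ->; exists (iter n p1 x); rewrite permX iter_embed.
Qed.

Lemma card_porbit_embed x : #|porbit p (f x)| = #|porbit p1 x|.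
Proof.
rewrite -(card_imset _ fI); apply: eq_card => z; apply/idP/imsetP => [zx|[y yx ->]].
  by have [y e] := porbit_embed zx; exists y => //; rewrite -mem_porbit_embed -e.
by rewrite mem_porbit_embed.
Qed.

End EmbedOrbits.

Section Compose.
Variables (R : realType) (I : Type) (ell : I -> nat) (J : Type) (k : J -> nat).
Variable Q : forall j, imap ell (k j).
Hypotheses (Qc : forall j, connected_map (Q j)) (k0 : forall j, (0 < k j)%N).
Variables (H : finType) (G : gmap k H) (al : {perm H}).
Hypothesis alm : matching al.

Let alK : involutive al. Proof. by case/matchingP: alm. Qed.
Let alf x : al x != x. Proof. by case/matchingP: alm => _; apply. Qed.

Let V : finType := {h : H | grt G h}.
Let jv (v : V) := glab G (val v).
Let X (v : V) := 'I_(halfedges (Q (jv v))).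
Local Notation H' := {v : V & X v}.

Let mkv h : V := exist _ (rt G h) (rt_root G h).

Definition compose_pi_fun (y : H') : H' :=
  Tagged X (vperm (Q (jv (tag y))) (tagged y)).

Lemma compose_pi_inj : injective compose_pi_fun.
Proof.
move=> [v x] [w y] /eqP; rewrite -tag_eqE /tag_eq /= => /andP[/eqP e].
by case: w / e y => y; rewrite tagged_asE => /eqP/perm_inj ->.
Qed.

Definition compose_pi : {perm H'} := perm compose_pi_inj.

Lemma compose_piE v x : compose_pi (Tagged X x) = Tagged X (vperm (Q (jv v)) x).
Proof. by rewrite permE. Qed.

Let bleg v (s : 'I_(k (jv v))) : H' := Tagged X (tnth (bnd (Q (jv v))) s).

Let leg (v : V) (s : 'I_(k (jv v))) : H := iter s (gpi G) (val v).

Lemma tagged_inj v (x y : X v) : Tagged X x = Tagged X y -> x = y.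
Proof. by move/eqP; rewrite -tag_eqE /tag_eq /= eqxx tagged_asE => /eqP. Qed.

Let ixo_lt h : (ix G h < k (jv (mkv h)))%N.
Proof. by rewrite /jv /= glab_rt ix_lt. Qed.

(** The leg of [G] at position s of a vertex is identified with the s-th boundary edge of the map
    substituted there. *)
Definition bmap h : H' := bleg (Ordinal (ixo_lt h)).

Let bmap_leg v s : bmap (@leg v s) = bleg s.
Proof.
have e : mkv (leg s) = v by apply: val_inj; rewrite /= rt_iter // (valP v).
have : val (Ordinal (ixo_lt (leg s))) = val s.
  by rewrite /= /leg ix_iter ?(valP v) // ltn_ord.
rewrite /bmap; move: (Ordinal _) => s'; move: (mkv _) e s' => w e.
by case: v / e s => s s' /val_inj ->.
Qed.

Let leg_ix h : leg (Ordinal (ixo_lt h)) = h.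
Proof. exact: iter_ix. Qed.

Let legP h : exists v s, h = @leg v s.
Proof. by exists (mkv h), (Ordinal (ixo_lt h)); rewrite leg_ix. Qed.

Let bmap_inj : injective bmap.
Proof.
move=> h h'; have [v [s ->]] := legP h; have [w [t ->]] := legP h'.
rewrite !bmap_leg /bleg => /eqP; rewrite -tag_eqE /tag_eq /= => /andP[/eqP e].
case: w / e t => t; rewrite tagged_asE => /eqP.
by have /tuple_uniqP := bnd_uniq (Q (jv v)); move=> inj /inj ->.
Qed.

Let codom_bmap v (x : X v) : (Tagged X x \in codom bmap) = (x \in bnd (Q (jv v))).
Proof.
apply/codomP/tnthP => [[h]|[s xs]].
  have [w [s ->]] := legP h; rewrite bmap_leg => /eqP.
  rewrite -tag_eqE /tag_eq /= => /andP[/eqP e].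
  by case: w / e s => s; rewrite tagged_asE => /eqP ->; exists s.
by exists (leg s); rewrite bmap_leg xs.
Qed.

(** Boundary half-edges are joined as [al] joins the legs of [G]; all others keep the edges of the
    substituted map. *)
Definition compose_al_fun (y : H') : H' :=
  if [pick h | bmap h == y] is Some h then bmap (al h)
  else Tagged X (einv (Q (jv (tag y))) (tagged y)).

Let alfb h : compose_al_fun (bmap h) = bmap (al h).
Proof.
by rewrite /compose_al_fun; case: pickP => [h' /eqP/bmap_inj ->//|/(_ h)]; rewrite eqxx.
Qed.

Let alfn v (x : X v) : x \notin bnd (Q (jv v)) ->
  compose_al_fun (Tagged X x) = Tagged X (einv (Q (jv v)) x).
Proof.
move=> xb; rewrite /compose_al_fun; case: pickP => [h /eqP e|//].
by move: xb; rewrite -codom_bmap -e codom_f.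
Qed.

Let compose_alK : involutive compose_al_fun.
Proof.
move=> [v x]; case: (boolP (x \in bnd (Q (jv v)))) => xb.
  have := xb; rewrite -codom_bmap => /codomP[h e].
  by rewrite -[existT _ _ _]/(Tagged X x) e !alfb alK.
rewrite -[existT _ _ _]/(Tagged X x) (alfn xb) alfn ?einv_involutive //.
by rewrite bnd_fixed einv_involutive eq_sym -bnd_fixed.
Qed.

Definition compose_al : {perm H'} := perm (inv_inj compose_alK).

Let calb h : compose_al (bmap h) = bmap (al h). Proof. by rewrite permE alfb. Qed.

Let caln v (x : X v) : x \notin bnd (Q (jv v)) ->
  compose_al (Tagged X x) = Tagged X (einv (Q (jv v)) x).
Proof. by move=> xb; rewrite permE alfn. Qed.

Lemma compose_matching : matching compose_al.
Proof.
apply/matchingP; split=> [y|[v x]]; first by rewrite !permE compose_alK.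
case: (boolP (x \in bnd (Q (jv v)))) => xb.
  have := xb; rewrite -codom_bmap => /codomP[h e].
  by rewrite -[existT _ _ _]/(Tagged X x) e calb (inj_eq bmap_inj) alf.
rewrite -[existT _ _ _]/(Tagged X x) (caln xb).
by apply: contraNneq xb => /tagged_inj e; rewrite bnd_fixed e.
Qed.

Definition compose_lab (y : H') : I := lab (i := Q (jv (tag y))) (tagged y).

Let pi_embed v x : compose_pi (Tagged X x) = Tagged X (vperm (Q (jv v)) x).
Proof. exact: compose_piE. Qed.

Lemma compose_lab_pi y : compose_lab (compose_pi y) = compose_lab y.
Proof. by case: y => v x; rewrite permE /compose_lab /= lab_vperm. Qed.

Lemma compose_flag_pi (y : H') :
  gflag G (val (tag (compose_pi y))) = gflag G (val (tag y)).
Proof. by rewrite permE. Qed.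

Lemma compose_deg y : #|porbit compose_pi y| = ell (compose_lab y).
Proof.
case: y => v x; rewrite -[existT _ _ _]/(Tagged X x).
by rewrite (card_porbit_embed (@tagged_inj v) (@pi_embed v)) lab_deg.
Qed.

Let crt (y : H') := vroot (Q (jv (tag y))) (tagged y).

Lemma compose_rt_ex y : exists r, crt r && (r \in porbit compose_pi y).
Proof.
case: y => v x; have [r /andP[rr rx]] := vroot_ex (Q (jv v)) x.
by exists (Tagged X r); rewrite /crt /= rr (mem_porbit_embed (@tagged_inj v) (@pi_embed v)).
Qed.

Lemma compose_rt_uniq r r' : crt r -> crt r' -> r' \in porbit compose_pi r -> r = r'.
Proof.
case: r r' => [v x] [w y] hx hy hp.
have [z e] := porbit_embed (@pi_embed v) hp.
move: (congr1 tag e) => /= wv {z e}; case: v / wv x hx hp => x hx hp.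
move: hp; rewrite (mem_porbit_embed (@tagged_inj w) (@pi_embed w) x y) => hp.
by congr existT; apply: vroot_uniq hp.
Qed.

Definition compose_gmap : gmap ell H' :=
  GMap compose_lab_pi compose_flag_pi compose_deg compose_rt_ex compose_rt_uniq.

(** Each [Q j] is connected, hence stays within one component, and it has a leg because [k j] is
    positive; so the components of the two maps correspond. *)
Lemma compose_gncomp : gncomp compose_pi compose_al = gncomp (gpi G) al.
Proof.
have fib v (x y : X v) : gcomp compose_pi compose_al (Tagged X x) =
    gcomp compose_pi compose_al (Tagged X y).
  have FI : invariant_fun (vperm (Q (jv v))) (einv (Q (jv v)))
      (fun x : X v => gcomp compose_pi compose_al (Tagged X x)).
    split=> z; first by rewrite -compose_piE gcomp_p.
    case: (boolP (z \in bnd (Q (jv v)))) => zb; last by rewrite -(caln zb) gcomp_a.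
    by congr gcomp; congr Tagged; apply/eqP; rewrite -bnd_fixed.
  apply: (invariant_connect FI).
  have /cards1P[K KE] := Qc (jv v).
  have mem z : gcomp (vperm (Q (jv v))) (einv (Q (jv v))) z = K.
    by apply/set1P; rewrite -KE imset_f.
  by rewrite gcomp_memE !mem.
have gval h : gcomp (gpi G) al (rt G h) = gcomp (gpi G) al h.
  by have [n ->] := porbit_iter (rt_mem G h); elim: n => //= n IH; rewrite gcomp_p.
have tagb h : val (tag (bmap h)) = rt G h by [].
apply/eqP; rewrite eqn_leq; apply/andP; split.
  have FI : invariant_fun (gpi G) al (fun h => gcomp compose_pi compose_al (bmap h)).
    split=> h; last by rewrite -calb gcomp_a.
    have [v [s ->]] := legP h.
    have [w [t e]] := legP (gpi G (leg s)).
    have vw : w = v.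
      apply/val_inj; rewrite -(rt_iter t (valP w)) -[iter t _ _]/(leg t) -e.
      by rewrite -[gpi G _]/(iter s.+1 (gpi G) (val v)) rt_iter // (valP v).
    by rewrite e !bmap_leg /bleg; case: v / vw s e => s e; apply: fib.
  apply: leq_trans (card_invariant FI); apply: subset_leq_card.
  apply/fintype.subsetP => _ /imsetP[[v x] _ ->]; apply/imsetP.
  exists (leg (Ordinal (k0 (jv v)))) => //.
  by rewrite bmap_leg; apply: fib.
have FI : invariant_fun compose_pi compose_al (fun y => gcomp (gpi G) al (val (tag y))).
  split=> y; first by rewrite permE.
  case: y => v x; rewrite -[existT _ _ _]/(Tagged X x).
  case: (boolP (x \in bnd (Q (jv v)))) => xb; last by rewrite (caln xb).
  have := xb; rewrite -codom_bmap => /codomP[h ->].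
  by rewrite calb !tagb !gval gcomp_a.
apply: leq_trans (card_invariant FI); apply: subset_leq_card.
apply/fintype.subsetP => _ /imsetP[h _ ->]; apply/imsetP; exists (bmap h) => //.
by rewrite tagb gval.
Qed.

Section ComposeValue.
Variables (N : nat) (N0 : (0 < N)%N) (x : forall i, tensor R N (ell i)).

Lemma gphi_flag q f (M : imap ell q) j :
  gphi (gmap_of_imap f M) x j =
  if f then (gphi (gmap_of_imap false M) x j)^* else gphi (gmap_of_imap false M) x j.
Proof. by case: f => //; rewrite /gphi rmorph_prod. Qed.

Let y j : tensor R N (k j) := imap_value x (Q j).

Let P v (i : {ffun H -> 'I_N}) := inv_bnd (einv (Q (jv v))) (bnd (Q (jv v)))
  [ffun s => i (@leg v s)].

Lemma gloc_compose v i : gloc G y (val v) i =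
  \sum_(j : {ffun X v -> 'I_N} | @P v i j)
     gphi (gmap_of_imap (gflag G (val v)) (Q (jv v))) x j.
Proof.
rewrite /gloc /y imap_valueE //.
under [RHS]eq_bigr do rewrite gphi_flag.
by case: ifP => _ //; rewrite rmorph_sum.
Qed.

Lemma gphi_compose (j : {ffun H' -> 'I_N}) : gphi compose_gmap x j =
  \prod_v gphi (gmap_of_imap (gflag G (val v)) (Q (jv v))) x (res v j).
Proof.
rewrite /gphi (sig_big_dep xpredT (fun v => vroot (Q (jv v)))
  (fun v u => gloc (gmap_of_imap (gflag G (val v)) (Q (jv v))) x u (res v j))) /=.
apply: eq_bigr => -[v u] _; rewrite /gloc /=.
set t1 := [ffun _ => _]; set t2 := [ffun _ => _]; suff -> : t1 = t2 by [].
apply/ffunP => t; rewrite !ffunE; congr (j _).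
by rewrite -[existT _ _ _]/(Tagged X u) (iter_embed (@pi_embed v)).
Qed.

Theorem compose_contract :
  contract (gphi G y) al = contract (gphi compose_gmap x) compose_al.
Proof.
have E i : gphi G y i = \sum_(j : {ffun H' -> 'I_N} | [forall v, @P v i (res v j)])
    gphi compose_gmap x j.
  rewrite /gphi (reindex_omap (val : V -> H) insub) /=; last first.
    by move=> h gh; rewrite insubT.
  rewrite (eq_bigl xpredT) => [|v]; last by rewrite valK eqxx (valP v).
  rewrite (eq_bigr _ (fun v _ => gloc_compose v i)).
  rewrite (prod_sum_ffun (fun v => @P v i)
    (fun v j => gphi (gmap_of_imap (gflag G (val v)) (Q (jv v))) x j) (Ordinal N0)).
  by apply: eq_bigr => j _; rewrite -gphi_compose.
pose bi (j : {ffun H' -> 'I_N}) : {ffun H -> 'I_N} := [ffun h => j (bmap h)].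
pose inner (j : {ffun H' -> 'I_N}) :=
  [forall v, inv_idx (einv (Q (jv v))) (res v j)].
(* The boundary indices of [j] determine [i], so the sum over [i] collapses to the single term
   [bi j]. *)
have PE i j : [forall v, @P v i (res v j)] = inner j && (i == bi j).
  apply/forallP/andP => [h|[/forallP h /eqP ->] v].
    split; first by apply/forallP => v; case/andP: (h v).
    apply/eqP/ffunP => l; have [v [s ->]] := legP l.
    by have /inv_bndP[_ /(_ s)] := h v; rewrite !ffunE bmap_leg => <-.
  apply/inv_bndP; split; first exact/inv_idxP.
  by move=> s; rewrite !ffunE bmap_leg.
rewrite /contract; under eq_bigr do rewrite E.
rewrite (exchange_big_dep inner) /=; last by move=> i j _; rewrite PE => /andP[].
have bal (j : {ffun H' -> 'I_N}) : inv_idx compose_al j = inner j && inv_idx al (bi j).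
  apply/inv_idxP/andP => [h|[/forallP h1 /inv_idxP h2] [v z]].
    split; last by apply/inv_idxP => l; rewrite !ffunE -calb h.
    apply/forallP => v; apply/inv_idxP => z; rewrite !ffunE.
    case: (boolP (z \in bnd (Q (jv v)))) => zb; last by rewrite -(caln zb) h.
    by congr (j _); congr Tagged; apply/eqP; rewrite -bnd_fixed.
  rewrite -[existT _ _ _]/(Tagged X z).
  case: (boolP (z \in bnd (Q (jv v)))) => zb.
    have := zb; rewrite -codom_bmap => /codomP[l ->].
    by have := h2 l; rewrite calb !ffunE.
  by rewrite (caln zb); have /inv_idxP/(_ z) := h1 v; rewrite !ffunE.
rewrite [RHS](eq_bigl _ _ bal) big_mkcondr; apply: eq_bigr => j inj.
under eq_bigl => i do rewrite PE inj /= andbC.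
case: ifP => h.
  rewrite (big_pred1 (bi j)) // => i /=.
  by case: eqP => [->|//]; rewrite h.
by rewrite big_pred0 // => i; case: eqP => [->|//]; rewrite h.
Qed.

End ComposeValue.

End Compose.

(** * Expansion of linear combinations at the vertices *)

Section Expansion.
Variables (R : realType) (I : Type) (ell : I -> nat) (J : finType) (k : J -> nat).
Local Notation C := (cplx R).
Variable p : forall j, lincomb R ell (k j).
Variables (H : finType) (G : gmap k H).

Definition term_index : finType := {j : J & 'I_(size (p j))}.
Local Notation J' := term_index.
Definition term_order (j : J') := k (tag j).
Definition term_coef (j : J') : C := (tnth (in_tuple (p (tag j))) (tagged j)).1.
Definition term_imap (j : J') : imap ell (term_order j) :=
  (tnth (in_tuple (p (tag j))) (tagged j)).2.

Let V : finType := {h : H | grt G h}.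
Let mkv h : V := exist _ (rt G h) (rt_root G h).

Let mkv_pi h : mkv (gpi G h) = mkv h.
Proof.
apply: val_inj; rewrite /= -{1}(iter_ix G h).
by rewrite -[gpi G _]/(iter (ix G h).+1 (gpi G) (rt G h)) rt_iter // rt_root.
Qed.

Let mkv_val (v : V) : mkv (val v) = v.
Proof. by apply: val_inj => /=; have := rt_iter (G := G) 0 (valP v). Qed.

Section Choice.
Variables (f : {ffun V -> J'}) (fP : forall v, tag (f v) = glab G (val v)).

(** Passing through the root makes the chosen term constant along each vertex. *)
Definition choice_lab h := f (mkv h).

Lemma choice_lab_pi h : choice_lab (gpi G h) = choice_lab h.
Proof. by rewrite /choice_lab mkv_pi. Qed.

Lemma choice_deg h : #|porbit (gpi G) h| = term_order (choice_lab h).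
Proof. by rewrite /term_order /choice_lab fP /= glab_rt gdeg. Qed.

Definition choice_gmap : gmap term_order H :=
  GMap choice_lab_pi (gflag_pi G) choice_deg (grt_ex G) (@grt_uniq _ _ _ G).

End Choice.

Section Sum.
Variables (N : nat) (x : forall i, tensor R N (ell i)).

Let y j : tensor R N (k j) := lincomb_value x (p j).
Let y' (j : J') : tensor R N (term_order j) := imap_value x (term_imap j).
Arguments y : clear implicits.
Arguments y' : clear implicits.
Let cj (b : bool) (z : C) := if b then z^* else z.

Let leg_val (j : J') h (i : {ffun H -> 'I_N}) :=
  cj (gflag G h) (y' j [ffun t : 'I_(term_order j) => i (iter t (gpi G) h)]).

Lemma gloc_lincomb h i : gloc G y h i =
  \sum_(j : J' | tag j == glab G h) cj (gflag G h) (term_coef j) * leg_val j h i.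
Proof.
have E : y (glab G h) [ffun t : 'I_(k (glab G h)) => i (iter t (gpi G) h)] =
   \sum_(j : J' | tag j == glab G h) term_coef j *
      y' j [ffun t : 'I_(term_order j) => i (iter t (gpi G) h)].
  transitivity (\sum_(j | j == glab G h) \sum_(t < size (p j))
     (tnth (in_tuple (p j)) t).1 * imap_value x (tnth (in_tuple (p j)) t).2
        [ffun t : 'I_(k j) => i (iter t (gpi G) h)]).
    by rewrite big_pred1_eq /y /lincomb_value big_tnth.
  rewrite (sig_big_dep (fun j => j == glab G h) (fun _ => xpredT)
    (fun j t => (tnth (in_tuple (p j)) t).1 * imap_value x (tnth (in_tuple (p j)) t).2
        [ffun t : 'I_(k j) => i (iter t (gpi G) h)])) /=.
  by apply: eq_bigl => j; rewrite andbT.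
rewrite /gloc E /leg_val /cj; case: ifP => _ //.
by rewrite rmorph_sum; apply: eq_bigr => j _; rewrite rmorphM.
Qed.

Lemma gphi_choice (f : {ffun V -> J'}) (fP : forall v : V, tag (f v) = glab G (val v)) i :
  gphi (choice_gmap fP) y' i = \prod_v leg_val (f v) (val v) i.
Proof.
rewrite /gphi (reindex_omap (val : V -> H) insub) /=; last first.
  by move=> h gh; rewrite insubT.
rewrite (eq_bigl xpredT) => [|v]; last by rewrite valK eqxx (valP v).
by apply: eq_bigr => v _; rewrite /gloc /leg_val /= /choice_lab mkv_val.
Qed.

Lemma gphi_lincomb i : gphi G y i =
  \sum_(f : {ffun V -> J'} | [forall v, tag (f v) == glab G (val v)])
    (\prod_v cj (gflag G (val v)) (term_coef (f v))) * \prod_v leg_val (f v) (val v) i.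
Proof.
rewrite /gphi (reindex_omap (val : V -> H) insub) /=; last first.
  by move=> h gh; rewrite insubT.
rewrite (eq_bigl xpredT) => [|v]; last by rewrite valK eqxx (valP v).
under eq_bigr do rewrite gloc_lincomb.
rewrite bigA_distr_big_dep; apply: eq_big => [f|f _]; last by rewrite big_split.
by apply/familyP/forallP.
Qed.

End Sum.

Lemma contract_lincomb N (x : forall i, tensor R N (ell i)) (al : {perm H}) :
  contract (gphi G (fun j => lincomb_value x (p j))) al =
  \sum_(f : {ffun V -> J'} | [forall v, tag (f v) == glab G (val v)])
    (\prod_v (if gflag G (val v) then (term_coef (f v))^* else term_coef (f v))) *
    \sum_(i | inv_idx al i) \prod_v (let z := imap_value x (term_imap (f v))
        [ffun t : 'I_(term_order (f v)) => i (iter t (gpi G) (val v))] in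
        if gflag G (val v) then z^* else z).
Proof.
rewrite /contract; under eq_bigr do rewrite gphi_lincomb.
by rewrite exchange_big; apply: eq_bigr => f _; rewrite mulr_sumr.
Qed.

(** The constant depends on the map alone and serves for all N and all families allowed by [cond].
    Flags are arbitrary, since second moments involve conjugated vertices. *)
Definition fine_bounded (cond : forall N, (forall i, tensor R N (ell i)) -> Prop) :=
  forall (H1 : finType) (G1 : gmap ell H1) (al : {perm H1}), matching al ->
  exists K : R, forall N (x : forall i, tensor R N (ell i)), (0 < N)%N -> cond N x ->
    nm (contract (gphi G1 x) al / N%:R ^+ gncomp (gpi G1) al) <= K.

(* Expanding the linear combinations and substituting the connected maps p j
   into the vertices of G keeps the number of components. *)
Lemma coarse_bounded cond (al : {perm H}) : fine_bounded cond ->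
  (forall j, (0 < k j)%N) ->
  (forall j, all (fun t => connected_map (imap_map t.2)) (p j)) ->
  matching al ->
  exists K : R, forall N (x : forall i, tensor R N (ell i)), (0 < N)%N -> cond N x ->
    nm (contract (gphi G (fun j => lincomb_value x (p j))) al /
        N%:R ^+ gncomp (gpi G) al) <= K.
Proof.
move=> fine k0 pc ma.
have tc j : connected_map (term_imap j).
  by have /all_tnthP := pc (tag j) : all _ (in_tuple (p (tag j))); apply.
have tk j : (0 < term_order j)%N by apply: k0.
(* The bound is conditional on [f] being compatible with the labels, so that a constant can be
   chosen for every [f]. *)
have bf (f : {ffun V -> J'}) : exists K : R, [forall v, tag (f v) == glab G (val v)] ->
   forall N (x : forall i, tensor R N (ell i)), (0 < N)%N -> cond N x ->
    nm ((\sum_(i | inv_idx al i) \prod_v (let z := imap_value x (term_imap (f v))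
        [ffun t : 'I_(term_order (f v)) => i (iter t (gpi G) (val v))] in
        if gflag G (val v) then z^* else z)) / N%:R ^+ gncomp (gpi G) al) <= K.
  have [/'forall_eqP fP|_] := boolP [forall v, tag (f v) == glab G (val v)]; last by exists 0.
  have [K hK] := fine _ (compose_gmap term_imap (choice_gmap fP)) _
     (compose_matching term_imap (choice_gmap fP) ma).
  exists K => _ N x N0 cx; have := hK _ _ N0 cx.
  rewrite (compose_gncomp tc tk (choice_gmap fP) ma).
  rewrite -(compose_contract term_imap tk (choice_gmap fP) ma N0 x).
  rewrite (_ : contract _ _ = \sum_(i | inv_idx al i)
    \prod_v (let z := imap_value x (term_imap (f v))
        [ffun t : 'I_(term_order (f v)) => i (iter t (gpi G) (val v))] in
        if gflag G (val v) then z^* else z)) //.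
  by apply: eq_bigr => i _; exact: gphi_choice.
have [K hK] := choice bf.
exists (\sum_(f : {ffun V -> J'}) nm (\prod_v (if gflag G (val v) then (term_coef (f v))^* else term_coef (f v))) * `|K f|).
move=> N x N0 cx; rewrite contract_lincomb mulr_suml.
apply: le_trans (nm_sum _ _ _) _; rewrite [leRHS](bigID (fun f : {ffun V -> J'} =>
  [forall v, tag (f v) == glab G (val v)])) /=.
rewrite -[leLHS]addr0; apply: lerD; last by apply: sumr_ge0 => f _; rewrite mulr_ge0 ?nm_ge0.
apply: ler_sum => f fP; rewrite -mulrA nmM ler_wpM2l ?nm_ge0 //.
by apply: le_trans (hK f fP N x N0 cx) (ler_norm _).
Qed.

End Expansion.

(** * Networks of unitary matrices *)

Lemma sum_upd (C : comNzRingType) (E : finType) (N : nat) (e : E)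
    (F : {ffun E -> 'I_N} -> C) :
  \sum_i \sum_v F (upd i e v) = N%:R * \sum_i F i.
Proof.
rewrite -[N in N%:R]card_ord mulr_natl -sumr_const exchange_big /=.
rewrite !pair_big /=.
pose g (u : 'I_N * {ffun E -> 'I_N}) := (u.2 e, upd u.2 e u.1).
have gK : involutive g by case=> v i; rewrite /g /= upd_l upd_upd upd_same.
rewrite [RHS](reindex_inj (inv_inj gK)) /=.
by [].
Qed.

Section MatrixNetworks.
Variables (R : realType) (E : finType) (N : nat).
Hypothesis N0 : (0 < N)%N.
Local Notation C := (cplx R).
Local Notation node := (E * E * 'M[C]_N)%type.
Implicit Types (s : seq node) (q : node).

Definition net_factor (i : {ffun E -> 'I_N}) q := q.2 (i q.1.1) (i q.1.2).
Definition network s := \sum_(i : {ffun E -> 'I_N}) \prod_(q <- s) net_factor i q.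
Definition incidence e q : nat := ((q.1.1 == e) + (q.1.2 == e))%N.
Definition occurrences e s : nat := (\sum_(q <- s) incidence e q)%N.

(* [c] bounds the number of connected components of the graph on [E] whose
   edges are the pairs of indices of the nodes of [s]. *)
Definition components_le s (c : nat) := forall (X : finType) (f : E -> X),
  (forall q, List.In q s -> f q.1.1 = f q.1.2) -> (#|[set f e | e : E]| <= c)%N.

Definition unitary_nodes s := forall q, List.In q s -> q.2 \is unitarymx.

Lemma unit_entry (X : 'M[C]_N) i j : X \is unitarymx -> nm (X i j) <= 1.
Proof. exact: unitary_entry. Qed.

(** The index [e] is summed out but not removed from [E]; it becomes free, which is the origin of
    the factor N. *)
Lemma network_indep (e : E) s (F : {ffun E -> 'I_N} -> C) :
  (forall i v, \prod_(q <- s) net_factor (upd i e v) q = \prod_(q <- s) net_factor i q) ->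
  N%:R * \sum_i (F i * \prod_(q <- s) net_factor i q) =
  \sum_i (\sum_v F (upd i e v)) * \prod_(q <- s) net_factor i q.
Proof.
move=> h; rewrite -(sum_upd e); apply: eq_bigr => i _; rewrite mulr_suml.
by apply: eq_bigr => v _; rewrite h.
Qed.

Lemma not_incident e s : occurrences e s = 0%N ->
  forall q, List.In q s -> q.1.1 != e /\ q.1.2 != e.
Proof.
elim: s => //= q s IH; rewrite /occurrences big_cons => /eqP.
rewrite addn_eq0 => /andP[/eqP h1 /eqP h2] q' [<-|]; last exact: IH.
by move: h1; rewrite /incidence; case: eqP; case: eqP.
Qed.

Lemma net_factor_upd e s i v : occurrences e s = 0%N ->
  \prod_(q <- s) net_factor (upd i e v) q = \prod_(q <- s) net_factor i q.
Proof.
elim: s => [|q s IH]; first by rewrite !big_nil.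
move=> h; have := not_incident h; rewrite !big_cons => ne.
rewrite IH; last by move: h; rewrite /occurrences big_cons; lia.
congr (_ * _); have [|n1 n2] := ne q; first by left.
by rewrite /net_factor !updE (negPf n1) (negPf n2).
Qed.

Lemma occurrencesP e s : (0 < occurrences e s)%N ->
  exists s1 q s2, s = s1 ++ q :: s2 /\ (q.1.1 == e) || (q.1.2 == e).
Proof.
elim: s => [|q s IH]; first by rewrite /occurrences big_nil.
have [h|h] := boolP ((q.1.1 == e) || (q.1.2 == e)).
  by exists [::], q, s.
rewrite /occurrences big_cons /incidence; move: h; rewrite negb_or => /andP[/negPf -> /negPf ->].
by move=> /IH [s1 [q' [s2 [-> h]]]]; exists (q :: s1), q', s2.
Qed.

(** Such a network is a union of cycles of unitary matrices and isolated indices. A loop is a trace,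
    of modulus at most N. Otherwise two neighbours are replaced by their product, again unitary; the
    index between them stays behind as an isolated component, which pays for the factor N. *)
Lemma network_bound s c : unitary_nodes s ->
  (forall e, occurrences e s = 0%N \/ occurrences e s = 2%N) ->
  components_le s c -> nm (network s) <= N%:R ^+ c.
Proof.
have NR : (0 < N%:R :> R) by rewrite ltr0n.
have N1 : (1 <= N%:R :> R) by rewrite ler1n.
have NC : N%:R != 0 :> C by rewrite pnatr_eq0 -lt0n.
have [n] := ubnP (size s); elim: n s c => // n IH [|[[e e'] X] s] c sn uni occ comp.
  rewrite /network; under eq_bigr do rewrite big_nil.
  rewrite sumr_const card_ffun card_ord nm_nat natrX ler_weXn2l //.
  by have := comp E id (fun _ h => match h with end); rewrite card_imset.
have unis : unitary_nodes s by move=> q qs; apply: uni; right.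
have unX : X \is unitarymx by apply: (uni (e, e', X)); left.
have occE z : occurrences z ((e, e', X) :: s) = ((e == z) + (e' == z) + occurrences z s)%N.
  by rewrite /occurrences big_cons.
case: (eqVneq e e') => [ee|ne].
  subst e'; have oe : occurrences e s = 0%N.
    by have := occ e; rewrite occE eqxx; lia.
  have E1 : N%:R * network ((e, e, X) :: s) = (\sum_v X v v) * network s.
    rewrite /network; under eq_bigr do rewrite big_cons.
    rewrite (@network_indep e) => [|i v]; last exact: net_factor_upd.
    rewrite mulr_sumr; apply: eq_bigr => i _; congr (_ * _); apply: eq_bigr => v _.
    by rewrite /net_factor /= upd_l.
  have trX : nm (\sum_v X v v) <= N%:R.
    apply: le_trans (nm_sum _ _ _) _; rewrite -[leRHS]mulr1 -[N in N%:R]card_ord mulr_natl -sumr_const.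
    by apply: ler_sum => v _; apply: unit_entry.
  rewrite -(ler_pM2l NR) -[N%:R in leLHS](nm_nat R) -nmM E1 nmM ler_pM ?nm_ge0 //.
  apply: IH => //.
    move=> z; case: (eqVneq z e) => [->|ze]; first by left.
    by have := occ z; rewrite occE eq_sym (negPf ze).
  by move=> Y f fs; apply: comp => q [<-//|]; apply: fs.
have oe : occurrences e' s = 1%N.
  by have := occ e'; rewrite occE eqxx (negPf ne); lia.
have [|s1 [[[u w] Y] [s2 [sE /= uw]]]] := @occurrencesP e' s; first by rewrite oe.
have occs z : occurrences z s = ((u == z) + (w == z) + occurrences z (s1 ++ s2))%N.
  by rewrite sE /occurrences !big_cat big_cons /incidence /=; clear; lia.
have inq q : List.In q s <-> q = (u, w, Y) \/ List.In q (s1 ++ s2).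
  by rewrite sE !List.in_app_iff /=; intuition.
have unY : Y \is unitarymx by apply: (unis (u, w, Y)); apply/inq; left.
(* [g] is the far end of the neighbour, which is transposed when [e'] is its column index. *)
pose g := if u == e' then w else u.
pose Z := if u == e' then Y else Y^T.
have unZ : Z \is unitarymx by rewrite /Z; case: ifP => _; [exact: unY | rewrite trmx_unitary].
have ge : g != e'.
  have := occs e'; rewrite oe /g; case: (eqVneq u e') => [_|//].
  by case: eqP => //= _; lia.
have o12 : occurrences e' (s1 ++ s2) = 0%N.
  by have := occs e'; rewrite oe; move: uw; clear; case: (u == e'); case: (w == e') => //= _; lia.
have ZE (i : {ffun E -> 'I_N}) : net_factor i (u, w, Y) = Z (i e') (i g).
  rewrite /net_factor /Z /g /=; case: eqP uw => [->//|_ /= /eqP ->].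
  by rewrite mxE.
have E1 : N%:R * network ((e, e', X) :: s) = network ((e, g, X *m Z) :: (s1 ++ s2)).
  rewrite /network.
  have -> : \sum_(i : {ffun E -> 'I_N}) \prod_(q <- (e, e', X) :: s) net_factor i q =
    \sum_(i : {ffun E -> 'I_N}) (X (i e) (i e') * Z (i e') (i g)) *
      \prod_(q <- s1 ++ s2) net_factor i q.
    apply: eq_bigr => i _; rewrite big_cons sE !big_cat big_cons ZE /=.
    rewrite {1}/net_factor /=; ring.
  rewrite (@network_indep e') => [|i v]; last exact: net_factor_upd.
  apply: eq_bigr => i _; rewrite big_cons; congr (_ * _).
  rewrite /net_factor /= mxE; apply: eq_bigr => v _.
  by rewrite upd_l !updE (negPf ne) (negPf ge).
rewrite -(ler_pM2l NR) -[N%:R in leLHS](nm_nat R) -nmM E1 -exprS.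
apply: IH.
- by move: sn; rewrite sE /= !size_cat /=; clear; lia.
- move=> q [<-|qs]; first exact: mul_unitarymx.
  by apply: unis; apply/inq; right.
- move=> z; rewrite /occurrences big_cons /incidence /= -/(occurrences z (s1 ++ s2)).
  case: (eqVneq z e') => [->|ze].
    by left; rewrite o12 (negPf ne) (negPf ge).
  have := occ z; rewrite occE occs [e' == z]eq_sym (negPf ze).
  suff -> : ((u == z) + (w == z) = (g == z))%N by clear; lia.
  rewrite /g; case: eqP uw => [-> _|_ /= /eqP ->].
    by rewrite [e' == z]eq_sym (negPf ze).
  by rewrite [e' == z]eq_sym (negPf ze) addn0.
(* [F] repeats at [e'] the value taken at [e]. The isolated index [e'] can add one more value of
   [f], hence the exponent [c.+1]. *)
move=> T f fs; pose F z := if z == e' then f e else f z.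
have nin : forall q, List.In q (s1 ++ s2) -> q.1.1 != e' /\ q.1.2 != e'.
  exact: not_incident.
have : (#|[set F z | z : E]| <= c)%N.
  apply: comp => q [<-|/inq[->|qs]]; rewrite /F /=.
  - by rewrite (negPf ne) eqxx.
  - have fg : f e = f g by apply: (fs (e, g, X *m Z)); left.
    move: fg ge; rewrite /g; case: (boolP (u == e')) => [_ fg /negPf -> //|ue' fg _].
    by move: uw; rewrite (negPf ue') /= => ->.
  - have [/negPf -> /negPf ->] := nin q qs; by apply: fs; right.
rewrite -ltnS => hF; apply: leq_trans hF.
rewrite (cardsD1 (f e')) (leq_trans (leq_add (leq_b1 _) (leqnn _))) // add1n.
rewrite ltnS; apply: subset_leq_card; apply/fintype.subsetP => y /setD1P[ye /imsetP[z _ yz]].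
apply/imsetP; exists z => //; rewrite /F; case: eqP => // ze.
by rewrite yz ze eqxx in ye.
Qed.

End MatrixNetworks.

Section MatrixMaps.
Variables (R : realType) (N : nat) (I : Type) (ell : I -> nat) (H : finType).
Hypothesis ell2 : forall i, ell i = 2%N.
Variables (G : gmap ell H) (al : {perm H}) (x : forall i, tensor R N (ell i)).
Local Notation C := (cplx R).
Hypotheses (alm : matching al) (N0 : (0 < N)%N).
Hypothesis xU : forall h, exists2 X : 'M[C]_N, X \is unitarymx &
  forall i : {ffun H -> 'I_N}, gloc G x h i = X (i h) (i (gpi G h)).

Let alK : involutive al. Proof. by case/matchingP: alm. Qed.
Let alf y : al y != y. Proof. by case/matchingP: alm => _; apply. Qed.

(** The half-edge of smaller rank stands for its edge. *)
Let rep h := if (enum_rank h < enum_rank (al h))%N then h else al h.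

Let rep_al h : rep (al h) = rep h.
Proof.
rewrite /rep alK; case: ltngtP => // e.
by have := alf h; rewrite -(inj_eq enum_rank_inj) -(inj_eq val_inj) /= e eqxx.
Qed.

Let rep_rep h : rep (rep h) = rep h.
Proof. by rewrite {2}/rep; case: ifP => // _; rewrite rep_al. Qed.

Let E : finType := {h : H | rep h == h}.

Let repE h : E := exist _ (rep h) (introT eqP (rep_rep h)).

Let repE_al h : repE (al h) = repE h.
Proof. by apply: val_inj; rewrite /= rep_al. Qed.

Let repE_val (e : E) : repE (val e) = e.
Proof. by apply: val_inj; rewrite /=; apply/eqP/(valP e). Qed.

Let rep_or h : rep h = h \/ rep h = al h.
Proof. by rewrite /rep; case: ifP; [left|right]. Qed.

Let matrix_of h : 'M[C]_N := sval (cid2 (xU h)).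

Let s : seq (E * E * 'M[C]_N) :=
  [seq (repE h, repE (gpi G h), matrix_of h) | h <- enum (grt G)].

Lemma contract_network : contract (gphi G x) al = network s.
Proof.
rewrite /contract /network.
pose mk (u : {ffun E -> 'I_N}) : {ffun H -> 'I_N} := [ffun h => u (repE h)].
pose km (i : {ffun H -> 'I_N}) : {ffun E -> 'I_N} := [ffun e => i (val e)].
rewrite (reindex_onto mk km) /=; last first.
  move=> i /inv_idxP ii; apply/ffunP => h; rewrite !ffunE /=.
  by case: (rep_or h) => ->.
apply: eq_big => [u|u _].
  apply/andP; split; first by apply/inv_idxP => h; rewrite !ffunE repE_al.
  by apply/eqP/ffunP => e; rewrite !ffunE repE_val.
rewrite big_map big_enum /= /gphi; apply: eq_bigr => h _.
rewrite /net_factor /= /matrix_of; case: cid2 => X /= _ ->.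
by rewrite !ffunE.
Qed.

Let occ e : occurrences e s = 2%N.
Proof.
rewrite /occurrences big_map big_enum /=.
transitivity (\sum_(h : H) (repE h == e))%N.
  rewrite (big_legs G) /=; apply: eq_bigr => h _.
  by rewrite ell2 !big_ord_recl big_ord0 addn0.
have ne : al (val e) != val e by apply: alf.
rewrite (bigD1 (val e)) //= (bigD1 (al (val e))) //= repE_al repE_val eqxx.
rewrite big1 ?addn0 // => h /andP[h1 h2]; apply/eqP; rewrite eqb0.
apply/eqP => /(congr1 val) /= he; case: (rep_or h) => rh.
  by rewrite -he rh eqxx in h1.
by rewrite -he rh alK eqxx in h2.
Qed.

(** The indices of the network are the edges of the map and its nodes are the vertices, all of
    degree 2, so the network has no more components than the map. *)
Lemma matrix_map_bound :
  nm (contract (gphi G x) al / N%:R ^+ gncomp (gpi G) al) <= 1.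
Proof.
have NR : (0 < N%:R :> R) by rewrite ltr0n.
rewrite nmM nmV nmX nm_nat ler_pdivrMr ?exprn_gt0 // mul1r contract_network.
apply: network_bound => //.
- move=> q /List.in_map_iff[h [<- _]] /=; rewrite /matrix_of; by case: cid2.
- by move=> e; right.
move=> T f fs.
have deg2 h : iter 2 (gpi G) h = h.
  by rewrite -{2}(iter_porbit (gpi G) h) gdeg ell2.
have rE h : grt G h -> f (repE h) = f (repE (gpi G h)).
  move=> gh; apply: (fs (repE h, repE (gpi G h), matrix_of h)).
  apply/List.in_map_iff; exists h; split=> //.
  have : h \in enum (grt G) by rewrite mem_enum.
  by elim: (enum _) => //= a r IH; rewrite inE => /predU1P[->|/IH]; [left|right].
have FI : invariant_fun (gpi G) al (fun h => f (repE h)).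
  split=> h; last by rewrite repE_al.
  have := iter_ix G h; have := ix_lt G h; rewrite ell2.
  case: (ix G h) => [|[|//]] _ /= <-; first by rewrite -rE ?rt_root.
  by rewrite -[RHS]rE ?rt_root // -[gpi G (gpi G _)]/(iter 2 (gpi G) _) deg2.
apply: leq_trans (card_invariant FI); apply: subset_leq_card.
apply/fintype.subsetP => _ /imsetP[e _ ->]; apply/imsetP; exists (val e) => //.
by rewrite repE_val.
Qed.

End MatrixMaps.

Section FineUnitary.
Variables (R : realType) (I0 : finType) (ell0 : I0 -> nat).
Variable A0 : forall N (i : I0), tensor R N (ell0 i).

Definition unitary_family N (x : forall i : two_index I0 true, tensor R N (two_order ell0 i)) :=
  exists2 X : 'M[cplx R]_N, X \is unitarymx & x = @two_families R N I0 ell0 (@A0 N) X true.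

(** Adjoints and conjugation flags only replace a unitary matrix by another one. *)
Lemma fine_unitary : fine_bounded unitary_family.
Proof.
move=> H G al ma; exists 1 => N x N0 [X XU ->].
apply: matrix_map_bound => // h.
have adjU (Y : 'M[cplx R]_N) : Y \is unitarymx -> Y ^t* \is unitarymx.
  by rewrite trmxC_unitary.
exists (if gflag G h then (if glab G h then map_mx Num.conj X else map_mx Num.conj (X ^t*))
        else (if glab G h then X else X ^t*)).
  case: ifP => _; case: ifP => _.
  - by rewrite conjC_unitary.
  - by rewrite conjC_unitary adjU.
  - by [].
  - exact: adjU.
move=> i; rewrite /gloc; case: (gflag G h).
  by case: (glab G h) => /=; rewrite /two_families /matrix_tensor !ffunE /= [RHS]mxE.
by case: (glab G h) => /=; rewrite /two_families /matrix_tensor !ffunE.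
Qed.

End FineUnitary.

(** * Relabelling by an interval of integers *)

Section Relabelling.
Variables (I : Type) (ell : I -> nat) (H : finType) (G : gmap ell H) (al : {perm H}).
Hypothesis alm : matching al.
Let alK : involutive al. Proof. by case/matchingP: alm. Qed.
Let alf y : al y != y. Proof. by case/matchingP: alm => _; apply. Qed.

(* The roots come first, so that they are the least elements of their cycles. *)
Let s := enum (grt G) ++ enum (predC (grt G)).

Let s_uniq : uniq s.
Proof.
rewrite cat_uniq !enum_uniq andbT /=; apply/hasPn => h.
by rewrite !mem_enum.
Qed.

Let s_size : size s == #|H|.
Proof. by rewrite size_cat -!cardE cardC. Qed.

Let g : 'I_#|H| -> H := tnth (Tuple s_size).

Let gI : injective g. Proof. exact/tuple_uniqP/s_uniq. Qed.

Let g_bij : bijective g.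
Proof. by apply: inj_card_bij gI _; rewrite card_ord. Qed.

Let gS h : exists i, g i == h.
Proof. by case: g_bij => g' _ K; exists (g' h); rewrite K. Qed.

Let idx h : 'I_#|H| := xchoose (gS h).

Let gidx h : g (idx h) = h. Proof. exact/eqP/(xchooseP (gS h)). Qed.

Let g_lt i j : grt G (g i) -> ~~ grt G (g j) -> (i < j)%N.
Proof.
have ss : size s = #|H| := eqP s_size.
have iE (u : 'I_#|H|) : g u = nth (g i) s u by rewrite /g (tnth_nth (g i)).
rewrite (iE i) (iE j) /s !nth_cat => hi hj; rewrite ltnNge; apply/negP => ji.
case: ifP hi => [li|/negbT]; last first.
  rewrite -leqNgt => li hi.
  have : nth (g i) (enum (predC (grt G))) (i - size (enum (grt G))) \in enum (predC (grt G)).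
    by rewrite mem_nth // -(ltn_add2r (size (enum (grt G)))) subnK // addnC -size_cat -/s ss.
  by rewrite mem_enum => h; have : ~~ grt G _ := h; rewrite hi.
have lj := leq_ltn_trans ji li; rewrite lj in hj.
have := mem_nth (g i) lj; rewrite mem_enum => h; have : grt G _ := h.
by rewrite (negPf hj).
Qed.

Let conj_inj (p : {perm H}) : injective (fun i => idx (p (g i))).
Proof. by move=> i j /(congr1 g); rewrite !gidx => /perm_inj/gI. Qed.

Let cp (p : {perm H}) : {perm 'I_#|H|} := perm (@conj_inj p).

Let cpE (p : {perm H}) i : p (g i) = g (cp p i).
Proof. by rewrite permE gidx. Qed.

Let cal_inv : [forall i, cp al (cp al i) == i].
Proof. by apply/forallP => i; apply/eqP/gI; rewrite -!cpE alK. Qed.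

Definition relabel_cmap := CMap (cp (gpi G)) cal_inv.

Let vroot_relabel i : vroot relabel_cmap i = grt G (g i).
Proof.
have dir j : grt G (g j) -> vroot relabel_cmap j.
  move=> gj; apply/'forall_implyP => l lj.
  have gl : g l \in porbit (gpi G) (g j) by rewrite (mem_porbit_embed gI (cpE (gpi G))).
  have [gr|nr] := boolP (grt G (g l)); last by rewrite ltnW // g_lt.
  by rewrite (gI (grt_uniq gj gr gl)).
apply/idP/idP; last exact: dir.
move=> vi; pose j := idx (rt G (g i)).
have gj : grt G (g j) by rewrite gidx rt_root.
suff -> : i = j by [].
apply: (vroot_uniq vi (dir _ gj)).
by rewrite -(mem_porbit_embed gI (cpE (gpi G))) gidx rt_mem.
Qed.

Variables (sg : I -> I) (sgP : forall i, ell (sg i) = ell i).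

(** The flags disappear here: a conjugated vertex receives the label that [sg] assigns to the
    conjugate tensor. *)
Let rlab i := if gflag G (g i) then sg (glab G (g i)) else glab G (g i).

Let rlab_vperm i : rlab (vperm relabel_cmap i) = rlab i.
Proof. by rewrite /rlab -cpE glab_pi gflag_pi. Qed.

Let rlab_deg i : #|porbit (vperm relabel_cmap) i| = ell (rlab i).
Proof.
rewrite -(card_porbit_embed gI (cpE (gpi G))) gdeg /rlab.
by case: ifP => _; rewrite ?sgP.
Qed.

Let rbnd : [tuple] =i boundary relabel_cmap.
Proof.
move=> i; change (false = (i \in boundary relabel_cmap)).
apply/esym/negbTE; rewrite inE /=.
by rewrite -(inj_eq gI) -cpE alf.
Qed.

Definition relabel_imap : imap ell 0 :=
  @IMap I ell 0 _ relabel_cmap rlab rlab_vperm rlab_deg [tuple] isT rbnd.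

Lemma relabel_gncomp : ncomp relabel_imap = gncomp (gpi G) al.
Proof.
rewrite ncomp_gncomp.
rewrite (@gncomp_split _ 'I_0 _ (cp (gpi G)) (cp al) 1%g 1%g (gpi G) al g (fun i => g (widen_ord (leq0n _) i))) //;
  try by move=> [].
- by rewrite [gncomp 1 1](_ : _ = 0%N) ?addn0 //; apply/eqP; rewrite -leqn0;
    apply: leq_trans (gncomp_le_card _ _) _; rewrite card_ord.
- by move=> ? [].
- by move=> z; left; exists (idx z); rewrite gidx.
Qed.

(** Index tuples are given by a function on [nat], which avoids a cast between the equal orders
    [ell (sg i)] and [ell i]. *)
Lemma relabel_value (R : realType) N (x : forall i, tensor R N (ell i)) :
  (forall (i : I) (t : nat -> 'I_N), x (sg i) [ffun s : 'I_(ell (sg i)) => t s] =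
      (x i [ffun s : 'I_(ell i) => t s])^*) ->
  contract (gphi G x) al / N%:R ^+ gncomp (gpi G) al =
  scalar_of (imap_value x relabel_imap).
Proof.
move=> xsg; rewrite imap_value0E relabel_gncomp; congr (_ / _).
have phiE (i : {ffun H -> 'I_N}) :
    gphi G x i = gphi (gmap_of_imap false relabel_imap) x [ffun u => i (g u)].
  rewrite /gphi (reindex g) /=; last exact: onW_bij g_bij.
  apply: eq_big => [u|u _]; first by rewrite vroot_relabel.
  rewrite /gloc /=.
  have tE q : [ffun t : 'I_q => i (iter t (gpi G) (g u))] =
      [ffun t : 'I_q => [ffun u => i (g u)] (iter t (cp (gpi G)) u)].
    by apply/ffunP => t; rewrite !ffunE (iter_embed (cpE (gpi G))).
  rewrite /rlab; case: (gflag G (g u)); last by rewrite tE.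
  by rewrite (xsg _ (fun t => [ffun u => i (g u)] (iter t (cp (gpi G)) u))) tE.
have [g' gK g'K] := g_bij.
rewrite /contract (reindex (fun i : {ffun 'I_#|H| -> 'I_N} => [ffun h => i (g' h)])) /=; last first.
  exists (fun i : {ffun H -> 'I_N} => [ffun u => i (g u)]) => i _.
    by apply/ffunP => u; rewrite !ffunE gK.
  by apply/ffunP => u; rewrite !ffunE g'K.
apply: eq_big => [i|i _].
  apply/inv_idxP/inv_idxP => h z.
    by have := h (g z); rewrite !ffunE cpE !gK.
  by rewrite !ffunE -(g'K z) cpE !gK h.
rewrite phiE; congr gphi; apply/ffunP => u; by rewrite !ffunE gK.
Qed.

End Relabelling.

Section FineDeterministic.
Variables (R : realType) (I0 : finType) (ell0 : I0 -> nat).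
Variable A0 : forall N (i : I0), tensor R N (ell0 i).
Arguments A0 : clear implicits.
Hypothesis A0J : forall N, (0 < N)%N -> stable_under_conj (A0 N).
Hypothesis A1 : forall M : imap ell0 0, exists C : R, forall N, (0 < N)%N ->
     `|scalar_of (imap_value (A0 N) M)| <= C%:C%C.

Definition deterministic_family N (x : forall i, tensor R N (ell0 i)) := x = A0 N.

(** The label of the conjugate tensor may depend on N. As [I0] is finite, a bound is taken for each
    self-map [sg] of [I0] that preserves the orders, and these bounds are summed. *)
Lemma fine_deterministic : fine_bounded deterministic_family.
Proof.
move=> H G al ma.
have bsg (sg : {ffun I0 -> I0}) : exists K : R,
    forall (sgP : forall i, ell0 (sg i) = ell0 i) N, (0 < N)%N ->
    nm (scalar_of (imap_value (A0 N) (relabel_imap G ma sgP))) <= K.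
  have [sgP|no] := pselect (forall i, ell0 (sg i) = ell0 i); last by exists 0.
  have [K hK] := A1 (relabel_imap G ma sgP); exists K => sgP' N N0.
  rewrite (Prop_irrelevance sgP' sgP).
  by have := hK N N0; rewrite nmE lecR.
have [K hK] := choice bsg.
exists (\sum_sg `|K sg|) => N x N0 ->.
have /choice[sg sgE] : forall i, exists i', exists e : ell0 i = ell0 i',
    forall t : {ffun 'I_(ell0 i') -> 'I_N},
      A0 N i' t = (A0 N i [ffun s => t (cast_ord e s)])^*.
  exact: A0J.
pose sgf : {ffun I0 -> I0} := [ffun i => sg i].
have sgP i : ell0 (sgf i) = ell0 i by rewrite ffunE; have [e _] := sgE i.
rewrite (@relabel_value _ _ _ G al ma sgf sgP _ N (A0 N)) => [|i t].
  apply: le_trans (hK sgf sgP N N0) _; apply: le_trans (ler_norm _) _.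
  by rewrite (bigD1 sgf) //= lerDl sumr_ge0.
rewrite /sgf ffunE; have [e ->] := sgE i; congr ((A0 N i _)^*).
by apply/ffunP => u; rewrite !ffunE.
Qed.

End FineDeterministic.

(** * Products of values of maps *)

Section GmapValues.
Variables (R : realType) (I : Type) (ell : I -> nat).

Definition gval N (x : forall i, tensor R N (ell i)) (H : finType) (G : gmap ell H)
    (a : {perm H}) : cplx R :=
  contract (gphi G x) a / N%:R ^+ gncomp (gpi G) a.

Lemma gloc_embed N (x : forall i, tensor R N (ell i)) (H H1 : finType)
    (G : gmap ell H) (G1 : gmap ell H1) (f : H1 -> H) :
  (forall u, gpi G (f u) = f (gpi G1 u)) -> (forall u, glab G (f u) = glab G1 u) ->
  (forall u, gflag G (f u) = gflag G1 u) ->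
  forall u i, gloc G x (f u) i = gloc G1 x u [ffun u => i (f u)].
Proof.
move=> fp fl ff u i; rewrite /gloc ff fl.
have -> : [ffun t : 'I_(ell (glab G1 u)) => i (iter t (gpi G) (f u))] =
   [ffun t : 'I_(ell (glab G1 u)) => [ffun u => i (f u)] (iter t (gpi G1) u)] => //.
by apply/ffunP => t; rewrite !ffunE (iter_embed fp).
Qed.

Section Split.
Variables (H1 H2 H : finType) (G1 : gmap ell H1) (G2 : gmap ell H2) (G : gmap ell H).
Variables (a1 : {perm H1}) (a2 : {perm H2}) (a : {perm H}).
Variables (f1 : H1 -> H) (f2 : H2 -> H).
Hypotheses (f1I : injective f1) (f2I : injective f2)
  (f12 : forall x y, f1 x != f2 y)
  (fC : forall z, (exists x, z = f1 x) \/ (exists y, z = f2 y)).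
Hypotheses (p1E : forall x, gpi G (f1 x) = f1 (gpi G1 x))
  (a1E : forall x, a (f1 x) = f1 (a1 x))
  (p2E : forall x, gpi G (f2 x) = f2 (gpi G2 x))
  (a2E : forall x, a (f2 x) = f2 (a2 x)).
Hypotheses (r1E : forall x, grt G (f1 x) = grt G1 x) (r2E : forall x, grt G (f2 x) = grt G2 x)
  (l1E : forall x, glab G (f1 x) = glab G1 x) (l2E : forall x, glab G (f2 x) = glab G2 x)
  (g1E : forall x, gflag G (f1 x) = gflag G1 x) (g2E : forall x, gflag G (f2 x) = gflag G2 x).

Lemma gval_split N (x : forall i, tensor R N (ell i)) :
  gval x G a = gval x G1 a1 * gval x G2 a2.
Proof.
rewrite /gval (gncomp_split f1I f2I f12 fC p1E a1E p2E a2E) exprD.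
rewrite (@contract_split _ _ _ _ _ _ _ _ _ _ f1I f2I f12 fC a1E a2E (gphi G x) (gphi G1 x) (gphi G2 x)).
  by rewrite invfM mulrACA.
move=> i; rewrite /gphi (big_split_type f1I f2I f12 fC).
congr (_ * _).
  by apply: eq_big => [u|u _]; [exact: r1E | exact: gloc_embed].
by apply: eq_big => [u|u _]; [exact: r2E | exact: gloc_embed].
Qed.

End Split.

Section Conj.
Variables (H : finType) (G : gmap ell H).

Let cflag_pi h : ~~ gflag G (gpi G h) = ~~ gflag G h.
Proof. by rewrite gflag_pi. Qed.

Definition conj_gmap : gmap ell H :=
  GMap (gflag := fun h => ~~ gflag G h) (glab_pi G) cflag_pi (gdeg G) (grt_ex G)
    (@grt_uniq _ _ _ G).

Lemma gval_conj N (x : forall i, tensor R N (ell i)) a :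
  gval x conj_gmap a = (gval x G a)^*.
Proof.
rewrite /gval rmorphM fmorphV rmorphXn rmorph_nat; congr (_ / _).
rewrite /contract rmorph_sum; apply: eq_bigr => i _.
rewrite /gphi rmorph_prod; apply: eq_bigr => h _; rewrite /gloc /=.
by case: (gflag G h); rewrite //= conjCK.
Qed.

End Conj.

Section SumGmap.
Variables (H1 H2 : finType) (G1 : gmap ell H1) (G2 : gmap ell H2).
Let p := sum_perm (gpi G1) (gpi G2).
Let inlI : injective (@inl H1 H2). Proof. by move=> u v []. Qed.
Let inrI : injective (@inr H1 H2). Proof. by move=> u v []. Qed.
Let pl u : p (inl u) = inl (gpi G1 u). Proof. exact: sum_perml. Qed.
Let pr u : p (inr u) = inr (gpi G2 u). Proof. exact: sum_permr. Qed.
Let sel (T : Type) (f1 : H1 -> T) (f2 : H2 -> T) z :=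
  match z with inl u => f1 u | inr v => f2 v end.

Lemma sum_lab_pi z : sel (glab G1) (glab G2) (p z) = sel (glab G1) (glab G2) z.
Proof. by case: z => u; rewrite ?pl ?pr /= glab_pi. Qed.

Lemma sum_flag_pi z : sel (gflag G1) (gflag G2) (p z) = sel (gflag G1) (gflag G2) z.
Proof. by case: z => u; rewrite ?pl ?pr /= gflag_pi. Qed.

Lemma sum_deg z : #|porbit p z| = ell (sel (glab G1) (glab G2) z).
Proof. by case: z => u; rewrite ?(card_porbit_embed inlI pl) ?(card_porbit_embed inrI pr) gdeg. Qed.

Lemma sum_rt_ex z : exists r, sel (grt G1) (grt G2) r && (r \in porbit p z).
Proof.
case: z => u; [have [r hr] := grt_ex G1 u | have [r hr] := grt_ex G2 u].
  by exists (inl r); rewrite (mem_porbit_embed inlI pl).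
by exists (inr r); rewrite (mem_porbit_embed inrI pr).
Qed.

Lemma sum_rt_uniq r r' : sel (grt G1) (grt G2) r -> sel (grt G1) (grt G2) r' ->
  r' \in porbit p r -> r = r'.
Proof.
case: r => u hu hr' h.
  have [v e] := porbit_embed pl h; rewrite e (mem_porbit_embed inlI pl) in h hr' *.
  by rewrite (grt_uniq hu hr' h).
have [v e] := porbit_embed pr h; rewrite e (mem_porbit_embed inrI pr) in h hr' *.
by rewrite (grt_uniq hu hr' h).
Qed.

Definition sum_gmap : gmap ell (H1 + H2)%type :=
  GMap sum_lab_pi sum_flag_pi sum_deg sum_rt_ex sum_rt_uniq.

Lemma gval_sum N (x : forall i, tensor R N (ell i)) a1 a2 :
  gval x sum_gmap (sum_perm a1 a2) = gval x G1 a1 * gval x G2 a2.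
Proof.
apply: (@gval_split _ _ _ G1 G2 sum_gmap a1 a2 (sum_perm a1 a2) inl inr) => //.
- by move=> [u|u]; [left|right]; exists u.
- by move=> u; rewrite sum_perml.
- by move=> u; rewrite sum_permr.
Qed.

End SumGmap.

Section SubGmap.
Variables (H : finType) (G : gmap ell H) (K : pred H).
Hypothesis Kp : forall h, K (gpi G h) = K h.
Local Notation HK := {h : H | K h}.

Definition sub_perm_fun (q : {perm H}) (qK : forall h, K (q h) = K h) (u : HK) : HK :=
  exist _ (q (val u)) (etrans (qK _) (valP u)).

Lemma sub_perm_inj (q : {perm H}) (qK : forall h, K (q h) = K h) : injective (sub_perm_fun qK).
Proof. by move=> u v /(congr1 val) /= /perm_inj/val_inj. Qed.

Definition sub_perm (q : {perm H}) (qK : forall h, K (q h) = K h) : {perm HK} :=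
  perm (@sub_perm_inj q qK).

Lemma sub_permE (q : {perm H}) (qK : forall h, K (q h) = K h) u : q (val u) = val (sub_perm qK u).
Proof. by rewrite permE. Qed.

Let p := sub_perm Kp.
Let pE u : gpi G (val u) = val (p u). Proof. exact: sub_permE. Qed.

Lemma sub_lab_pi u : glab G (val (p u)) = glab G (val u).
Proof. by rewrite -pE glab_pi. Qed.

Lemma sub_flag_pi u : gflag G (val (p u)) = gflag G (val u).
Proof. by rewrite -pE gflag_pi. Qed.

Lemma sub_deg u : #|porbit p u| = ell (glab G (val u)).
Proof. by rewrite -(card_porbit_embed val_inj pE) gdeg. Qed.

Lemma sub_rt_ex u : exists r, grt G (val r) && (r \in porbit p u).
Proof.
have [r /andP[gr hr]] := grt_ex G (val u); have [v e] := porbit_embed pE hr.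
by exists v; rewrite -e gr -(mem_porbit_embed val_inj pE) -e.
Qed.

Lemma sub_rt_uniq (r r' : HK) : grt G (val r) -> grt G (val r') -> r' \in porbit p r -> r = r'.
Proof.
by move=> gr gr' h; apply/val_inj/(grt_uniq gr gr'); rewrite (mem_porbit_embed val_inj pE).
Qed.

Definition sub_gmap : gmap ell HK :=
  GMap sub_lab_pi sub_flag_pi sub_deg sub_rt_ex sub_rt_uniq.

Lemma matching_sub (q : {perm H}) (qK : forall h, K (q h) = K h) : matching q -> matching (sub_perm qK).
Proof.
move=> /matchingP[qq qf]; apply/matchingP; split=> u.
  by apply: val_inj; rewrite -!sub_permE qq.
by apply: contraNneq (qf (val u)) => e; rewrite (sub_permE qK) e.
Qed.

End SubGmap.

Lemma gval_partition N (x : forall i, tensor R N (ell i)) (H : finType)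
    (G : gmap ell H) (a : {perm H}) (K : pred H)
    (Kp : forall h, K (gpi G h) = K h) (Ka : forall h, K (a h) = K h)
    (Kp' : forall h, ~~ K (gpi G h) = ~~ K h) (Ka' : forall h, ~~ K (a h) = ~~ K h) :
  gval x G a = gval x (sub_gmap Kp) (sub_perm Ka) *
    gval x (sub_gmap (K := fun h => ~~ K h) Kp') (sub_perm (K := fun h => ~~ K h) Ka').
Proof.
apply: (@gval_split _ _ _ _ _ G _ _ a val val) => //; try exact: val_inj;
  try exact: sub_permE.
- by move=> [u hu] [v hv]; apply/eqP => /= e; rewrite e (negPf hv) in hu.
- move=> z; case: (boolP (K z)) => h; [left|right].
    by exists (exist _ z h).
  by exists (exist _ z h).
Qed.

End GmapValues.

Section ComponentRoots.
Variables (m : nat) (M : cmap m) (h : 'I_m).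

(** The half-edges of a component are relabelled increasingly, so that its roots remain the least
    elements of their cycles. *)
Lemma enum_val_leq (K : {set 'I_m}) (i j : 'I_#|K|) :
  (enum_val i <= enum_val j)%N = (i <= j)%N.
Proof.
have st : sorted ltn (map val (enum K)).
  rewrite {1}/enum_mem -enumT; apply: (subseq_sorted ltn_trans (s2 := map val (enum 'I_m))).
    exact/map_subseq/filter_subseq.
  by rewrite val_enum_ord iota_ltn_sorted.
have nthE (u : 'I_#|K|) : val (enum_val u) = nth 0%N (map val (enum K)) u.
  by rewrite /enum_val (nth_map (enum_default u)) // -cardE.
have sz (u : 'I_#|K|) : (u < size (map val (enum K)))%N by rewrite size_map -cardE.
have mono : forall u v : 'I_#|K|, (u < v)%N -> (enum_val u < enum_val v)%N.
  move=> u v uv; rewrite -[X in (X < _)%N]/(val (enum_val u)) -[X in (_ < X)%N]/(val (enum_val v)).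
  by rewrite !nthE; apply: (sorted_ltn_nth ltn_trans) => //; apply: sz.
case: (ltngtP i j) => [ij|ji|/val_inj ->]; rewrite ?leqnn //.
  by rewrite ltnW // mono.
by apply/negbTE; rewrite -ltnNge mono.
Qed.

Lemma vroot_component u : vroot (component M h) u = vroot M (enum_val u).
Proof.
have vE x : vperm M (enum_val x) = enum_val (vperm (component M h) x).
  by rewrite component_vpermE.
apply/'forall_implyP/'forall_implyP => hu x xu.
  have [y e] := porbit_embed vE xu.
  by rewrite e enum_val_leq hu // -(mem_porbit_embed (@enum_val_inj _ _) vE) -e.
by rewrite -enum_val_leq hu // (mem_porbit_embed (@enum_val_inj _ _) vE).
Qed.

End ComponentRoots.

(** * Asymptotic freeness *)

Local Open Scope classical_set_scope.

Section Groups.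
Variables (R : realType) (N : nat).
Local Notation M := 'M[cplx R]_N.

(** The properties of U(N) and O(N) from which the mean values are computed, so that both cases are
    treated at once. *)
Record unitary_subgroup (G : set M) : Prop := UnitarySubgroup {
  sg_borel : borel_set G;
  sg_unitary : G `<=` unitary_group (R := R) (N := N);
  sg_mul : forall V X, G V -> G X -> G (V *m X);
  sg_adj : forall X, G X -> G (X ^t*);
  sg_orth : orthogonal_group (R := R) (N := N) `<=` G }.

Lemma unitary_group_subgroup : unitary_subgroup (@unitary_group R N).
Proof.
split; first exact: borel_unitary.
- by [].
- by move=> V X; apply: mul_unitarymx.
- by move=> X XU; rewrite /unitary_group /= trmxC_unitary.
- exact: orthogonal_unitary.
Qed.

Lemma orthogonalP (X : M) : orthogonal_group X <->
  map_mx Num.conj X = X /\ X *m X^T = 1%:M.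
Proof.
split=> -[h1 h2]; split=> //; first by apply/eqP; rewrite -realmx_conj.
by rewrite realmx_conj; apply/eqP.
Qed.

Lemma orthogonal_group_subgroup : unitary_subgroup (@orthogonal_group R N).
Proof.
split => //; first exact: borel_orthogonal.
- exact: orthogonal_unitary.
- move=> V X /orthogonalP[v1 v2] /orthogonalP[x1 x2]; apply/orthogonalP.
  rewrite map_mxM v1 x1; split=> //.
  by rewrite trmx_mul mulmxA -(mulmxA V) x2 mulmx1.
- move=> X /orthogonalP[x1 x2]; apply/orthogonalP.
  rewrite -map_trmx x1; split; first by rewrite -map_trmx x1.
  by rewrite trmxK; apply: mulmx1C.
Qed.

End Groups.

Section InProbability.
Variables (R : realType) (d : nat -> measure_display).
Variables (T : forall N, measurableType (d N)) (P : forall N, probability (T N) R).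

Lemma cvg0_in_probabilityP (X : forall N, T N -> cplx R) : cvg0_in_probability P X ->
  forall e dl : R, 0 < e -> 0 < dl -> exists N0, forall N, (N0 <= N)%N ->
    fine (P N [set w | (e%:C)%C <= `|X N w|]) <= dl.
Proof.
move=> XP e dl e0 dl0; have /fine_cvgP[_ /cvgrPdist_le/(_ dl dl0)] := XP e e0.
case=> N0 _ h; exists N0 => N NN; have := h N NN.
by rewrite /= sub0r normrN; apply: le_trans; apply: ler_norm.
Qed.

Lemma cvg0_in_probability_of_bound (X : forall N, T N -> cplx R) :
  (forall e dl : R, 0 < e -> 0 < dl -> exists N0, forall N, (N0 <= N)%N ->
    (P N [set w | ((e%:C)%C <= `|X N w|)%R] <= dl%:E)%E) -> cvg0_in_probability P X.
Proof.
move=> h e e0.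
have bd dl : 0 < dl -> exists N0, forall N, (N0 <= N)%N ->
    P N [set w | (e%:C)%C <= `|X N w|] \is a fin_num /\
    fine (P N [set w | (e%:C)%C <= `|X N w|]) <= dl.
  move=> dl0; have [N0 hN] := h e dl e0 dl0; exists N0 => N NN.
  have le := hN N NN; have fn : P N [set w | (e%:C)%C <= `|X N w|] \is a fin_num.
    by rewrite ge0_fin_numE ?measure_ge0 // (le_lt_trans le) ?ltry.
  by split=> //; rewrite -lee_fin fineK.
apply/fine_cvgP; split.
  by have [N0 hN] := bd 1 ltr01; exists N0 => // N /hN[].
apply/cvgrPdist_le => dl dl0; have [N0 hN] := bd dl dl0; exists N0 => // N /hN[_].
by rewrite /= sub0r normrN ger0_norm // fine_ge0 // measure_ge0.
Qed.

End InProbability.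

Lemma map_le_vperm m (M M' : cmap m) : in_M0 M -> map_le M' M ->
  vperm M' = vperm M /\ in_M0 M'.
Proof.
move=> M0 [->//|lt]; suff : (in_M0 M -> vperm M' = vperm M /\ in_M0 M') by apply.
elim: lt => {M0} [x y [[x0 y0 e _] _] _ //|x y z _ h1 _ h2 z0].
by have [e1 y0] := h2 z0; have [e2 x0] := h1 y0; rewrite e2 e1.
Qed.

(** * Means and second moments of the values of a map *)

Section Assembly.
Variables (R : realType) (d : nat -> measure_display)
  (T : forall N, measurableType (d N)) (P : forall N, probability (T N) R)
  (U : forall N, T N -> 'M[cplx R]_N)
  (I0 : finType) (ell0 : I0 -> nat)
  (A0 : forall N (i : I0), tensor R N (ell0 i)).
Arguments A0 : clear implicits.
Arguments U : clear implicits.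
Hypotheses
  (haarU : forall N, (0 < N)%N ->
     haar_distributed (P N) (@unitary_group R N) (U N) \/
     haar_distributed (P N) (@orthogonal_group R N) (U N))
  (A0J : forall N, (0 < N)%N -> stable_under_conj (A0 N))
  (A1 : forall M : imap ell0 0, exists C : R, forall N, (0 < N)%N ->
     `|scalar_of (imap_value (A0 N) M)| <= C%:C%C).
Variables (J : finType) (col : J -> bool) (k : J -> nat).
Hypothesis k0 : forall j, (0 < k j)%N.
Variable p : forall j, lincomb R (@two_order I0 ell0 (col j)) (k j).
Arguments p : clear implicits.
Hypothesis pc : forall j, all (fun t => connected_map (imap_map t.2)) (p j).

Definition jtensor N (X : 'M[cplx R]_N) j : tensor R N (k j) :=
  lincomb_value (@two_families R N I0 ell0 (A0 N) X (col j)) (p j).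
Arguments jtensor : clear implicits.

Section Monochromatic.
Variable c : bool.

(** The type of [p j] depends on the colour of [j]. For a map of one colour [c] it is transported to
    that colour; the empty combinations at the other indices are not met on such a map. *)
Definition recolour j : lincomb R (@two_order I0 ell0 c) (k j) :=
  if col j =P c is ReflectT e then
    eq_rect (col j) (fun c => lincomb R (@two_order I0 ell0 c) (k j)) (p j) c e
  else [::].

Lemma recolour_connected j : all (fun t => connected_map (imap_map t.2)) (recolour j).
Proof.
rewrite /recolour; case: eqP => // e; move: (pc j); move: (p j).
by case: c / e.
Qed.

Lemma recolour_value N (X : 'M[cplx R]_N) j : col j = c ->
  lincomb_value (@two_families R N I0 ell0 (A0 N) X c) (recolour j) = jtensor N X j.
Proof.
rewrite /recolour /jtensor; case: eqP => // e _; move: (p j).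
by case: c / e.
Qed.

Lemma fine_bounded_colour : fine_bounded (fun N (x : forall i, tensor R N (@two_order I0 ell0 c i)) =>
  exists2 X : 'M[cplx R]_N, unitary_group X & x = @two_families R N I0 ell0 (A0 N) X c).
Proof.
case: c => H G a ma; first exact: (@fine_unitary R I0 ell0 A0 H G a ma).
have [K hK] := fine_deterministic A0J A1 (H1 := H) G ma.
by exists K => N x N0 [X _ ->]; apply: hK.
Qed.

Lemma mono_bounded (H : finType) (G : gmap k H) (a : {perm H}) : matching a ->
  (forall h, col (glab G h) = c) ->
  exists K : R, forall N (X : 'M[cplx R]_N), (0 < N)%N -> unitary_group X ->
    nm (gval (jtensor N X) G a) <= K.
Proof.
move=> ma Gc.
have [K hK] := coarse_bounded G fine_bounded_colour k0 recolour_connected ma.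
exists K => N X N0 XU.
have -> : gval (jtensor N X) G a = gval (fun j =>
    lincomb_value (@two_families R N I0 ell0 (A0 N) X c) (recolour j)) G a.
  rewrite /gval /contract; congr (_ / _); apply: eq_bigr => i _.
  by apply: eq_bigr => h _; rewrite /gloc recolour_value.
by apply: hK => //; exists X.
Qed.

End Monochromatic.

(** Without bichromatic edges the map is the disjoint union of its parts of each colour, and its
    value is the product of theirs. *)
Lemma achromatic_bounded (H : finType) (G : gmap k H) (a : {perm H}) : matching a ->
  (forall h, col (glab G (a h)) = col (glab G h)) ->
  exists K : R, forall N (X : 'M[cplx R]_N), (0 < N)%N -> unitary_group X ->
    nm (gval (jtensor N X) G a) <= K.
Proof.
move=> ma ac; pose K h := col (glab G h).
have Kp h : K (gpi G h) = K h by rewrite /K glab_pi.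
have Kp' h : ~~ K (gpi G h) = ~~ K h by rewrite Kp.
have Ka' h : ~~ K (a h) = ~~ K h by rewrite /K ac.
have [C1 h1] := @mono_bounded true _ (sub_gmap Kp) (sub_perm (K := K) ac)
  (matching_sub _ ma) (fun h => valP h).
have [C2 h2] := @mono_bounded false _ (sub_gmap (K := fun h => ~~ K h) Kp')
  (sub_perm (K := fun h => ~~ K h) Ka') (matching_sub _ ma) (fun h => negbTE (valP h)).
exists (C1 * C2) => N X N0 XU.
rewrite (@gval_partition R J k N (jtensor N X) H G a K Kp ac Kp' Ka') nmM.
by apply: ler_pM; rewrite ?nm_ge0 ?h1 ?h2.
Qed.

(** The hypothesis on [U] is a disjunction for each N, so the group may vary with N. *)
Definition Gr N : set 'M[cplx R]_N :=
  if pselect (haar_distributed (P N) (@unitary_group R N) (U N))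
  then @unitary_group R N else @orthogonal_group R N.
Arguments Gr : clear implicits.

Lemma Gr_haar N : (0 < N)%N -> haar_distributed (P N) (Gr N) (U N).
Proof. by rewrite /Gr; case: pselect => // no /haarU[]. Qed.

Lemma Gr_subgroup N : unitary_subgroup (Gr N).
Proof.
rewrite /Gr; case: (pselect _) => h; first exact: unitary_group_subgroup.
exact: orthogonal_group_subgroup.
Qed.

Definition mean N (F : 'M[cplx R]_N -> cplx R) : cplx R := Ex (P N) (Gr N) (U N) F.

Lemma der_jtensor N (a b : 'I_N) j (t : {ffun 'I_(k j) -> 'I_N}) :
  der a b (fun X => jtensor N X j t)
    (fun X => if col j then \sum_s lie_term (jtensor N X j) a b t s else 0).
Proof. exact: der_lincomb_value. Qed.

Lemma polf_gphi N (H : finType) (G : gmap k H) i : (0 < N)%N ->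
  polf (fun X => gphi G (jtensor N X) i).
Proof.
(* Only the polynomial character is wanted, so the degenerate plane [(a, a)] will do. *)
move=> N0; pose a := Ordinal N0.
have [] := der_polf (der_gphi (col := col) (x := jtensor N) (@der_jtensor N a a) G i).
by [].
Qed.

Lemma polf_gval N (H : finType) (G : gmap k H) a : (0 < N)%N ->
  polf (fun X => gval (jtensor N X) G a).
Proof.
move=> N0; apply: polf_mul; last exact: polf_const.
by apply: polf_sum => i; apply: polf_gphi.
Qed.

Definition mean_tensor (H : finType) (G : gmap k H) N (i : {ffun H -> 'I_N}) : cplx R :=
  mean (fun X => gphi G (jtensor N X) i).

Lemma mean_lie (H : finType) (G : gmap k H) N : (0 < N)%N ->
  lie_invariant (@mean_tensor H G N) (fun l => col (glab G l)).
Proof.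
move=> N0 a b i; have hU := Gr_haar N0; have [mG GU GM GA GO] := Gr_subgroup N.
have [->|ab] := eqVneq a b; first by apply: big1 => l _; rewrite /lie_term subrr.
have dG := der_gphi (col := col) (x := jtensor N) (@der_jtensor N a b) G i.
rewrite -[RHS](mean_der ab hU mG GU GM GA GO dG).
have pl l : polf (fun X => lie_term (gphi G (jtensor N X)) a b i l).
  by apply: polf_add; [|apply: polf_opp]; apply: polf_muln; apply: polf_gphi.
rewrite (Ex_sum hU mG GU) //. apply: eq_bigr => l _.
have E c (n : bool) : mean_tensor G (upd i l c) *+ n =
    Ex (P N) (Gr N) (U N) (fun X => n%:R * gphi G (jtensor N X) (upd i l c)).
  by rewrite (Ex_scale hU mG GU) ?mulr_natl //; apply: polf_gphi.
rewrite /lie_term !E -mulN1r -(Ex_scale hU mG GU (-1)) -?(Ex_add hU mG GU).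
- by apply: Ex_eq => X _; rewrite !mulr_natl mulN1r.
- by apply: polf_mul; [exact: polf_const | exact: polf_gphi].
- by apply: polf_mul; [exact: polf_const|]; apply: polf_mul; [exact: polf_const | exact: polf_gphi].
- by apply: polf_mul; [exact: polf_const | exact: polf_gphi].
Qed.

Lemma mean_nval (H : finType) (G : gmap k H) a N : (0 < N)%N ->
  nval (gpi G) (@mean_tensor H G) N a = mean (fun X => gval (jtensor N X) G a).
Proof.
move=> N0; have hU := Gr_haar N0; have [mG GU _ _ _] := Gr_subgroup N.
rewrite /nval /gval /mean.
under [RHS]Ex_eq => X _ do rewrite mulrC.
rewrite (Ex_scale hU mG GU); last by apply: polf_sum => i; apply: polf_gphi.
rewrite mulrC; congr (_ * _); rewrite (Ex_sum hU mG GU) // => i.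
exact: polf_gphi.
Qed.

Lemma mean_bigO (H : finType) (G : gmap k H) a : matching a ->
  bigO (nval (gpi G) (@mean_tensor H G) ^~ a).
Proof.
apply: (nval_bounded (mean_lie G)) => b mb bc.
have [K hK] := achromatic_bounded mb bc.
exists (2 * K), 1%N => N N0; rewrite mean_nval //.
have hU := Gr_haar N0; have [mG GU _ _ _] := Gr_subgroup N.
apply: (Ex_bound hU mG GU) => [|X GX]; first exact: polf_gval.
by apply: hK => //; apply: GU.
Qed.

(** The squared modulus is the value of the disjoint union with the conjugate map, to which the
    bound on means applies. *)
Lemma second_moment_bigO (H : finType) (G : gmap k H) a : matching a ->
  exists (K : R) (N0 : nat), forall N, (N0 <= N)%N ->
    Ere (P N) (Gr N) (U N) (sqnm (fun X => gval (jtensor N X) G a)) <= K.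
Proof.
move=> ma; have mm : matching (sum_perm a a) by rewrite matching_sum ma.
have [K [N0 hK]] := mean_bigO (sum_gmap G (conj_gmap G)) mm.
exists K, N0.+1 => N NN; have Np : (0 < N)%N by apply: leq_trans NN.
have := hK N (ltnW NN); rewrite mean_nval //.
rewrite Ere_sqnm => h; apply: le_trans (ler_norm _) _.
apply: le_trans (nm_Re _) _; apply: le_trans h; rewrite le_eqVlt; apply/orP; left.
apply/eqP; congr nm; apply: Ex_eq => X _.
by rewrite gval_sum gval_conj.
Qed.

Lemma mean_mul_small (H1 H2 : finType) (G1 : gmap k H1) (G2 : gmap k H2) a1 a2 (K : R) :
  matching a2 ->
  (forall N (X : 'M[cplx R]_N), (0 < N)%N -> unitary_group X ->
    nm (gval (jtensor N X) G1 a1) <= K) ->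
  cvg0_in_probability P (fun N w => gval (jtensor N (U N w)) G1 a1) ->
  litO (fun N => mean (fun X : 'M[cplx R]_N =>
    gval (jtensor N X) G1 a1 * gval (jtensor N X) G2 a2)).
Proof.
move=> m2 bK /cvg0_in_probabilityP small e e0.
have [B [N1 hB]] := second_moment_bigO G2 m2.
have B1 : 0 < `|B| + 1 by rewrite ltr_wpDl.
(* This weight leaves at most [e / 2] to the second factor. The second moment of the first must then
   be at most [t * e / 2], shared equally between the threshold [x] and the probability of exceeding
   it. *)
pose t := e / 2 / (`|B| + 1); have t0 : 0 < t by rewrite !divr_gt0.
have te : 0 < t * e / 4 by rewrite divr_gt0 // mulr_gt0.
pose x := Num.min 1 (t * e / 4).
have x0 : 0 < x by rewrite lt_min ltr01.
have K1 : 0 < K ^+ 2 + 1 by rewrite ltr_wpDl // sqr_ge0.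
have [N2 hN] := small x (t * e / 4 / (K ^+ 2 + 1)) x0 (divr_gt0 te K1).
exists (maxn (maxn N1 N2) 1) => N; rewrite !geq_max => /andP[/andP[n1 n2] N0].
have hU := Gr_haar N0; have [mG GU _ _ _] := Gr_subgroup N.
have pF1 := polf_gval G1 a1 N0; have pF2 := polf_gval G2 a2 N0.
apply: le_trans (Ex_cauchy hU mG GU pF1 pF2 t0) _.
have h1 := second_moment_split hU mG GU pF1 x0 (fun X GX => bK N X N0 (GU X GX)).
have h2 := hB N n1; have h3 := hN N n2.
have x1 : x ^+ 2 <= t * e / 4.
  apply: (@le_trans _ _ x); last by rewrite ge_min lexx orbT.
  by rewrite expr2 ler_piMr ?(ltW x0) // ge_min lexx.
have h4 : K ^+ 2 * fine (P N [set w | (x%:C)%C <= `|gval (jtensor N (U N w)) G1 a1|]) <= t * e / 4.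
  apply: (@le_trans _ _ (K ^+ 2 * (t * e / 4 / (K ^+ 2 + 1)))).
    by rewrite ler_wpM2l ?sqr_ge0.
  rewrite mulrCA ler_piMr ?(ltW te) // ler_pdivrMr // mul1r lerDl //.
have h5 : t^-1 * Ere (P N) (Gr N) (U N) (sqnm (fun X => gval (jtensor N X) G1 a1)) <= e / 2.
  rewrite mulrC ler_pdivrMr //; apply: le_trans h1 _; apply: le_trans (lerD x1 h4) _.
  lra.
have h6 : t * Ere (P N) (Gr N) (U N) (sqnm (fun X => gval (jtensor N X) G2 a2)) <= e / 2.
  apply: (@le_trans _ _ (t * (`|B| + 1))); last by rewrite /t divfK // gt_eqF.
  rewrite ler_wpM2l ?(ltW t0) //; apply: le_trans h2 _; apply: le_trans (ler_norm _) _.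
  by rewrite lerDl.
lra.
Qed.

Section ComponentGmap.
Variables (M : imap k 0) (Mh : cmap (halfedges M)) (h : 'I_(halfedges M)).
Hypothesis vM : vperm Mh = vperm M.

Let pE i : vperm Mh (enum_val i) = enum_val (vperm (component Mh h) i).
Proof. by rewrite component_vpermE. Qed.

Let clab (i : 'I_#|Defs.comp Mh h|) := lab (i := M) (enum_val i).

Let clab_pi i : clab (vperm (component Mh h) i) = clab i.
Proof. by rewrite /clab -pE vM lab_vperm. Qed.

Let cdeg i : #|porbit (vperm (component Mh h)) i| = k (clab i).
Proof. by rewrite -(card_porbit_embed (@enum_val_inj _ _) pE) vM lab_deg. Qed.

Definition component_gmap : gmap k 'I_#|Defs.comp Mh h| :=
  GMap (gflag := fun=> false) clab_pi (fun=> erefl) cdeg (vroot_ex (component Mh h))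
    (@vroot_uniq _ (component Mh h)).

Lemma component_gval N (x : forall j, tensor R N (k j)) :
  scalar_of (trace_action x (component Mh h) clab [tuple]) =
  gval x component_gmap (einv (component Mh h)).
Proof.
rewrite /scalar_of /trace_action /gval mulrC; congr (_ / _).
apply: eq_bigl => i; rewrite andb_idr // => _; apply/forallP => -[].
by [].
Qed.

Let K x := x \notin Defs.comp Mh h.

Let Kp x : K (gpi (gmap_of_imap false M) x) = K x.
Proof. by rewrite /K /= -vM comp_gcomp !gcomp_memE gcomp_p. Qed.

Let Ka x : K (einv Mh x) = K x.
Proof. by rewrite /K comp_gcomp !gcomp_memE gcomp_a. Qed.

Definition rest_gmap := sub_gmap (G := gmap_of_imap false M) Kp.
Definition rest_einv := sub_perm Ka.

Lemma rest_matching : in_M0 Mh -> matching rest_einv.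
Proof. by move=> /einv_matching; apply: matching_sub. Qed.

Lemma component_split N (x : forall j, tensor R N (k j)) :
  gval x (gmap_of_imap false M) (einv Mh) =
  gval x component_gmap (einv (component Mh h)) * gval x rest_gmap rest_einv.
Proof.
apply: (gval_split (G1 := component_gmap) (G2 := rest_gmap) (f1 := enum_val) (f2 := val))
  => //.
- exact: enum_val_inj.
- by move=> i u; apply: contraNneq (valP u) => <-; apply: enum_valP.
- move=> z; case: (boolP (z \in Defs.comp Mh h)) => hz; [left|right].
    by exists (enum_rank_in hz z); rewrite enum_rankK_in.
  by exists (exist _ z hz).
- by move=> i; rewrite /= -vM pE.
- by move=> i; rewrite component_einvE.
- by move=> u; rewrite (sub_permE Kp).
- by move=> u; rewrite (sub_permE Ka).
- by move=> i; rewrite /= vroot_component /vroot vM.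
Qed.

End ComponentGmap.

Theorem free_in_probability (M : imap k 0) :
  (forall Mhat, admissible_descendant (fun h => col (lab (i := M) h)) M Mhat ->
     exists h : 'I_(halfedges M),
       minimal_non_mono (fun h => col (lab (i := M) h)) Mhat h \/
       (monochromatic (fun h => col (lab (i := M) h)) Mhat h /\
        cvg0_in_probability P (fun N w =>
          scalar_of (trace_action (jtensor N (U N w)) (component Mhat h)
                    (fun i => lab (i := M) (enum_val i)) [tuple])))) ->
  cvg0_in_probability P (fun N w => scalar_of (imap_value (jtensor N (U N w)) M)).
Proof.
move=> adm.
have M0 : in_M0 M.
  apply/eqP/setP => h; rewrite -(@bndE _ _ _ M h) inE.
  by case: (bnd M) => -[].
pose GM := gmap_of_imap false M; pose G2 := conj_gmap GM.
have mM := einv_matching M0.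
pose phi := @mean_tensor _ (sum_gmap GM G2).
have phiL N : (0 < N)%N -> lie_invariant (phi N)
   (fun z : 'I_(halfedges M) + 'I_(halfedges M) =>
      match z with inl x => col (lab (i := M) x) | inr y => col (lab (i := M) y) end).
  move=> N0 a b i; rewrite -[RHS](mean_lie (sum_gmap GM G2) N0 a b i).
  by apply: eq_bigl => -[].
have vE Mh N : (0 < N)%N ->
    nval (sum_perm (vperm M) (vperm M)) phi N (sum_perm (einv Mh) (einv M)) =
    mean (fun X => gval (jtensor N X) GM (einv Mh) * gval (jtensor N X) G2 (einv M)).
  move=> N0; rewrite -[LHS]/(nval (gpi (sum_gmap GM G2)) _ _ _) mean_nval //.
  by apply: Ex_eq => X _; rewrite gval_sum.
have small : litO (nval (sum_perm (vperm M) (vperm M)) phi ^~ (sum_perm (einv M) (einv M))).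
  (* The conjugate copy of [M] plays the part of the spectators. *)
  apply: (descent (M := M) phiL) => //.
  - by move=> b mb; apply: (mean_bigO (sum_gmap GM G2)).
  - by move=> x; rewrite lab_vperm.
  move=> Mh aMh; have [le _ _] := aMh; have [vM Mh0] := map_le_vperm M0 le.
  have [h [hmin|[mono hP]]] := adm _ aMh; [by left; exists h | right].
  have mh : matching (einv (component Mh h)) by apply/einv_matching/component_in_M0.
  have [K hK] := @mono_bounded (col (lab (i := M) h)) _ (component_gmap h vM) _ mh
     (fun i => mono _ (enum_valP i)).
  have mR : matching (sum_perm (rest_einv Mh h) (einv M)).
    by rewrite matching_sum rest_matching.
  have hP' : cvg0_in_probability P (fun N w =>
      gval (jtensor N (U N w)) (component_gmap h vM) (einv (component Mh h))).
    by move=> e e0; have := hP e e0; under [X in X @ \oo --> _ -> _]eq_fun => N do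
      under eq_set => w do rewrite (component_gval h vM).
  (* The second factor gathers the rest of the descendant and the conjugate of [M]. *)
  have := mean_mul_small (sum_gmap (rest_gmap h vM) G2) mR hK hP'.
  apply: (@litO_le _ _ _ 1 1) => N N0; rewrite mul1r vE //.
  rewrite le_eqVlt; apply/orP; left; apply/eqP; congr nm; apply: Ex_eq => X _.
  by rewrite (component_split h vM) gval_sum mulrA.
apply: cvg0_in_probability_of_bound => e dl e0 dl0.
(* By Chebyshev's inequality a second moment of at most [dl * e ^+ 2] gives a probability of at most
   [dl]. *)
have [N0 hN] := small (dl * e ^+ 2) (mulr_gt0 dl0 (exprn_gt0 2 e0)).
exists (maxn N0 1) => N; rewrite geq_max => /andP[n0 n1].
have hU := Gr_haar n1; have [mG GU _ _ _] := Gr_subgroup N.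
have pF := polf_gval GM (einv M) n1.
have -> : [set w | ((e%:C)%C <= `|scalar_of (imap_value (jtensor N (U N w)) M)|)%R] =
   [set w | ((e%:C)%C <= `|gval (jtensor N (U N w)) GM (einv M)|)%R].
  by apply/seteqP; split=> w /=; rewrite imap_value0E.
apply: le_trans (chebyshev_large hU mG GU pF e0) _.
rewrite lee_fin ler_pdivrMl ?exprn_gt0 // mulrC Ere_sqnm.
apply: le_trans (ler_norm _) _; apply: le_trans (nm_Re _) _.
apply: le_trans (hN N n0); rewrite vE // le_eqVlt; apply/orP; left.
by apply/eqP; congr nm; apply: Ex_eq => X _; rewrite gval_conj.
Qed.

End Assembly.

Local Close Scope classical_set_scope.
Local Close Scope sesquilinear_scope.

Theorem theorem3 (R : realType) (d : nat -> measure_display)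
    (T : forall N, measurableType (d N)) (P : forall N, probability (T N) R)
    (U : forall N, T N -> 'M[cplx R]_N)
    (I0 : finType) (ell0 : I0 -> nat)
    (A0 : forall N (i : I0), tensor R N (ell0 i)) :
  (forall N, (0 < N)%N ->
     haar_distributed (P N) (@unitary_group R N) (U N) \/
     haar_distributed (P N) (@orthogonal_group R N) (U N)) ->
  (forall i, (0 < ell0 i)%N) ->
  (forall N, (0 < N)%N -> stable_under_conj (A0 N)) ->
  (forall M : imap ell0 0, exists C : R, forall N, (0 < N)%N ->
     `|scalar_of (imap_value (A0 N) M)| <= C%:C%C) ->
  asymptotically_free_in_probability P
    (fun N w => two_families (A0 N) (U N w)).
Proof.
move=> haarU _ A0J A1 J col k k0 p pc M colour pA adm.
exact: (free_in_probability haarU A0J A1 k0 pc adm).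
Qed.
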